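(* Let $R$ be an involutive R-matrix with rescaled Thoma parameters $(a,b)$, let $n\in\mathbb{N}$ and let $\lambda$ be a partition of $n$. The multiplicity of the irreducible $S_n$-representation associated to $\lambda$ in $\rho_R^{(n)}$ is $$\langle\lambda,\rho_R^{(n)}\rangle=\left[(1\otimes\omega)\circ\Delta(\mathsf{s}_\lambda)\right](a,b).$$ Further, let $\ell(a),\ell(b)$ be the respective lengths of $a$ and $b$. Then $\langle\lambda,\rho_R^{(n)}\rangle=0$ if and only if the Young diagram of $\lambda$ contains a rectangle of height $\ell(a)+1$ and width $\ell(b)+1$. If $\lambda$ contains a rectangle of height $\ell(a)$ and width $\ell(b)$ (but not one of respective height and width $\ell(a)+1,\ell(b)+1$), then $$\langle\lambda,\rho_R^{(n)}\rangle=\mathsf{s}_\mu(a)\,\mathsf{s}_\nu(b)\prod_{i=1}^{\ell(a)}\prod_{j=1}^{\ell(b)}(a_i+b_j),$$ where $\mu,\nu$ are the partitions with parts $\mu_i=\lambda_i-\ell(b)$, $i=1,\dots,\ell(a)$, and $\nu_j=\lambda'_j-\ell(a)$, $j=1,\dots,\ell(b)$.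
   Context: $\mathbb{N}=\{1,2,\dots\}$. An involutive R-matrix with base space $V$ (a nonzero finite-dimensional complex Hilbert space) and dimension $d=\dim V$ is a unitary $R\in\mathrm{End}(V\otimes V)$ with $R^2=1$ satisfying $(R\otimes \mathrm{id}_V)(\mathrm{id}_V\otimes R)(R\otimes \mathrm{id}_V)=(\mathrm{id}_V\otimes R)(R\otimes \mathrm{id}_V)(\mathrm{id}_V\otimes R)$. It defines unitary representations $\rho_R^{(n)}$ of $S_n$ on $V^{\otimes n}$, $n\in\mathbb{N}$, by sending $(k,k+1)$ to $\mathrm{id}_V^{\otimes(k-1)}\otimes R\otimes\mathrm{id}_V^{\otimes(n-k-1)}$. The character $\chi_R(\sigma)=d^{-n}\mathrm{Tr}_{V^{\otimes n}}(\rho_R^{(n)}(\sigma))$, $\sigma\in S_n$, is an extremal character of $S_\infty=\bigcup_nS_n$; its Thoma parameters are the unique real sequences $\alpha_1\ge\alpha_2\ge\dots\ge0$, $\beta_1\ge\beta_2\ge\dots\ge0$ with $\sum_i\alpha_i+\sum_i\beta_i\le1$ and $\chi_R(c_n)=\sum_i\alpha_i^n+(-1)^{n+1}\sum_i\beta_i^n$ on $n$-cycles $c_n$, $n\ge2$. The rescaled Thoma parameters are $a_i=d\alpha_i$, $b_i=d\beta_i$; these are non-negative integers, finitely many non-zero, with total sum $d$, so $a$ and $b$ (non-zero entries) are partitions; $\ell$ denotes the number of non-zero parts. The irreducible representation of $S_n$ associated to $[n]$ is the trivial one, that associated to $[1^n]$ the alternating one. $\Lambda$ is the ring of symmetric functions,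 $\mathsf{s}_\lambda$ the Schur functions; $\lambda'$ is the conjugate partition. $\omega:\Lambda\to\Lambda$ is the ring involution with $\omega(\mathsf{s}_\lambda)=\mathsf{s}_{\lambda'}$ (exchanging elementary and complete symmetric functions). $\Delta:\Lambda\to\Lambda\otimes\Lambda$ is the coproduct $f(x)\mapsto f(x,y)$ splitting the alphabet of variables into two. For $F\in\Lambda\otimes\Lambda$, $F(a,b)$ is obtained by evaluating the first tensor factor at the variables $a_1,a_2,\dots$ and the second at $b_1,b_2,\dots$ (remaining variables zero). Diagrams are drawn with row $i$ of length $\lambda_i$; a rectangle of height $h$ and width $w$ is the diagram with $h$ rows of length $w$. *)

(* Defs.v *)
From HB Require Import structures.
From mathcomp Require Import all_boot all_order all_algebra all_fingroup all_character.
From mathcomp Require Import mpoly complex zify.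
From mathcomp Require Import boolp reals ereal topology normedtype sequences.

Set Implicit Arguments.
Unset Strict Implicit.
Unset Printing Implicit Defensive.

Import Order.TTheory GRing.Theory Num.Theory.
Import numFieldNormedType.Exports.

Local Open Scope ring_scope.


Definition is_part (la : seq nat) : bool := sorted geq la && (0%N \notin la).

Definition is_part_of (n : nat) (la : seq nat) : bool :=
  is_part la && (sumn la == n).

Definition conj_part (la : seq nat) : seq nat :=
  [seq count (fun r => j < r)%N la | j <- iota 0 (head 0%N la)].

Definition in_diagram (la : seq nat) (i j : nat) : bool := (j < nth 0 la i)%N.

Definition contains_rect (la : seq nat) (h w : nat) : Prop :=
  forall i j, in_diagram (nseq h w) i j -> in_diagram la i j.

(* The partition whose i-th part, i < l, is la_i - c. *)
Definition shift_part (la : seq nat) (l c : nat) : seq nat :=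
  [seq r <- [seq (nth 0 la i - c)%N | i <- iota 0 l] | (0 < r)%N].

Section SymFun.
Variable A : comNzRingType.

(* Set the variables X_i, i >= N, to 0. *)
Definition mrestr (N M : nat) : {mpoly A[M]} -> {mpoly A[N]} :=
  mmap (@mpolyC N A)
    (fun i : 'I_M => oapp (fun j : 'I_N => 'X_j) 0 (insub (val i))).

(* The ring of symmetric functions as a graded inverse limit: a symmetric
   function is a compatible family of symmetric polynomials F N in N variables,
   N = 0, 1, 2, ..., of bounded degree. *)
Record is_symfun (F : forall N, {mpoly A[N]}) : Prop := IsSymFun {
  symfun_sym : forall N, F N \is symmetric;
  symfun_stable : forall N M, (N <= M)%N -> mrestr N (F M) = F N;
  symfun_bound : exists D, forall N, (msize (F N) <= D)%N }.

Record symfun := SymFun {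
  sf_val :> forall N, {mpoly A[N]};
  sf_valP : is_symfun sf_val }.

Lemma msizeM_leq N (p q : {mpoly A[N]}) e f :
  (msize p <= e.+1)%N -> (msize q <= f.+1)%N -> (msize (p * q) <= (e + f).+1)%N.
Proof.
move=> hp hq; rewrite msizeE; apply/bigmax_leqP_seq => m + _.
move/msuppM_le/allpairsP => [[m1 m2] /= [h1 h2 ->]].
rewrite mdegD ltnS leq_add //.
  by rewrite -ltnS (leq_trans (msize_mdeg_lt h1)).
by rewrite -ltnS (leq_trans (msize_mdeg_lt h2)).
Qed.

Lemma is_symfunC (c : A) : is_symfun (fun N => c%:MP).
Proof.
split=> [N|N M _|].
- by apply/issymP => s; rewrite /msym mmapC.
- exact: mmapC.
- by exists 1%N => N; rewrite mmeasureC; case: (c != 0).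
Qed.

Lemma is_symfunD F G :
  is_symfun F -> is_symfun G -> is_symfun (fun N => F N + G N).
Proof.
move=> [sF rF [dF bF]] [sG rG [dG bG]]; split=> [N|N M le_NM|].
- exact: rpredD (sF N) (sG N).
- by rewrite [LHS]rmorphD /= -/(mrestr _ _) (rF _ _ le_NM) -/(mrestr _ _) rG.
- exists (maxn dF dG) => N; apply: leq_trans (msizeD_le _ _) _.
  by rewrite geq_max !leq_max bF bG orbT.
Qed.

Lemma is_symfunM F G :
  is_symfun F -> is_symfun G -> is_symfun (fun N => F N * G N).
Proof.
move=> [sF rF [dF bF]] [sG rG [dG bG]]; split=> [N|N M le_NM|].
- exact: rpredM (sF N) (sG N).
- by rewrite [LHS]rmorphM /= -/(mrestr _ _) (rF _ _ le_NM) -/(mrestr _ _) rG.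
- exists (dF + dG).+1 => N; apply: msizeM_leq; exact: leqW.
Qed.

Lemma eq_is_symfun F G : (forall N, F N = G N) -> is_symfun F -> is_symfun G.
Proof.
move=> eFG [sF rF [d bF]]; split=> [N|N M le_NM|]; rewrite -?eFG //.
  exact: rF.
by exists d => N; rewrite -eFG.
Qed.

Lemma is_symfun_sum (I : Type) (r : seq I) (F : I -> forall N, {mpoly A[N]}) :
  (forall i, is_symfun (F i)) -> is_symfun (fun N => \sum_(i <- r) F i N).
Proof.
move=> sF; elim: r => [|i r IHr].
  by apply: eq_is_symfun (is_symfunC 0) => N; rewrite big_nil.
by apply: eq_is_symfun (is_symfunD (sF i) IHr) => N; rewrite big_cons.
Qed.

Lemma is_symfun_prod (I : Type) (r : seq I) (F : I -> forall N, {mpoly A[N]}) :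
  (forall i, is_symfun (F i)) -> is_symfun (fun N => \prod_(i <- r) F i N).
Proof.
move=> sF; elim: r => [|i r IHr].
  by apply: eq_is_symfun (is_symfunC 1) => N; rewrite big_nil.
by apply: eq_is_symfun (is_symfunM (sF i) IHr) => N; rewrite big_cons.
Qed.

Lemma is_symfunX F k : is_symfun F -> is_symfun (fun N => F N ^+ k).
Proof.
move=> sF; apply: eq_is_symfun (is_symfun_prod (iota 0 k) (fun _ : nat => sF)).
by move=> N; rewrite big_const_seq count_predT size_iota iter_mulr_1.
Qed.

Definition hpoly (k N : nat) : {mpoly A[N]} :=
  \sum_(m : 'X_{1..N < k.+1} | mdeg m == k) 'X_[m].

Lemma mcoeff_hpoly k N (m : 'X_{1..N}) : (hpoly k N)@_m = (mdeg m == k)%:R.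
Proof.
rewrite /hpoly raddf_sum /=.
have [mk|mk] := boolP (mdeg m == k); last first.
  rewrite big1 // => i /eqP di; rewrite mcoeffX; case: eqP => // eim.
  by move: mk; rewrite -eim di eqxx.
have lt_mk : (mdeg m < k.+1)%N by rewrite (eqP mk).
rewrite (bigD1 (BMultinom lt_mk)) //= mcoeffX eqxx big1 ?addr0 // => i /andP[_ ne].
by rewrite mcoeffX; case: eqP => // eim; rewrite -val_eqE /= eim eqxx in ne.
Qed.

Lemma is_symfun_h k : is_symfun (hpoly k).
Proof.
split=> [N|N M le_NM|].
- apply/issymP => s; apply/mpolyP => m; rewrite mcoeff_sym !mcoeff_hpoly.
  congr (_ == _)%:R; rewrite !mdegE.
  by rewrite [RHS](reindex_inj (@perm_inj _ s)); apply: eq_bigr => i _; rewrite mnmE.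
- rewrite [LHS]rmorph_sum /=.
  pose pad (m : 'X_{1..N}) := [multinom oapp (fun j => m j) 0 (insub (val i)) | i < M].
  pose trc (m : 'X_{1..M}) := [multinom m (widen_ord le_NM i) | i < N].
  pose low (m : 'X_{1..M}) := [forall i : 'I_M, (N <= i)%N ==> (m i == 0)%N].
  have mrX (m : 'X_{1..M}) :
      mrestr N ('X_[m] : {mpoly A[M]}) = if low m then 'X_[trc m] else 0.
    rewrite /mrestr mmapX /mmap1; case: ifPn => [/fintype.forallP lo|].
      rewrite mpolyXE_id (bigID (fun i : 'I_M => (i < N)%N)) /= [X in _ * X]big1 ?mulr1.
        rewrite (big_ord_narrow le_NM) /=; apply: eq_bigr => i _.
        rewrite mnmE; case: insubP => [j _ ji|]; last by rewrite /= ltn_ord.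
        by rewrite /=; congr ('X_ _ ^+ _); apply: val_inj.
      move=> i; rewrite -leqNgt => le_Ni.
      by have := lo i; rewrite le_Ni /= => /eqP ->; rewrite expr0.
    case/fintype.forallPn => i; rewrite negb_imply => /andP[le_Ni mi].
    rewrite (bigD1 i) //= insubF ?ltnNge ?le_Ni //= expr0n (negbTE mi) mul0r //.
  under eq_bigr => m _ do rewrite -/(mrestr _ _) mrX.
  rewrite -big_mkcondr /=.
  have dpad m : mdeg (pad m) = mdeg m.
    rewrite !mdegE (bigID (fun i : 'I_M => (i < N)%N)) /= [X in (_ + X)%N]big1 ?addn0.
      rewrite (big_ord_narrow le_NM) /=; apply: eq_bigr => i _.
      rewrite mnmE; case: insubP => [j _ ji|]; last by rewrite /= ltn_ord.
      by rewrite /=; congr (m _); apply: val_inj.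
    by move=> i; rewrite -leqNgt => le_Ni; rewrite mnmE insubF // ltnNge le_Ni.
  have padK : cancel pad trc.
    move=> m; apply/mnmP => i; rewrite !mnmE /=.
    case: insubP => [j _ ji|]; last by rewrite /= ltn_ord.
    by rewrite /=; congr (m _); apply: val_inj.
  have trcK m : low m -> pad (trc m) = m.
    move/fintype.forallP => lo; apply/mnmP => i; rewrite !mnmE.
    case: insubP => [j _ ji|] /=; first by rewrite mnmE; congr (m _); apply: val_inj.
    by rewrite -leqNgt => le_Ni; have := lo i; rewrite le_Ni => /eqP.
  have lowpad m : low (pad m).
    by apply/fintype.forallP => i; apply/implyP => le_Ni; rewrite mnmE insubF // ltnNge le_Ni.
  have padB (m : 'X_{1..N < k.+1}) : (mdeg (pad m) < k.+1)%N by rewrite dpad bmdeg.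
  apply/mpolyP => m; rewrite mcoeff_hpoly raddf_sum /=.
  under eq_bigr do rewrite mcoeffX.
  have [mk|mk] := boolP (mdeg m == k); last first.
    rewrite big1 // => i /andP[/eqP di loi]; case: eqP => // eim; case/eqP: mk.
    by rewrite -eim -(dpad (trc i)) trcK.
  have lt_mk : (mdeg (pad m) < k.+1)%N by rewrite dpad (eqP mk).
  rewrite (bigD1 (BMultinom lt_mk)) /=; last by rewrite lowpad dpad mk.
  rewrite padK eqxx big1 ?addr0 // => i /andP[/andP[_ loi] ne].
  case: eqP => // eim; case/eqP: ne; apply: val_inj => /=.
  by rewrite -eim trcK.
- exists k.+1 => N; rewrite msizeE; apply/bigmax_leqP_seq => m + _.
  by rewrite mcoeff_msupp mcoeff_hpoly; have [->|] := eqVneq (mdeg m) k; rewrite ?eqxx.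
Qed.

(* Schur functions are given by the Jacobi-Trudi determinant
   det(h_(la_i - i + j)), where h_k = 0 for k < 0. *)
Definition JT_mx (la : seq nat) (N : nat) : 'M[{mpoly A[N]}]_(size la) :=
  \matrix_(i, j) if (i <= nth 0 la i + j)%N
                 then hpoly (nth 0%N la i + j - i) N else 0.

Lemma is_symfun_schur la : is_symfun (fun N => \det (JT_mx la N)).
Proof.
rewrite /determinant; apply: is_symfun_sum => s.
apply: (is_symfunM (F := fun N => (-1) ^+ s)).
  apply: eq_is_symfun (is_symfunC ((-1) ^+ s)) => N.
  by rewrite rmorphXn rmorphN1.
apply: is_symfun_prod => i.
apply: (@eq_is_symfun (fun N => if (i <= nth 0 la i + s i)%N
  then hpoly (nth 0%N la i + s i - i) N else 0)) => [N|]; first by rewrite mxE.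
by case: (_ <= _)%N; [exact: is_symfun_h | exact: is_symfunC 0].
Qed.

Definition schur (la : seq nat) : symfun := SymFun (is_symfun_schur la).

(* Compatibility of the family makes this the value at the variables listed in
   a, the remaining ones being zero. *)
Definition sf_eval (f : symfun) (a : seq A) : A :=
  (f (size a)).@[fun i => nth 0 a i].

Definition sf_deg (f : symfun) : nat := sval (cid (symfun_bound (sf_valP f))).

(* The ring morphism exchanging elementary and complete symmetric functions.
   Since D = sf_deg f bounds the degree of f, the fundamental theorem yields
   f = t(e_1, ..., e_D) with t = symf (f D), and omega f = t(h_1, ..., h_D).
   By omegaE below, the value does not depend on the choice of the bound D. *)
Definition omega_val (f : symfun) (N : nat) : {mpoly A[N]} :=
  symf (f (sf_deg f)) \mPo [tuple hpoly i.+1 N | i < sf_deg f].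

Lemma is_symfun_omega f : is_symfun (omega_val f).
Proof.
apply: eq_is_symfun (fun N => esym (comp_mpolyE _ _)) _.
apply: is_symfun_sum => m.
apply: eq_is_symfun (fun N => mul_mpolyC _ _) _.
apply: is_symfunM; first exact: is_symfunC.
apply: is_symfun_prod => i; apply: is_symfunX.
apply: eq_is_symfun (is_symfun_h i.+1) => N.
by rewrite tnth_mktuple.
Qed.

Definition omega (f : symfun) : symfun := SymFun (is_symfun_omega f).

End SymFun.

Lemma rmorph_mmap n (A : nzRingType) (B C : nzRingType) (g : {rmorphism B -> C})
    (f : A -> B) (h : 'I_n -> B) (p : {mpoly A[n]}) :
  g (mmap f h p) = mmap (g \o f) (g \o h) p.
Proof.
rewrite /mmap rmorph_sum; apply: eq_bigr => m _; rewrite rmorphM /mmap1 rmorph_prod.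
by congr (_ * _); apply: eq_bigr => i _; rewrite rmorphXn.
Qed.

Lemma eq_mmap n (A B : nzRingType) (f f' : A -> B) (h h' : 'I_n -> B)
    (p : {mpoly A[n]}) : f =1 f' -> h =1 h' -> mmap f h p = mmap f' h' p.
Proof.
move=> ef eh; apply: eq_bigr => m _; rewrite ef /mmap1; congr (_ * _).
by apply: eq_bigr => i _; rewrite eh.
Qed.

Section OmegaTheory.
Variable A : comNzRingType.

Lemma mrestr_mesym k N M : (N <= M)%N -> mrestr N (mesym M A k) = mesym N A k.
Proof.
move=> le_NM; rewrite /mesym [LHS]rmorph_sum /=.
pose w := widen_ord le_NM.
have w_inj : injective w by move=> i j /(congr1 val) /= /val_inj.
have mrX (i : 'I_N) : mrestr N ('X_(w i) : {mpoly A[M]}) = 'X_i.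
  rewrite /mrestr mmapX mmap1U; case: insubP => [j _ ji|]; last by rewrite /= ltn_ord.
  by rewrite /=; congr 'X_ _; apply: val_inj.
rewrite (bigID (fun h : {set 'I_M} => h \subset codom w)) /= addrC.
rewrite big1 ?add0r => [|h /andP[_ /subsetPn[i ih iw]]]; last first.
  rewrite -/(mrestr _ _) /mrestr rmorph_prod /= (bigD1 i) //= mmapX mmap1U insubF ?mul0r //.
  apply/negP => lt_i; case/negP: iw; apply/codomP.
  by exists (Ordinal lt_i); apply: val_inj.
rewrite (reindex_onto (fun h : {set 'I_N} => w @: h) (fun h => w @^-1: h)) /=; last first.
  move=> h /andP[_ /subsetP hw]; apply/setP => i; apply/imsetP/idP => [[j]|ih].
    by rewrite inE => jh ->.
  by have /codomP[j ij] := hw _ ih; exists j; rewrite // inE -ij.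
apply: eq_big => [h|h _].
  rewrite card_imset // -[RHS]andbT -andbA; congr (_ && _).
  rewrite (_ : _ \subset _); last by apply/subsetP => _ /imsetP[i _ ->]; apply: codom_f.
  by apply/eqP/setP => i; rewrite inE (mem_imset _ _ w_inj).
rewrite big_imset /=; last by move=> ? ? _ _; apply: w_inj.
by rewrite rmorph_prod; apply: eq_bigr => i _; apply: mrX.
Qed.

Lemma is_symfun_e k : is_symfun (fun N => mesym N A k).
Proof.
split=> [N|N M|]; [exact: mesym_sym|exact: mrestr_mesym|].
exists k.+1 => N; rewrite mesymE; apply: leq_trans (mmeasure_sum _ _ _ _) _.
by apply/bigmax_leqP => h /eqP <-; rewrite msizeX mdeg_mesym1.
Qed.

Definition sf_e (k : nat) : symfun A := SymFun (is_symfun_e k).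

Lemma symf_bound (f : symfun A) D D' N :
  (D <= D')%N -> (forall N, (msize (f N) <= D)%N) ->
  symf (f D') \mPo [tuple hpoly A i.+1 N | i < D'] =
  symf (f D) \mPo [tuple hpoly A i.+1 N | i < D].
Proof.
move=> le_D bf; have [sf rf _] := sf_valP f.
have e : mrestr D (symf (f D')) = symf (f D).
  apply: msym_fundamental_un; rewrite -symfP // -(rf _ _ le_D) {2}(symfP (sf D')).
  rewrite /mrestr [LHS]rmorph_mmap [RHS]rmorph_mmap; apply: eq_mmap => [c|i] /=.
    by rewrite comp_mpolyC mmapC.
  rewrite tnth_mktuple -/(mrestr _ _) mrestr_mesym //.
  case: insubP => [j _ ji|ge_i] /=; first by rewrite comp_mpolyXU -tnth_nth tnth_mktuple ji.
  by rewrite comp_mpoly0 mesym_geqnE // ltnS leqNgt.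
rewrite -e /mrestr [RHS]rmorph_mmap /comp_mpoly /mmap [LHS]big_seq [RHS]big_seq.
apply: eq_bigr => m mt /=; rewrite -/(comp_mpoly _ _) comp_mpolyC; congr (_ * _).
apply: eq_bigr => i _ /=; rewrite tnth_mktuple.
case: insubP => [j _ ji|ge_i] /=; first by rewrite comp_mpolyXU -tnth_nth tnth_mktuple ji.
have lt_m : (mnmwgt m < D)%N.
  apply: leq_trans (bf D'); apply: leq_trans (symfn_wgle _ (sf D')).
  exact: mmeasure_mnm_lt mt.
have mi : m i = 0%N.
  apply/eqP; rewrite -leqn0 leqNgt; apply/negP => mi.
  have : (m i * i.+1 <= mnmwgt m)%N by rewrite /mnmwgt (bigD1 i) //= leq_addr.
  by nia.
by rewrite mi !expr0.
Qed.

Lemma omegaE (f : symfun A) D N : (forall N, (msize (f N) <= D)%N) ->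
  omega f N = symf (f D) \mPo [tuple hpoly A i.+1 N | i < D].
Proof.
move=> bD; rewrite /= /omega_val.
have bf : forall N, (msize (f N) <= sf_deg f)%N by rewrite /sf_deg; case: cid.
case: (leqP (sf_deg f) D) => [|/ltnW] le_D; first by rewrite -(symf_bound _ le_D).
exact: symf_bound.
Qed.

Lemma omega_e k N : omega (sf_e k) N = hpoly A k N.
Proof.
have be M : (msize (sf_e k M) <= k.+1)%N.
  rewrite /= mesymE; apply: leq_trans (mmeasure_sum _ _ _ _) _.
  by apply/bigmax_leqP => h /eqP <-; rewrite msizeX mdeg_mesym1.
rewrite (omegaE _ be); case: k be => [|k] be.
  rewrite (_ : symf _ = 1); last first.
    apply: msym_fundamental_un; rewrite -symfP ?mesym_sym //= comp_mpoly1.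
    exact: mesym0E.
  rewrite comp_mpoly1; apply/mpolyP => m.
  by rewrite mcoeff_hpoly mcoeff1 mdeg_eq0.
pose k0 : 'I_k.+2 := inord k.
have k0E : k0 = k :> nat by rewrite inordK.
rewrite (_ : symf _ = 'X_k0); last first.
  apply: msym_fundamental_un; rewrite -symfP ?mesym_sym //=.
  by rewrite comp_mpolyXU -tnth_nth tnth_mktuple k0E.
by rewrite comp_mpolyXU -tnth_nth tnth_mktuple k0E.
Qed.
End OmegaTheory.

Section Coproduct.
Variable A : comNzRingType.

(* xy_subst p is p(x_1, ..., x_N, y_1, ..., y_M) as a polynomial in y with
   coefficients in A[x_1, ..., x_N]. *)
Definition xy_var (N M : nat) (i : 'I_(N + M)) : {mpoly {mpoly A[N]}[M]} :=
  match split i with inl j => ('X_j)%:MP | inr k => 'X_k end.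

Definition xy_subst (N M : nat) : {mpoly A[N + M]} -> {mpoly {mpoly A[N]}[M]} :=
  mmap (@mpolyC M {mpoly A[N]} \o @mpolyC N A) (@xy_var N M).

Lemma msizeXn_leq n (B : comNzRingType) (p : {mpoly B[n]}) e k :
  (msize p <= e.+1)%N -> (msize (p ^+ k) <= (k * e).+1)%N.
Proof.
move=> hp; elim: k => [|k IHk]; first by rewrite expr0 msize1.
by rewrite exprS mulSn msizeM_leq.
Qed.

Lemma msize_xy_subst N M (p : {mpoly A[N + M]}) :
  (msize (xy_subst p) <= msize p)%N.
Proof.
rewrite /xy_subst /mmap; apply: leq_trans (mmeasure_sum _ _ _ _) _.
apply/bigmax_leqP_seq => m /msize_mdeg_lt lt_m _; apply: leq_trans lt_m.
rewrite -[mdeg m]add0n; apply: msizeM_leq.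
  by rewrite /= mmeasureC; case: (_ != 0).
rewrite /mmap1 mdegE; elim/big_rec2: _ => [|i e p' _ hp]; first by rewrite msize1.
apply: msizeM_leq hp; rewrite -[X in (_ <= X.+1)%N]muln1; apply: msizeXn_leq.
rewrite /xy_var; case: (split i) => j; last by rewrite msizeX mdeg1.
by rewrite mmeasureC; case: (_ != 0).
Qed.

Lemma is_symfun_xy (f : symfun A) N :
  is_symfun (fun M => xy_subst (f (N + M)%N)).
Proof.
have [sf rf [D bf]] := sf_valP f.
split=> [M|M0 M le_M|].
- apply/issymP => s.
  pose t (i : 'I_(N + M)) : 'I_(N + M) :=
    match split i with inl j => lshift M j | inr k => rshift N (s k) end.
  have t_inj : injective t.
    apply: (can_inj (g := fun i : 'I_(N + M) =>
      match split i with inl j => lshift M j | inr k => rshift N (s^-1%g k) end)).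
    move=> i; rewrite /t; case: (split_ordP i) => j ->.
      by rewrite (unsplitK (inl j)).
    by rewrite (unsplitK (inr (s j))) permK.
  rewrite -[in RHS](issymP _ (sf (N + M)%N) (perm t_inj)).
  rewrite /xy_subst [LHS]rmorph_mmap [RHS]rmorph_mmap.
  apply: eq_mmap => [c|i] /=.
    by rewrite /msym mmapC [RHS]mmapC.
  rewrite [RHS]mmapX mmap1U permE /t /xy_var; case: (split_ordP i) => j _.
    by rewrite (unsplitK (inl j)) /msym mmapC.
  by rewrite (unsplitK (inr (s j))) /msym mmapX mmap1U.
- rewrite -(rf (N + M0)%N (N + M)%N) ?leq_add2l //.
  rewrite /xy_subst /mrestr [LHS]rmorph_mmap [RHS]rmorph_mmap.
  apply: eq_mmap => [c|i] /=; first by rewrite mmapC [RHS]mmapC.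
  rewrite {1}/xy_var; case: (split_ordP i) => j ->.
    rewrite mmapC insubT /=; first by rewrite ltn_addr.
    move=> lt_j; rewrite mmapX mmap1U /xy_var.
    rewrite (_ : Sub _ _ = lshift M0 j); last exact: val_inj.
    by rewrite (unsplitK (inl j)).
  rewrite mmapX mmap1U /=; case: insubP => [k lt_j kj|ge_j] /=.
    rewrite insubT /=; first by rewrite ltn_add2l.
    move=> lt_Nj; rewrite mmapX mmap1U /xy_var.
    rewrite (_ : Sub _ _ = rshift N k); last by apply: val_inj; rewrite /= kj.
    by rewrite (unsplitK (inr k)).
  by rewrite insubF ?raddf0 //= ltn_add2l; apply: negbTE.
- by exists D => M; apply: leq_trans (msize_xy_subst _) (bf _).
Qed.

(* The family f(x_1, ..., x_N, y), as a symmetric function in y. *)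
Definition xy_symfun (f : symfun A) (N : nat) : symfun {mpoly A[N]} :=
  SymFun (is_symfun_xy f N).

End Coproduct.

(* Elements of Lambda (x) Lambda are given, for every number N of variables of
   the first alphabet x, as symmetric functions in the second alphabet y with
   coefficients in A[x_1, ..., x_N]: f (x) g is the family f(x_1, ..., x_N) g(y)
   (tens below).  Extending scalars in omega makes it act on y alone, i.e., as
   1 (x) omega (id_tens_omega_tens below). *)
Definition tens_symfun (A : comNzRingType) := forall N, symfun {mpoly A[N]}.

Definition Delta (A : comNzRingType) (f : symfun A) : tens_symfun A := xy_symfun f.

Definition id_tens_omega (A : comNzRingType) (F : tens_symfun A) : tens_symfun A :=
  fun N => omega (F N).

Definition sf_eval2 (A : comNzRingType) (F : tens_symfun A) (a b : seq A) : A :=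
  (sf_eval (F (size a)) [seq c%:MP | c <- b]).@[fun i => nth 0 a i].


Section Tensor.
Variables (A : comNzRingType).

Section Map.
Variables (B : comNzRingType) (phi : {rmorphism A -> B}).

Lemma map_mrestr N M (p : {mpoly A[M]}) :
  mrestr N (map_mpoly phi p) = map_mpoly phi (mrestr N p).
Proof.
rewrite /mrestr /map_mpoly [LHS]rmorph_mmap [RHS]rmorph_mmap; apply: eq_mmap => [c|i] /=.
  by rewrite mmapC [RHS]mmapC.
rewrite mmapX mmap1U; case: insubP => [j _ _|_] /=; last by rewrite mmap0.
by rewrite mmapX mmap1U.
Qed.

Lemma is_symfun_map (c : B) (g : symfun A) :
  is_symfun (fun M => c *: map_mpoly phi (g M)).
Proof.
have [sg rg [D bg]] := sf_valP g.
apply: eq_is_symfun (fun M => mul_mpolyC _ _) _.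
apply: is_symfunM; first exact: is_symfunC.
split=> [M|N M le_NM|].
- apply/issymP => s; apply/mpolyP => m; rewrite mcoeff_sym !mcoeff_map_mpoly.
  by rewrite msym_coeff.
- by rewrite map_mrestr rg.
- exists D => M; apply: leq_trans (bg M); rewrite [X in (X <= _)%N]msizeE.
  apply/bigmax_leqP_seq => m + _; rewrite mcoeff_msupp mcoeff_map_mpoly => nz.
  apply: msize_mdeg_lt; rewrite mcoeff_msupp; apply: contraNneq nz => ->.
  by rewrite raddf0.
Qed.
End Map.

Definition tens (f g : symfun A) : tens_symfun A :=
  fun N => SymFun (is_symfun_map (@mpolyC N A) (f N) g).

Lemma id_tens_omega_tens (f g : symfun A) N M :
  id_tens_omega (tens f g) N M = tens f (omega g) N M.
Proof.
have [sg _ [D bg]] := sf_valP g.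
have bt M' : (msize (tens f g N M') <= D)%N.
  apply: leq_trans (bg M'); rewrite [X in (X <= _)%N]msizeE.
  apply/bigmax_leqP_seq => m + _; rewrite mcoeff_msupp /= mcoeffZ mcoeff_map_mpoly => nz.
  apply: msize_mdeg_lt; rewrite mcoeff_msupp; apply: contraNneq nz => ->.
  by rewrite raddf0 mulr0.
have mapC n k (t : {mpoly A[n]}) (l : n.-tuple {mpoly A[k]}) l' :
    (forall i, tnth l' i = map_mpoly (@mpolyC N A) (tnth l i)) ->
  map_mpoly (@mpolyC N A) (t \mPo l) = map_mpoly (@mpolyC N A) t \mPo l'.
  move=> el; rewrite /comp_mpoly /map_mpoly [LHS]rmorph_mmap [RHS]rmorph_mmap.
  apply: eq_mmap => [c|i] /=; first by rewrite mmapC [RHS]mmapC.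
  by rewrite mmapX mmap1U el.
have mapCe k n : map_mpoly (@mpolyC N A) (mesym n A k) = mesym n {mpoly A[N]} k.
  rewrite /mesym rmorph_sum; apply: eq_bigr => h _; rewrite rmorph_prod.
  by apply: eq_bigr => i _; apply: map_mpolyX.
have mapCh k n : map_mpoly (@mpolyC N A) (hpoly A k n) = hpoly {mpoly A[N]} k n.
  by rewrite /hpoly rmorph_sum; apply: eq_bigr => m _; apply: map_mpolyX.
have -> : tens f (omega g) N M = f N *: map_mpoly (@mpolyC N A) (omega g M) by [].
rewrite /id_tens_omega (omegaE _ bt) (omegaE _ bg).
rewrite (mapC _ _ _ _ [tuple hpoly {mpoly A[N]} i.+1 M | i < D]); last first.
  by move=> i; rewrite !tnth_mktuple mapCh.
rewrite -comp_mpolyZ; congr (_ \mPo _).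
apply: msym_fundamental_un; rewrite -symfP; last exact: symfun_sym (sf_valP _) _.
rewrite comp_mpolyZ -(mapC _ _ _ [tuple mesym D A i.+1 | i < D]).
  by rewrite -symfP.
by move=> i; rewrite !tnth_mktuple mapCe.
Qed.
End Tensor.

(* Coxeter presentation of the symmetric group: cox m relates words in the
   generators 0, ..., m - 1 that are equal modulo the Coxeter relations. *)
Inductive cox (m : nat) : seq nat -> seq nat -> Prop :=
| cox_refl w : cox m w w
| cox_sym w1 w2 : cox m w1 w2 -> cox m w2 w1
| cox_trans w1 w2 w3 : cox m w1 w2 -> cox m w2 w3 -> cox m w1 w3
| cox_ctx u v w1 w2 : cox m w1 w2 -> cox m (u ++ w1 ++ v) (u ++ w2 ++ v)
| cox_sq k : (k < m)%N -> cox m [:: k; k] [::]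
| cox_comm i j : (i.+1 < j)%N -> (j < m)%N -> cox m [:: i; j] [:: j; i]
| cox_braid k : (k.+1 < m)%N -> cox m [:: k; k.+1; k] [:: k.+1; k; k.+1].

Lemma cox_le m m' w1 w2 : (m <= m')%N -> cox m w1 w2 -> cox m' w1 w2.
Proof.
move=> le_m; elim=> {w1 w2} [w|w1 w2 _ IH|w1 w2 w3 _ IH1 _ IH2|u v w1 w2 _ IH|k|i j|k].
- exact: cox_refl.
- exact: cox_sym.
- exact: cox_trans IH1 IH2.
- exact: cox_ctx.
- by move=> lt; apply: cox_sq; apply: leq_trans le_m.
- by move=> ij lt; apply: cox_comm => //; apply: leq_trans le_m.
- by move=> lt; apply: cox_braid; apply: leq_trans le_m.
Qed.

Lemma cox_catl m u w1 w2 : cox m w1 w2 -> cox m (u ++ w1) (u ++ w2).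
Proof. by move/(cox_ctx u [::]); rewrite !cats0. Qed.

Lemma cox_catr m v w1 w2 : cox m w1 w2 -> cox m (w1 ++ v) (w2 ++ v).
Proof. exact: (@cox_ctx m [::]). Qed.

Lemma cox_far m i w : (i < m)%N -> all (fun j => (i.+1 < j < m)%N) w ->
  cox m (w ++ [:: i]) (i :: w).
Proof.
move=> lt_i; elim: w => [|j w IHw] /=; first by move=> _; apply: cox_refl.
case/andP => /andP[ij jm] /IHw; move/(cox_catl [:: j]) => /cox_trans; apply.
exact: (@cox_catr m w [:: j; i] [:: i; j]) (cox_sym (cox_comm ij jm)).
Qed.

Lemma cox_far' m i w : (i < m)%N -> all (fun j => (j.+1 < i)%N) w ->
  cox m (w ++ [:: i]) (i :: w).
Proof.
move=> lt_i; elim: w => [|j w IHw] /=; first by move=> _; apply: cox_refl.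
case/andP => ji /IHw; move/(cox_catl [:: j]) => /cox_trans; apply.
exact: (@cox_catr m w [:: j; i] [:: i; j]) (cox_comm ji lt_i).
Qed.

(* desc m j = [:: m.-1; ...; j] *)
Definition desc (m j : nat) := rev (iota j (m - j)).

Lemma desc_cat m j k : (j <= k <= m)%N -> desc m j = desc m k ++ desc k j.
Proof.
case/andP => jk km; rewrite /desc -rev_cat -[X in rev (_ ++ iota X _)](subnKC jk).
by rewrite -iotaD addnC addnBA // subnK.
Qed.

Lemma desc1 j : desc j.+1 j = [:: j].
Proof. by rewrite /desc subSnn. Qed.

Lemma desc1' j : (0 < j)%N -> desc j j.-1 = [:: j.-1].
Proof. by case: j => // j _; rewrite desc1. Qed.

Lemma descnn j : desc j j = [::].
Proof. by rewrite /desc subnn. Qed.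

Lemma mem_desc m j k : (k \in desc m j) = (j <= k < m)%N.
Proof. by rewrite mem_rev mem_iota; lia. Qed.

Lemma cox_desc m i j : (i < m)%N -> (j <= m)%N ->
  exists w' j', [/\ all (fun k => (k < m.-1)%N) w', (j' <= m)%N &
    cox m (desc m j ++ [:: i]) (w' ++ desc m j')].
Proof.
move=> im jm; case: (ltngtP i.+1 j) => [ij|ji|ij].
- exists [:: i], j; split=> //=; first by lia.
  apply: (@cox_far m i (desc m j)) => //; apply/allP => k; rewrite mem_desc; lia.
- case: (ltngtP j i) => [lt_ji|lt_ij|eq_ij].
  + exists [:: i.-1], j; split=> //=; first by lia.
    have e1 : desc m j = desc m i.+1 ++ [:: i; i.-1] ++ desc i.-1 j.
      rewrite (@desc_cat m j i.+1) ?(@desc_cat i.+1 j i) ?(@desc_cat i j i.-1); try lia.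
      by rewrite desc1 (desc1' (_ : 0 < i)%N) //; lia.
    rewrite {1}e1 -!catA.
    have c1 : cox m (desc i.-1 j ++ [:: i]) (i :: desc i.-1 j).
      by apply: cox_far' => //; apply/allP => k; rewrite mem_desc; lia.
    apply: cox_trans (cox_catl _ (cox_catl _ c1)) _.
    have c2 : cox m [:: i; i.-1; i] [:: i.-1; i; i.-1].
      have := @cox_braid m i.-1; rewrite prednK; last by lia.
      by move/(_ im)/cox_sym.
    have := cox_ctx (desc m i.+1) (desc i.-1 j) c2.
    rewrite /= => /cox_trans; apply.
    have c3 : cox m (desc m i.+1 ++ [:: i.-1]) (i.-1 :: desc m i.+1).
      by apply: cox_far; [lia|]; apply/allP => k; rewrite mem_desc; lia.
    have := cox_catr ([:: i; i.-1] ++ desc i.-1 j) c3.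
    by rewrite -catA /= e1.
  + by exfalso; lia.
  + exists [::], j.+1; split=> //=; first by lia.
    rewrite (@desc_cat m j j.+1) ?desc1; last by lia.
    rewrite -catA -eq_ij -[X in cox _ _ X]cats0; apply: cox_catl.
    by apply: cox_sq; lia.
- exists [::], i; split=> //=; first by lia.
  by rewrite (@desc_cat m i i.+1) ?desc1 -?ij //; [apply: cox_refl|lia].
Qed.

Lemma cox_nf m w : all (fun k => (k < m)%N) w ->
  exists w' j, [/\ all (fun k => (k < m.-1)%N) w', (j <= m)%N &
    cox m w (w' ++ desc m j)].
Proof.
elim/last_ind: w => [|w i IHw].
  move=> _; exists [::], m; split=> //=.
  by rewrite descnn; apply: cox_refl.
rewrite all_rcons => /andP[im /IHw[w' [j [aw jm cw]]]].
have [w2 [j' [aw2 jm' c2]]] := cox_desc im jm.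
exists (w' ++ w2), j'; split=> //; first by rewrite all_cat aw.
rewrite -cats1; apply: cox_trans (cox_catr _ cw) _.
by rewrite -!catA; apply: cox_catl.
Qed.

Definition swapn (k x : nat) : nat :=
  if x == k then k.+1 else if x == k.+1 then k else x.
Lemma swapnP k x :
  x = k /\ swapn k x = k.+1 \/ x = k.+1 /\ swapn k x = k \/
  x <> k /\ x <> k.+1 /\ swapn k x = x.
Proof. by rewrite /swapn; case: (x =P k); case: (x =P k.+1); tauto. Qed.

Ltac swapn_lia := repeat match goal with
  |- context[swapn ?k ?x] =>
     lazymatch x with
     | context[swapn _ _] => fail
     | _ => let y := fresh in have := swapnP k x; move: (swapn k x) => y
     end
  end; lia.

Definition wact (w : seq nat) (x : nat) : nat := foldl (fun y k => swapn k y) x w.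

Lemma wact_cat u v x : wact (u ++ v) x = wact v (wact u x).
Proof. exact: foldl_cat. Qed.

Lemma cox_wact m w1 w2 : cox m w1 w2 -> wact w1 =1 wact w2.
Proof.
elim=> {w1 w2} [w|w1 w2 _ IH|w1 w2 w3 _ IH1 _ IH2|u v w1 w2 _ IH|k|i j|k].
- by [].
- by move=> x; rewrite IH.
- by move=> x; rewrite IH1.
- by move=> x; rewrite !wact_cat IH.
- by move=> _ x; rewrite /wact /=; swapn_lia.
- by move=> ij _ x; rewrite /wact /=; swapn_lia.
- by move=> _ x; rewrite /wact /=; swapn_lia.
Qed.

Lemma wact_fix m w x : all (fun k => (k < m)%N) w -> (m < x)%N -> wact w x = x.
Proof.
elim: w x => //= k w IHw x /andP[km aw] mx; rewrite /wact /= -/(wact w _).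
have -> : swapn k x = x by swapn_lia.
exact: IHw.
Qed.

Lemma wact_desc m j : (j <= m)%N -> wact (desc m j) m = j.
Proof.
elim: m => [|m IHm]; first by rewrite leqn0 => /eqP ->.
rewrite leq_eqVlt => /predU1P[->|jm]; first by rewrite descnn.
rewrite (@desc_cat m.+1 j m) ?desc1; last by lia.
rewrite wact_cat; have -> : wact [:: m] m.+1 = m by rewrite /wact /=; swapn_lia.
exact: IHm.
Qed.

Lemma cox_id m w : all (fun k => (k < m)%N) w ->
  (forall x, (x <= m)%N -> wact w x = x) -> cox m w [::].
Proof.
elim: m w => [|m IHm] w aw idw.
  by case: w aw {idw} => // _; apply: cox_refl.
have [w' [j [aw' jm cw]]] := cox_nf aw.
have jE : j = m.+1.
  have := idw _ (leqnn m.+1); rewrite (cox_wact cw) wact_cat (wact_fix aw') //.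
  by rewrite wact_desc.
rewrite jE descnn cats0 in cw; apply: (cox_trans cw).
apply: (cox_le (leqnSn m)); apply: IHm => // x xm.
by rewrite -(cox_wact cw) idw // ltnW.
Qed.

Section WordMx.
Variables (F : fieldType) (p m : nat) (T : nat -> 'M[F]_p).
Hypothesis T_sq : forall k, (k < m)%N -> T k *m T k = 1%:M.
Hypothesis T_comm : forall i j, (i.+1 < j)%N -> (j < m)%N -> T i *m T j = T j *m T i.
Hypothesis T_braid : forall k, (k.+1 < m)%N ->
  T k *m T k.+1 *m T k = T k.+1 *m T k *m T k.+1.

Definition word_mx (w : seq nat) : 'M[F]_p := foldr (fun k M => T k *m M) 1%:M w.

Lemma word_mx_cat u v : word_mx (u ++ v) = word_mx u *m word_mx v.
Proof. by elim: u => [|k u IHu] /=; rewrite ?mul1mx // IHu mulmxA. Qed.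

Lemma cox_word_mx w1 w2 : cox m w1 w2 -> word_mx w1 = word_mx w2.
Proof.
elim=> {w1 w2} [w|w1 w2 _ IH|w1 w2 w3 _ IH1 _ IH2|u v w1 w2 _ IH|k|i j|k] //=.
- by rewrite IH1.
- by rewrite !word_mx_cat IH.
- by move=> km; rewrite mulmx1 T_sq.
- by move=> ij jm; rewrite !mulmx1 T_comm.
- by move=> km; rewrite !mulmx1 !mulmxA T_braid.
Qed.

End WordMx.

Section Words.
Variable n : nat.

Definition adjp (k : nat) : 'S_n :=
  if insub k is Some i then if insub k.+1 is Some j then tperm i j else 1%g else 1%g.

Definition word_perm (w : seq nat) : 'S_n := foldr (fun k s => adjp k * s)%g 1%g w.

Lemma adjpE k (x : 'I_n) : (k.+1 < n)%N -> adjp k x = swapn k x :> nat.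
Proof.
move=> kn; rewrite /adjp (insubT (fun x => x < n)%N (ltnW kn)) (insubT (fun x => x < n)%N kn) /=.
rewrite /swapn; case: tpermP => [->|->|/eqP xk /eqP xk1] //=.
- by rewrite eqxx.
- by rewrite eqxx; case: eqP => ?; lia.
- by rewrite -!val_eqE /= in xk xk1; rewrite (negbTE xk) (negbTE xk1).
Qed.

Lemma word_perm_cat u v : word_perm (u ++ v) = (word_perm u * word_perm v)%g.
Proof. by elim: u => [|k u IHu] /=; rewrite ?mul1g // IHu mulgA. Qed.

Lemma word_permE w (x : 'I_n) : all (fun k => k < n.-1)%N w ->
  word_perm w x = wact w x :> nat.
Proof.
elim: w x => [|k w IHw] x /=; first by rewrite perm1.
case/andP => kn aw; rewrite permM IHw //.
by rewrite adjpE //; lia.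
Qed.

Lemma adjpV k : (adjp k * adjp k = 1)%g.
Proof.
by rewrite /adjp; case: insubP => [i _ _|_]; [case: insubP => [j _ _|_]|];
  rewrite ?tperm2 ?mulg1.
Qed.

Lemma word_perm_rev w : word_perm (rev w) = (word_perm w)^-1%g.
Proof.
elim: w => [|k w IHw]; first by rewrite invg1.
rewrite rev_cons -cats1 word_perm_cat IHw /= mulg1 invMg.
by congr (_ * _)%g; apply/eqP; rewrite eq_sym eq_invg_mul adjpV.
Qed.

Lemma word_perm_tperm (i j : 'I_n) :
  exists2 w, all (fun k => k < n.-1)%N w & word_perm w = tperm i j.
Proof.
wlog ij : i j / (i < j)%N.
  move=> H; case: (ltngtP i j) => [|ji|/val_inj ->]; first exact: H.
    by have [w aw ew] := H _ _ ji; exists w => //; rewrite tpermC.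
  by exists [::] => //; rewrite tperm1.
move: {2}(j - i)%N (leqnn (j - i)%N) => e.
elim: e i j ij => [|e IHe] i j ij le_e; first by exfalso; lia.
have := ltn_ord j; case: (ltngtP i.+1 j) => [lt|lt|eq_ij] jn; [|by exfalso; lia|].
  have jn' : (j.-1 < n)%N by lia.
  pose j' := Ordinal jn'.
  have [||w aw ew] := IHe i j'; [by rewrite /=; lia|by rewrite /=; lia|].
  exists ([:: j.-1] ++ w ++ [:: j.-1]).
    by rewrite all_cat all_cat aw /= !andbT; lia.
  rewrite !word_perm_cat ew /= !mulg1.
  have -> : adjp j.-1 = tperm j' j.
    rewrite /adjp (insubT (fun x => x < n)%N jn') prednK; last by lia.
    by rewrite insubT // /=; congr tperm; apply: val_inj.
  have := tpermJ i j' (tperm j' j); rewrite conjgE tpermV => ->.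
  rewrite tpermL tpermD //; first by rewrite -val_eqE /=; lia.
  by rewrite -val_eqE /=; lia.
exists [:: val i]; first by rewrite /= andbT; lia.
rewrite /= mulg1 /adjp valK insubT; first by rewrite eq_ij.
by move=> H /=; congr tperm; apply: val_inj.
Qed.

Lemma word_exists (s : 'S_n) :
  exists w, all (fun k => k < n.-1)%N w && (word_perm w == s).
Proof.
have [ts -> _] := prod_tpermP s; elim: ts => [|t ts [w /andP[aw /eqP ew]]].
  by exists [::]; rewrite big_nil /=.
have [w1 aw1 ew1] := word_perm_tperm t.1 t.2.
by exists (w1 ++ w); rewrite all_cat aw1 aw word_perm_cat ew ew1 big_cons /=.
Qed.

Definition perm_word (s : 'S_n) : seq nat := xchoose (word_exists s).

Lemma perm_word_all s : all (fun k => k < n.-1)%N (perm_word s).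
Proof. by case/andP: (xchooseP (word_exists s)). Qed.

Lemma perm_wordK s : word_perm (perm_word s) = s.
Proof. by case/andP: (xchooseP (word_exists s)) => _ /eqP. Qed.

Section Rep.
Variables (F : fieldType) (p : nat) (T : nat -> 'M[F]_p).
Hypothesis T_sq : forall k, (k < n.-1)%N -> T k *m T k = 1%:M.
Hypothesis T_comm : forall i j, (i.+1 < j)%N -> (j < n.-1)%N -> T i *m T j = T j *m T i.
Hypothesis T_braid : forall k, (k.+1 < n.-1)%N ->
  T k *m T k.+1 *m T k = T k.+1 *m T k *m T k.+1.

Lemma word_mx_eq u v : all (fun k => k < n.-1)%N u -> all (fun k => k < n.-1)%N v ->
  word_perm u = word_perm v -> word_mx T u = word_mx T v.
Proof.
move=> au av euv.
have avr : all (fun k => k < n.-1)%N (rev v) by rewrite all_rev.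
have id1 w : all (fun k => k < n.-1)%N w -> word_perm w = 1%g -> word_mx T w = 1%:M.
  move=> aw ew; suff : cox n.-1 w [::] by move/(cox_word_mx T_sq T_comm T_braid).
  apply: cox_id => // x xn.
  case: (posnP n) => [n0|n0].
    by move: aw; case: (w) => //= k w'; rewrite n0.
  have lt_x : (x < n)%N by lia.
  have := word_permE (Ordinal lt_x) aw.
  by rewrite ew perm1 /=.
have e1 : word_mx T u *m word_mx T (rev v) = 1%:M.
  rewrite -word_mx_cat id1 ?all_cat ?au // word_perm_cat word_perm_rev euv.
  by rewrite mulgV.
have e2 : word_mx T (rev v) *m word_mx T v = 1%:M.
  rewrite -word_mx_cat id1 ?all_cat ?avr // word_perm_cat word_perm_rev.
  by rewrite mulVg.
by rewrite -[LHS]mulmx1 -e2 mulmxA e1 mul1mx.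
Qed.

Definition cox_fun (s : 'S_n) : 'M[F]_p := word_mx T (perm_word s).

Lemma cox_fun_repr : mx_repr [set: 'S_n] cox_fun.
Proof.
split=> [|s t _ _].
  by apply: (@word_mx_eq _ [::]); rewrite ?perm_word_all // perm_wordK.
rewrite /cox_fun -word_mx_cat; apply: word_mx_eq; rewrite ?all_cat ?perm_word_all //.
by rewrite word_perm_cat !perm_wordK.
Qed.

Lemma cox_fun_adj k : (k < n.-1)%N -> cox_fun (adjp k) = T k.
Proof.
move=> kn; rewrite -[RHS]mulmx1; apply: (@word_mx_eq _ [:: k]) => /=.
- exact: perm_word_all.
- by rewrite kn.
- by rewrite perm_wordK mulg1.
Qed.
End Rep.
End Words.

(* The base space is V = F^d, and the standard basis of its n-th tensor power is
   indexed by {ffun 'I_n -> 'I_d}. *)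
Definition tdim (d n : nat) : nat := #|{: {ffun 'I_n -> 'I_d}}|.

Section Legs.
Variables (F : fieldType) (d : nat).
Notation "''End_' n" := 'M[F]_(tdim d n) (at level 8, n at level 2).

Definition tcoef n (X : 'End_n) (x y : {ffun 'I_n -> 'I_d}) : F :=
  X (enum_rank x) (enum_rank y).

Definition agree_off p n (g : 'I_p -> 'I_n) (x y : {ffun 'I_n -> 'I_d}) : bool :=
  [forall k, (k \notin codom g) ==> (x k == y k)].

(* X acting on the tensor factors g 0, ..., g (p - 1) of the n-th tensor power,
   and the identity on the other ones. *)
Definition on_legs p n (g : 'I_p -> 'I_n) (X : 'End_p) : 'End_n :=
  \matrix_(i, j)
    let x := enum_val i in let y := enum_val j in
    if agree_off g x y
    then tcoef X [ffun l => x (g l)] [ffun l => y (g l)] else 0.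

Lemma tcoefP n (X Y : 'End_n) : (forall x y, tcoef X x y = tcoef Y x y) -> X = Y.
Proof.
move=> eXY; apply/matrixP => i j; have := eXY (enum_val i) (enum_val j).
by rewrite /tcoef !enum_valK.
Qed.

Lemma tcoef1 n (x y : {ffun 'I_n -> 'I_d}) :
  tcoef (1%:M : 'End_n) x y = (x == y)%:R.
Proof. by rewrite /tcoef mxE (inj_eq enum_rank_inj). Qed.

Lemma tcoefM n (X Y : 'End_n) x y :
  tcoef (X *m Y) x y = \sum_z tcoef X x z * tcoef Y z y.
Proof.
rewrite /tcoef mxE (reindex (@enum_rank {ffun 'I_n -> 'I_d})) //=.
exact/onW_bij/enum_rank_bij.
Qed.

Lemma tcoef_legs p n (g : 'I_p -> 'I_n) X x y :
  tcoef (on_legs g X) x y =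
  if agree_off g x y then tcoef X [ffun l => x (g l)] [ffun l => y (g l)] else 0.
Proof. by rewrite {1}/tcoef mxE !enum_rankK. Qed.

Lemma agree_offP p n (g : 'I_p -> 'I_n) (x y : {ffun 'I_n -> 'I_d}) :
  reflect (forall k, k \notin codom g -> x k = y k) (agree_off g x y).
Proof.
apply: (iffP fintype.forallP) => H k; first by move=> kg; have := H k; rewrite kg => /eqP.
by apply/implyP => /H/eqP.
Qed.

Section One.
Variables (p n : nat) (g : 'I_p -> 'I_n).
Hypothesis g_inj : injective g.

Let patch (x : {ffun 'I_n -> 'I_d}) (u : {ffun 'I_p -> 'I_d}) : {ffun 'I_n -> 'I_d} :=
  [ffun k => if [pick l | g l == k] is Some l then u l else x k].

Let patch_in x u l : patch x u (g l) = u l.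
Proof.
rewrite ffunE; case: pickP => [l' /eqP/g_inj -> //|/(_ l)]; by rewrite eqxx.
Qed.

Let patch_out x u k : k \notin codom g -> patch x u k = x k.
Proof.
move=> kg; rewrite ffunE; case: pickP => // l /eqP gl.
by move: kg; rewrite -gl codom_f.
Qed.

Lemma on_legs1 : on_legs g 1%:M = 1%:M.
Proof.
apply: tcoefP => x y; rewrite tcoef_legs !tcoef1.
case: ifPn => [/agree_offP xy|/agree_offP xy]; last first.
  by case: eqP => // exy; case: xy => k _; rewrite exy.
congr (_ %:R); congr nat_of_bool; apply/eqP/eqP => [/ffunP e|-> //].
apply/ffunP => k; have [/codomP[l ->]|] := boolP (k \in codom g); last exact: xy.
by have := e l; rewrite !ffunE.
Qed.

Lemma on_legsM X Y : on_legs g (X *m Y) = on_legs g X *m on_legs g Y.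
Proof.
apply: tcoefP => x y; rewrite tcoef_legs !tcoefM.
under [RHS]eq_bigr do rewrite !tcoef_legs.
case: (agree_offP g x y) => xy; last first.
  rewrite big1 // => z _; case: (agree_offP g x z) => xz; last by rewrite mul0r.
  case: (agree_offP g z y) => zy; last by rewrite mulr0.
  by case: xy => k kg; rewrite xz ?zy.
rewrite (bigID (agree_off g x)) /= [X in _ + X]big1 ?addr0; last first.
  by move=> z /negbTE ->; rewrite mul0r.
rewrite (reindex_onto (patch x) (fun z => [ffun l => z (g l)])) /=; last first.
  move=> z /agree_offP xz; apply/ffunP => k.
  have [/codomP[l ->]|kg] := boolP (k \in codom g); first by rewrite patch_in ffunE.
  by rewrite patch_out ?xz.
apply: eq_big => [u|u _].
  apply/esym/andP; split; first by apply/agree_offP => k kg; rewrite patch_out.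
  by apply/eqP/ffunP => l; rewrite ffunE patch_in.
have -> : agree_off g x (patch x u) by apply/agree_offP => k kg; rewrite patch_out.
have -> : agree_off g (patch x u) y.
  by apply/agree_offP => k kg; rewrite patch_out // xy.
have e : [ffun l => patch x u (g l)] = u.
  by apply/ffunP => l; rewrite ffunE patch_in.
by rewrite e.
Qed.

Lemma on_legs_comp q (h : 'I_q -> 'I_p) X :
  on_legs g (on_legs h X) = on_legs (g \o h) X.
Proof.
apply: tcoefP => x y; rewrite !tcoef_legs.
have e (z : {ffun 'I_n -> 'I_d}) :
    [ffun l => [ffun l0 => z (g l0)] (h l)] = [ffun l => z ((g \o h) l)].
  by apply/ffunP => l; rewrite !ffunE.
rewrite !e; case: (agree_offP g x y) => xy; last first.
  case: (agree_offP (g \o h) x y) => // xy'; case: xy => k kg; apply: xy'.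
  by apply: contra kg => /codomP[l ->]; apply: codom_f.
case: (agree_offP (g \o h) x y) => [xy'|xy'].
  rewrite ifT //; apply/agree_offP => l lh; rewrite !ffunE; apply: xy'.
  by apply: contra lh => /codomP[l' /g_inj ->]; apply: codom_f.
rewrite ifF //; apply/negP => /agree_offP H; apply: xy' => k kgh.
have [/codomP[l kl]|] := boolP (k \in codom g); last exact: xy.
have := H l; rewrite !ffunE -kl; apply.
by apply: contra kgh => /codomP[l' ll']; rewrite kl ll'; apply: (codom_f (g \o h)).
Qed.
End One.

Lemma eq_on_legs p n (g g' : 'I_p -> 'I_n) X : g =1 g' -> on_legs g X = on_legs g' X.
Proof.
move=> eg; apply: tcoefP => x y; rewrite !tcoef_legs.
have -> : agree_off g x y = agree_off g' x y.
  by rewrite /agree_off (eq_codom eg).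
by rewrite (_ : [ffun l => x (g l)] = [ffun l => x (g' l)]) 1?(_ : [ffun l => y (g l)] = [ffun l => y (g' l)]) //;
  apply/ffunP => l; rewrite !ffunE eg.
Qed.

Section Two.
Variables (p q n : nat) (g : 'I_p -> 'I_n) (h : 'I_q -> 'I_n).
Hypothesis gh : forall i j, g i != h j.

Lemma tcoef_legs2 X Y x y :
  tcoef (on_legs g X *m on_legs h Y) x y =
  if [forall k, (k \notin codom g) && (k \notin codom h) ==> (x k == y k)]
  then tcoef X [ffun l => x (g l)] [ffun l => y (g l)] *
       tcoef Y [ffun l => x (h l)] [ffun l => y (h l)] else 0.
Proof.
have g_nh l : g l \notin codom h.
  by apply/codomP => -[j gl]; have := gh l j; rewrite gl eqxx.
have h_ng l : h l \notin codom g.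
  by apply/codomP => -[j gl]; have := gh j l; rewrite gl eqxx.
pose z0 : {ffun 'I_n -> 'I_d} := [ffun k => if k \in codom h then x k else y k].
rewrite tcoefM (bigD1 z0) //= big1 ?addr0 => [|z zz0]; last first.
  rewrite !tcoef_legs; case: (agree_offP g x z) => xz; last by rewrite mul0r.
  case: (agree_offP h z y) => zy; last by rewrite mulr0.
  case/eqP: zz0; apply/ffunP => k; rewrite ffunE; case: ifPn => kh; last exact: zy.
  by rewrite xz //; case/codomP: kh => l ->.
rewrite !tcoef_legs.
set c := [forall k, _]; have [/fintype.forallP H|] := boolP c; rewrite {}/c.
  have -> : agree_off g x z0.
    apply/agree_offP => k kg; rewrite ffunE; case: ifPn => // kh.
    by have := H k; rewrite kg kh => /eqP.
  have -> : agree_off h z0 y.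
    by apply/agree_offP => k kh; rewrite ffunE (negbTE kh).
  congr (_ * _).
    by congr tcoef; apply/ffunP => l; rewrite !ffunE (negbTE (g_nh l)).
  by congr tcoef; apply/ffunP => l; rewrite !ffunE codom_f.
case/fintype.forallPn => k; rewrite negb_imply => /andP[/andP[kg kh] /eqP xy].
case: (agree_offP g x z0) => [/(_ k kg)|]; last by rewrite mul0r.
by rewrite ffunE (negbTE kh).
Qed.
End Two.

Lemma on_legs_comm p q n (g : 'I_p -> 'I_n) (h : 'I_q -> 'I_n) X Y :
  (forall i j, g i != h j) ->
  on_legs g X *m on_legs h Y = on_legs h Y *m on_legs g X.
Proof.
move=> gh; apply: tcoefP => x y; rewrite !tcoef_legs2 //; last first.
  by move=> i j; rewrite eq_sym.
rewrite mulrC; congr (if _ then _ else _); apply: eq_forallb => k.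
by rewrite andbC.
Qed.

(* For g = site hk and p = 2, on_legs g R is 1 (x) ... (x) R (x) ... (x) 1 with
   R on the (0-based) factors k and k + 1. *)
Definition site n k (hk : (k.+1 < n)%N) (l : 'I_2) : 'I_n :=
  if l == 0 then Ordinal (ltnW hk) else Ordinal hk.

Lemma val_site n k (hk : (k.+1 < n)%N) l : site hk l = (k + l)%N :> nat.
Proof. by rewrite /site; case: l => -[|[|//]] i /=; rewrite ?addn0 ?addn1. Qed.

Lemma site_inj n k (hk : (k.+1 < n)%N) : injective (site hk).
Proof.
move=> i j /(congr1 val) /=; rewrite !val_site => /addnI; exact: val_inj.
Qed.

End Legs.

Section Multiplicity.
Variables (F : decFieldType) (gT : finGroupType) (G : {group gT}).

(* W ranges over the isotypic components of rG. *)
Definition multiplicity m n (rV : mx_representation F G m)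
    (rG : mx_representation F G n) : nat :=
  (\sum_(W : DecSocleType rG | `[< mx_rsim (socle_repr W) rV >])
     socle_mult W)%N.
End Multiplicity.

Section Specht.
Variables (F : fieldType) (la : seq nat) (n : nat).

(* The boxes of the diagram of la are numbered 0, ..., n - 1 row by row, so
   that box k is in row reshape_index la k and column reshape_offset la k. *)
Definition row_stab : {set 'S_n} :=
  [set s : 'S_n | [forall k, reshape_index la (s k) == reshape_index la k]].

Definition col_stab : {set 'S_n} :=
  [set s : 'S_n | [forall k, reshape_offset la (s k) == reshape_offset la k]].

Definition young_symmetrizer : 'rV[F]_#|[set: 'S_n]| :=
  \sum_(p in row_stab) \sum_(q in col_stab)
    (-1) ^+ q *: delta_mx 0 (gring_index [set: 'S_n] (p * q)%g).

Definition specht :=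
  submod_repr (cyclic_mx_module (regular_repr F [set: 'S_n]) young_symmetrizer).
End Specht.

Local Open Scope complex_scope.

Record involutive_Rmatrix (K : realType) (d : nat) := InvolutiveRmatrix {
  Rmx :> 'M[K[i]]_(tdim d 2);
  Rmx_dim : (0 < d)%N;
  Rmx_unitary : Rmx \is unitarymx;
  Rmx_invol : Rmx *m Rmx = 1%:M;
  Rmx_YBE :
    let R12 := on_legs (@site 3 0 isT) Rmx in
    let R23 := on_legs (@site 3 1 isT) Rmx in
    R12 *m R23 *m R12 = R23 *m R12 *m R23 }.

Section YangBaxterRepresentation.
Variables (K : realType) (d : nat) (R : involutive_Rmatrix K d) (n : nat).

Definition Radj (k : nat) : 'M[K[i]]_(tdim d n) :=
  if @idP (k.+1 < n)%N is ReflectT kn then on_legs (site kn) R else 1%:M.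

Lemma RadjE k (kn : (k.+1 < n)%N) : Radj k = on_legs (site kn) R.
Proof.
rewrite /Radj; case: {-}_ / idP => [kn'|]; last by rewrite kn.
by rewrite (bool_irrelevance kn' kn).
Qed.

Lemma Radj_sq k : (k < n.-1)%N -> Radj k *m Radj k = 1%:M.
Proof.
move=> kn; have kn' : (k.+1 < n)%N by lia.
by rewrite (RadjE kn') -on_legsM ?Rmx_invol ?on_legs1 //; apply: site_inj.
Qed.

Lemma Radj_comm i j : (i.+1 < j)%N -> (j < n.-1)%N ->
  Radj i *m Radj j = Radj j *m Radj i.
Proof.
move=> ij jn; have jn' : (j.+1 < n)%N by lia.
have in' : (i.+1 < n)%N by lia.
rewrite (RadjE jn') (RadjE in'); apply: on_legs_comm => k l.
by rewrite -val_eqE /= !val_site; have := ltn_ord k; have := ltn_ord l; lia.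
Qed.

Lemma Radj_braid k : (k.+1 < n.-1)%N ->
  Radj k *m Radj k.+1 *m Radj k = Radj k.+1 *m Radj k *m Radj k.+1.
Proof.
move=> kn; have lt_kn (l : 'I_3) : (k + l < n)%N by have := ltn_ord l; lia.
pose g (l : 'I_3) : 'I_n := Ordinal (lt_kn l).
have g_inj : injective g by move=> l l' [/addnI]; apply: val_inj.
have k0 : (k.+1 < n)%N by lia.
have k1 : (k.+2 < n)%N by lia.
have e0 : Radj k = on_legs g (on_legs (@site 3 0 isT) R).
  rewrite (RadjE k0) on_legs_comp //; apply: eq_on_legs => l.
  by apply: val_inj; rewrite /= !val_site.
have e1 : Radj k.+1 = on_legs g (on_legs (@site 3 1 isT) R).
  rewrite (RadjE k1) on_legs_comp //; apply: eq_on_legs => l.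
  by apply: val_inj; rewrite /= !val_site; lia.
by rewrite e0 e1 -!on_legsM // Rmx_YBE.
Qed.

(* Products in 'S_n are read from left to right: rho_R (s * t) is
   rho_R s *m rho_R t where s * t maps x to t (s x). *)
Definition rho_R : mx_representation K[i] [set: 'S_n] (tdim d n) :=
  MxRepresentation (cox_fun_repr Radj_sq Radj_comm Radj_braid).

Lemma rho_RE k (kn : (k.+1 < n)%N) :
  rho_R (tperm (Ordinal (ltnW kn)) (Ordinal kn)) = on_legs (site kn) R.
Proof.
have <- : adjp n k = tperm (Ordinal (ltnW kn)) (Ordinal kn).
  rewrite /adjp (insubT (fun x => x < n)%N (ltnW kn)).
  by rewrite (insubT (fun x => x < n)%N kn).
by rewrite -RadjE; apply: cox_fun_adj Radj_sq Radj_comm Radj_braid _ _; lia.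
Qed.

Definition chi_R (s : 'S_n) : K[i] := (d ^ n)%:R^-1 * \tr (rho_R s).

End YangBaxterRepresentation.

Record thoma_parameters (K : realType) (d : nat) (R : involutive_Rmatrix K d)
    (alpha beta : nat -> K) : Prop := ThomaParameters {
  thoma_alpha_ge0 : forall i, 0 <= alpha i;
  thoma_beta_ge0 : forall i, 0 <= beta i;
  thoma_alpha_ni : forall i, alpha i.+1 <= alpha i;
  thoma_beta_ni : forall i, beta i.+1 <= beta i;
  thoma_sum : (\sum_(0 <= i <oo) (alpha i)%:E
               + \sum_(0 <= i <oo) (beta i)%:E <= 1)%E;
  (* the permutations with a single orbit are the n-cycles *)
  thoma_cycle : forall n (s : 'S_n), (2 <= n)%N -> #|porbits s| = 1%N ->
    chi_R R s = (limn (series (fun i => alpha i ^+ n))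
                 + (-1) ^+ n.+1 * limn (series (fun i => beta i ^+ n)))%:C }.

Record rescaled_thoma_parameters (K : realType) (d : nat)
    (R : involutive_Rmatrix K d) (a b : seq nat) : Prop :=
    RescaledThomaParameters {
  thoma_a_part : is_part a;
  thoma_b_part : is_part b;
  thoma_rescaled : exists alpha beta : nat -> K,
    [/\ thoma_parameters R alpha beta,
        forall i, (nth 0%N a i)%:R = d%:R * alpha i &
        forall i, (nth 0%N b i)%:R = d%:R * beta i] }.

(* Main.v *)
(** The traces of [rho_R] are class functions that are multiplicative over
    disjoint cycles. Hence, with [t k] the trace of a [k]-cycle and [Q n] the
    multiplicity of the trivial representation in the [n]-th tensor power,
    [\sum_n Q n z^n = exp (\sum_k t k z^k / k)], and pairing with the permutation
    characters of Young subgroups turns [rho_R] into products of the [Q n].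
    The class function of the Young symmetrizer and the Jacobi-Trudi
    combination of these permutation characters have the same norm and the
    matching inner product, so they are proportional; therefore the multiplicity
    of the Specht module of [la] is the determinant of the [Q (la_i + j - i)].
    The Thoma parameters give
    [\sum_n Q n z^n = exp (g z) \prod_b (1 + b z) / \prod_a (1 - a z)] with
    [g = d - |a| - |b|], and integrality of the [Q n] forces [g = 0]. So the
    multiplicity is the supersymmetric Schur function of [(a, b)]: its branching
    rule over horizontal and vertical strips shows when it vanishes, and column
    operations on the Jacobi-Trudi matrix factor it when the diagram contains
    the [size a] by [size b] rectangle. *)

Require Import Defs.
From mathcomp Require Import all_boot all_order all_algebra all_fingroup all_character.
From mathcomp Require Import all_solvable.
From mathcomp Require boolp ereal topology normedtype sequences.
From mathcomp Require Import mpoly complex reals zify ring.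

Set Implicit Arguments.
Unset Strict Implicit.
Unset Printing Implicit Defensive.

Import Order.TTheory GRing.Theory Num.Theory.
Local Open Scope ring_scope.

(** * Multiplicative families of class functions *)

(** The multiplicity enters through one trace. The Young symmetrizer C satisfies C g C = (scalar) C
    for every g, so it has trace kappa on the Specht module and 0 on every other irreducible. Its
    average over conjugation is compared with the Jacobi-Trudi class function by a sum of squares:
    all values are real, and the squares of the difference add up to kappa^2 n! (1 - 2 + 1) = 0. The
    inner product comes from the dominance order on column-injective fillings, the norm of the
    Jacobi-Trudi side from the leading coefficient in s_la a_delta = a_(la + delta).

    Generating functions are replaced by the recursion n Q_n = \sum_i t_(n-i) Q_i. It makes sense in
    every commutative ring, in particular for polynomial-valued class functions, whose coefficients
    treat all Young subgroups at once; its solution is unique when positive integers are not zero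
    divisors.

    The Thoma parameters describe cycles of length at least 2 only, while t_1 = d always. The gap g
    between d and the sum of the parameters therefore sits in t_1 alone, which is the origin of the
    factor exp (g z). *)

Section Newton.
Variable (R : comNzRingType) (chi : forall n, 'S_n -> R).

(** Multiplicativity is stated on words in the adjacent transpositions, the second word being
    shifted by k. This avoids an embedding of a product of symmetric groups and is the form in which
    products of copies of R separate into tensor factors. *)
Record mult_class_family : Prop := MultClassFamily {
  mcf1 : chi (1%g : 'S_0) = 1;
  mcfJ : forall n (g h : 'S_n), chi (g ^ h)%g = chi g;
  mcfM : forall k m u v, all (fun i => i < k.-1)%N u -> all (fun i => i < m.-1)%N v ->
    chi (word_perm (k + m) (u ++ map (addn k) v)) =
    chi (word_perm k u) * chi (word_perm m v) }.

Definition full_cycle n : 'S_n := word_perm n (iota 0 n.-1).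

Hypothesis chiP : mult_class_family.

Section Step.
Variable N : nat.

(** [tail k] is the cycle on k, ..., N - 1, and the permutations summed in [W k] share only the
    letter k with it. [W] interpolates between one N-cycle at k = 0 and the whole sum at k = N -
    1. *)
Let low k : {set 'I_N} := [set i : 'I_N | i <= k]%N.
Let tail k : 'S_N := word_perm N (iota k (N.-1 - k)).
Let W k := \sum_(g : 'S_N | perm_on (low k) g) chi (g * tail k)%g.

Let all_tail k : all (fun i => i < N.-1)%N (iota k (N.-1 - k)).
Proof. by apply/allP => i; rewrite mem_iota; lia. Qed.

Let tail_fix k (x : 'I_N) : (x < k)%N -> tail k x = x.
Proof.
move=> xk; apply: val_inj; rewrite /= word_permE //.
elim: (N.-1 - k)%N {-3}k xk => [//|m IHm] k' xk'; rewrite /wact /= -/(wact _ _).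
have -> : swapn k' x = x by have := swapnP k' x; lia.
by apply: IHm; lia.
Qed.

Let sum_low k : (k < N)%N ->
  \sum_(g : 'S_N | perm_on [set i : 'I_N | i < k]%N g) chi (g * tail k)%g =
  (\sum_(g : 'S_k) chi g) * chi (full_cycle (N - k)).
Proof.
move=> kN; pose emb (g : 'S_k) : 'S_N := word_perm N (perm_word g).
have embw (g : 'S_k) : all (fun i => i < N.-1)%N (perm_word g).
  by apply: sub_all (perm_word_all g) => i; lia.
have embE (g : 'S_k) (x : 'I_k) : emb g (widen_ord (ltnW kN) x) = g x :> nat.
  rewrite /emb word_permE //= -(word_permE x (perm_word_all g)).
  by rewrite perm_wordK.
have embF (g : 'S_k) (x : 'I_N) : (k <= x)%N -> emb g x = x.
  move=> kx; apply: val_inj; rewrite /emb /= word_permE //.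
  case: (posnP k) => [k0|k0].
    by have := perm_word_all g; case: (perm_word g) => //= i w /andP[]; lia.
  by apply: (@wact_fix k.-1); [exact: perm_word_all|lia].
have emb_on g : perm_on [set i : 'I_N | i < k]%N (emb g).
  by apply/subsetP => x; rewrite !inE ltnNge; apply: contraNN => /embF ->.
have emb_inj : injective emb.
  move=> g h e; apply/permP => x; apply: val_inj; rewrite /= -!embE.
  by rewrite e.
have emb_onto (g : 'S_N) : perm_on [set i : 'I_N | i < k]%N g -> g \in codom emb.
  move=> gon; apply/codomP.
  have lt_g (x : 'I_k) : (g (widen_ord (ltnW kN) x) < k)%N.
    have := perm_closed (widen_ord (ltnW kN) x) gon.
    by rewrite !inE /= ltn_ord.
  pose g' := fun x : 'I_k => Ordinal (lt_g x).
  have g'_inj : injective g'.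
    move=> x y /(congr1 val) /= /val_inj /perm_inj /(congr1 val) /= ?.
    exact: val_inj.
  exists (perm g'_inj); apply/permP => x; apply: val_inj => /=.
  case: (ltnP x k) => xk.
    have -> : x = widen_ord (ltnW kN) (Ordinal xk) by apply: val_inj.
    by rewrite embE permE.
  rewrite embF //; congr val; apply: (out_perm gon); by rewrite inE -leqNgt.
rewrite mulr_suml.
(* The inverse of [emb] has to be total: outside its range [insubd] falls back on the identity. *)
rewrite (reindex_onto emb (fun g => iinv (emb_onto _ (valP (insubd (exist (perm_on [set i : 'I_N | i < k]%N) _ (perm_on1 _)) g))))) /=; last first.
  move=> g gon; rewrite f_iinv; by rewrite val_insubd gon.
apply: eq_big => [g|g _].
  rewrite emb_on /=; apply/eqP; apply: emb_inj; rewrite f_iinv.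
  by rewrite val_insubd emb_on.
have [m Nm] : exists m, N = (k + m)%N by exists (N - k)%N; lia.
rewrite /emb /tail /full_cycle -word_perm_cat.
have -> : (iota k (N.-1 - k)) = map (addn k) (iota 0 (N - k).-1).
  by rewrite -iotaDl addn0; congr iota; lia.
have -> : (N - k)%N = m by lia.
rewrite -[in RHS](perm_wordK g).
move: (perm_word_all g); rewrite Nm => aw; apply: (mcfM chiP) => //.
by apply/allP => i; rewrite mem_iota; lia.
Qed.

(** Sort by the image i of k and write g as g' times the transposition of i and k, with g' fixing k.
    For i = k the factors g' and [tail k] are disjoint. Each of the k values i < k contributes
    [W k.-1]: conjugation by the transposition of i and k - 1 commutes with [tail k] and moves i to
    k - 1, and the transposition of k - 1 and k lengthens [tail k] to [tail k.-1]. *)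
Let W_rec k : (k < N)%N ->
  W k = (\sum_(g : 'S_k) chi g) * chi (full_cycle (N - k)) + k%:R * W k.-1.
Proof.
move=> kN; pose K := Ordinal kN.
pose lo := [set i : 'I_N | i < k]%N.
have lo_low g : perm_on lo g -> perm_on (low k) g.
  by move/subset_trans; apply; apply/subsetP => x; rewrite !inE; lia.
have step1 : W k = \sum_(i in low k) \sum_(g : 'S_N | perm_on lo g)
     chi (g * tperm i K * tail k)%g.
  rewrite /W (partition_big (fun g : 'S_N => g K) (mem (low k))) /=; last first.
    by move=> g gon; rewrite (perm_closed _ gon) inE /=.
  apply: eq_bigr => i il.
  rewrite (reindex_onto (fun g => g * tperm i K)%g (fun g => g * tperm i K)%g); last first.
    by move=> g _; rewrite -mulgA tperm2 mulg1.
  apply: eq_bigl => g; rewrite -mulgA tperm2 mulg1 eqxx andbT.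
  have ton : perm_on (low k) (tperm i K).
    apply/subsetP => x; rewrite !inE; case: tpermP => [->|->|]; rewrite ?eqxx //=.
    by move: il; rewrite inE.
  apply/andP/idP => [[gon /eqP gK]|gon].
    have gKK : g K = K.
      by move: gK; rewrite permM => /(congr1 (tperm i K)); rewrite tpermK tpermL.
    have gon' : perm_on (low k) g.
      by rewrite -[g]mulg1 -(tperm2 i K) mulgA; apply: perm_onM.
    apply/subsetP => x gx; have := subsetP gon' x gx; rewrite !inE leq_eqVlt.
    case/orP => // /eqP xk; move: gx; rewrite inE.
    have -> : x = K by apply: val_inj; rewrite /= -xk.
    by rewrite gKK eqxx.
  split; first exact: perm_onM (lo_low _ gon) ton.
  by rewrite permM (out_perm gon) ?tpermR // inE ltnn.
have step2 i : (i < k)%N -> forall Hi : (i < N)%N,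
    \sum_(g : 'S_N | perm_on lo g) chi (g * tperm (Ordinal Hi) K * tail k)%g = W k.-1.
  move=> ik Hi; have k1 : (k.-1 < N)%N by lia.
  pose K1 := Ordinal k1; pose I := Ordinal Hi; pose t := tperm I K1.
  have ton : perm_on lo t.
    apply/subsetP => x; rewrite !inE; case: tpermP => [->|->|]; rewrite ?eqxx //=; lia.
  have tt : commute t (tail k).
    apply/permP => x; rewrite !permM.
    case: (tpermP I K1 x) => [->|->|/eqP xI /eqP xK].
    - by rewrite !tail_fix ?tpermL //=; lia.
    - by rewrite !tail_fix ?tpermR //=; lia.
    rewrite tpermD //; apply/eqP => e; [move: xI|move: xK]; rewrite -(inj_eq (@perm_inj _ (tail k))) -e tail_fix ?eqxx //=; lia.
  rewrite /W (reindex_inj (conjg_inj t)) /=.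
  have -> : low k.-1 = lo by apply/setP => x; rewrite !inE; lia.
  apply: eq_big => [g|g gon].
    apply/idP/idP => H.
      rewrite -(conjgK t g) tpermV conjgE tpermV; apply: perm_onM => //; apply: perm_onM => //.
    by rewrite conjgE tpermV; apply: perm_onM => //; apply: perm_onM.
  rewrite -(mcfJ chiP _ t); congr chi.
  have tl : tail k.-1 = (tperm K1 K * tail k)%g.
    rewrite /tail; have -> : (N.-1 - k.-1)%N = (N.-1 - k).+1 by lia.
    rewrite /= prednK; last by lia.
    congr (_ * _)%g; rewrite /adjp (insubT (fun x => x < N)%N k1) prednK; last by lia.
    by rewrite (insubT (fun x => x < N)%N kN).
  rewrite tl mulgA conjMg conjMg -conjgM tperm2 conjg1.
  have -> : (tperm (Ordinal Hi) K ^ t = tperm K1 K)%g.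
    rewrite tpermJ tpermL tpermD // -val_eqE /=; lia.
  by congr (_ * _)%g; rewrite conjgE -tt mulKg.
rewrite step1 (bigD1 K) /=; last by rewrite inE.
congr (_ + _).
  rewrite -sum_low //; apply: eq_bigr => g _; by rewrite tperm1 mulg1.
rewrite (eq_bigr (fun=> W k.-1)); last first.
  move=> i /andP[]; rewrite inE => il; rewrite -val_eqE /= => ne.
  case: i il ne => i Hi /= il ne; apply: step2; lia.
rewrite sumr_const mulr_natl; congr (_ *+ _).
rewrite -[RHS](card_ord k) -(card_image (f := widen_ord (ltnW kN))); last first.
  by move=> x y /(congr1 val) /= /val_inj.
apply: eq_card => x; apply/idP/imageP => [|[y _ ->]]; rewrite unfold_in /= inE -val_eqE /=.
  move=> xk; have xk' : (x < k)%N by lia.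
  by exists (Ordinal xk') => //; apply: val_inj.
by have := ltn_ord y; lia.
Qed.

(** Unrolling [W_rec] from N - 1 down to 0 gives this without any division, so it is available for
    polynomial-valued families. *)
Lemma sum_chi_step (Q : nat -> R) : (0 < N)%N ->
  (forall i, (i < N)%N -> \sum_(g : 'S_i) chi g = (i`!)%:R * Q i) ->
  \sum_(g : 'S_N) chi g =
  (N.-1`!)%:R * \sum_(i < N) chi (full_cycle (N - i)) * Q i.
Proof.
move=> N0 HQ.
have HW k : (k < N)%N ->
    W k = (k`!)%:R * \sum_(i < k.+1) chi (full_cycle (N - i)) * Q i.
  elim: k => [|k IHk] kN.
    by rewrite W_rec // HQ // mul0r addr0 fact0 !mul1r big_ord1 mulrC.
  rewrite W_rec // HQ // IHk; last exact: ltnW.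
  rewrite [in RHS]big_ord_recr /= mulrDr addrC factS natrM -!mulrA; congr (_ + _).
  by congr (_ * (_ * _)); rewrite mulrC.
have -> : \sum_(g : 'S_N) chi g = W N.-1.
  rewrite /W; apply: eq_big => [g|g _].
    apply/esym/subsetP => x _; rewrite inE; have := ltn_ord x; lia.
  by rewrite /tail subnn mulg1.
rewrite HW; last by lia.
by rewrite prednK.
Qed.
End Step.

Lemma sum_chi_newton (Q : nat -> R) : Q 0%N = 1 ->
  (forall n, (0 < n)%N -> n%:R * Q n = \sum_(i < n) chi (full_cycle (n - i)) * Q i) ->
  forall n, \sum_(g : 'S_n) chi g = (n`!)%:R * Q n.
Proof.
move=> Q0 HQ; elim/ltn_ind => n IHn; case: n IHn => [|n] IHn.
  rewrite fact0 mul1r Q0 (eq_bigr (fun=> 1)) => [|g _].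
    by rewrite sumr_const -(mcf1 chiP) card_Sn.
  by rewrite -(mcf1 chiP); congr chi; apply/permP; case.
rewrite (sum_chi_step _ IHn) // -HQ // factS natrM /= mulrA; congr (_ * _); exact: mulrC.
Qed.
End Newton.

Lemma word_perm_shift k m u v (g := word_perm (k + m) (u ++ map (addn k) v)) :
  all (fun i => i < k.-1)%N u -> all (fun i => i < m.-1)%N v ->
  (forall i, g (lshift m i) = lshift m (word_perm k u i)) /\
  (forall j, g (rshift k j) = rshift k (word_perm m v j)).
Proof.
move=> au av.
have auv : all (fun i => i < (k + m).-1)%N (u ++ map (addn k) v).
  rewrite all_cat; apply/andP; split; first by apply: sub_all au => i; lia.
  by rewrite all_map; apply: sub_all av => i /=; lia.
have shift_lo x : (x < k)%N -> wact (map (addn k) v) x = x.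
  move=> xk; elim: v {g av auv} => //= i v IHv; rewrite /wact /= -/(wact _ _).
  by have -> : swapn (k + i) x = x by have := swapnP (k + i) x; lia.
have shift_hi y : wact (map (addn k) v) (k + y)%N = (k + wact v y)%N.
  elim: v {g av auv shift_lo} y => //= i v IHv y; rewrite /wact /= -!/(wact _ _) -IHv.
  congr wact; have := swapnP (k + i) (k + y); have := swapnP i y; lia.
split=> i; apply: val_inj; rewrite /g /= !word_permE //= wact_cat.
  by rewrite -(word_permE i au) shift_lo.
rewrite -shift_hi; congr wact; case: (posnP k) => [k0|k0].
  by case: (u) au => //= a u' /andP[]; lia.
by apply: (@wact_fix k.-1) => //; lia.
Qed.

Lemma mult_class_familyM (R : comNzRingType) (chi psi : forall n, 'S_n -> R) :
  mult_class_family chi -> mult_class_family psi ->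
  mult_class_family (fun n g => chi n g * psi n g).
Proof.
case=> c1 cJ cM [p1 pJ pM]; split=> [|n g h|k m u v au av].
- by rewrite c1 p1 mulr1.
- by rewrite cJ pJ.
- by rewrite cM // pM // mulrACA.
Qed.

Lemma mult_class_family_rmorph (R S : comNzRingType) (phi : {rmorphism R -> S})
    (chi : forall n, 'S_n -> R) :
  mult_class_family chi -> mult_class_family (fun n g => phi (chi n g)).
Proof.
case=> c1 cJ cM; split=> [|n g h|k m u v au av].
- by rewrite c1 rmorph1.
- by rewrite cJ.
- by rewrite cM // rmorphM.
Qed.

Lemma full_cycleE n (i : 'I_n) :
  full_cycle n i = (if i == 0 :> nat then n.-1 else i.-1) :> nat.
Proof.
rewrite /full_cycle word_permE; last by apply/allP => j; rewrite mem_iota; lia.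
have H k m x : wact (iota k m) x =
  if (x < k)%N then x else if x == k then (k + m)%N else if (x <= k + m)%N then x.-1 else x.
  elim: m k x => [|m IHm] k x /=; first by rewrite /wact /=; repeat case: ifP; lia.
  rewrite /wact /= -/(wact _ _) IHm.
  by have := swapnP k x; repeat case: ifP; lia.
by rewrite H; have := ltn_ord i; repeat case: ifP; lia.
Qed.

Definition colour_fixed (T : eqType) n (f : {ffun 'I_n -> T}) (g : 'S_n) : bool :=
  [forall i, f (g i) == f i].

Section Colourings.
Variables (R : comNzRingType) (l : nat) (x : 'I_l -> R).

(** The product of the power sums p_m(x) over the cycle lengths m of g: a fixed colouring is
    constant on cycles. *)
Definition colsum n (g : 'S_n) : R :=
  \sum_(f : {ffun 'I_n -> 'I_l} | colour_fixed f g) \prod_i x (f i).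

Lemma colsumP : mult_class_family colsum.
Proof.
split=> [|n g h|k m u v au av].
- have f0 : {ffun 'I_0 -> 'I_l} by apply: finfun; case.
  rewrite /colsum (big_pred1 f0); first by rewrite big_ord0.
  move=> f; rewrite /= (_ : colour_fixed _ _ = true).
    by apply/esym/eqP/ffunP; case.
  by apply/fintype.forallP; case.
- rewrite /colsum (reindex (fun f : {ffun 'I_n -> 'I_l} => [ffun i => f (h^-1 i)%g])) /=.
    apply: eq_big => [f|f _].
      apply/fintype.forallP/fintype.forallP => H i.
        by have := H (h i); rewrite !ffunE permJ !permK.
      by have := H (h^-1 i)%g; rewrite -[i in (g ^ h)%g i](permKV h) permJ !ffunE !permK.
    rewrite (reindex_inj (@perm_inj _ h)); apply: eq_bigr => i _.
    by rewrite ffunE permK.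
  exists (fun f : {ffun 'I_n -> 'I_l} => [ffun i => f (h i)%g]) => f _; apply/ffunP => i.
    by rewrite !ffunE permK.
  by rewrite !ffunE permKV.
have [gl gr] := word_perm_shift au av.
set g := word_perm _ _ in gl gr *.
rewrite /colsum big_distrlr /= pair_big /=.
pose F (p : {ffun 'I_k -> 'I_l} * {ffun 'I_m -> 'I_l}) : {ffun 'I_(k + m) -> 'I_l} :=
  [ffun i => match split i with inl a => p.1 a | inr b => p.2 b end].
have Fl p a : F p (lshift m a) = p.1 a by rewrite ffunE (unsplitK (inl a)).
have Fr p b : F p (rshift k b) = p.2 b by rewrite ffunE (unsplitK (inr b)).
rewrite (reindex F) /=; last first.
  exists (fun f : {ffun 'I_(k + m) -> 'I_l} =>
    ([ffun a => f (lshift m a)], [ffun b => f (rshift k b)])) => [[p q]|f] _.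
    by congr pair; apply/ffunP => i; rewrite ffunE ?Fl ?Fr.
  apply/ffunP => i; rewrite ffunE; case: (split_ordP i) => j -> /=; by rewrite ffunE.
apply: eq_big => [p|p _].
  apply/fintype.forallP/andP => [H|[/fintype.forallP H1 /fintype.forallP H2] i].
    split; apply/fintype.forallP => i.
      by have := H (lshift m i); rewrite gl !Fl.
    by have := H (rshift k i); rewrite gr !Fr.
  by case: (split_ordP i) => j ->; rewrite ?gl ?gr ?Fl ?Fr.
rewrite big_split_ord /=; congr (_ * _); apply: eq_bigr => i _; by rewrite ?Fl ?Fr.
Qed.

Lemma colsum_cycle n : (0 < n)%N -> colsum (full_cycle n) = \sum_i x i ^+ n.
Proof.
case: n => // n _; rewrite /colsum.
rewrite (reindex_onto (fun i : 'I_l => [ffun _ : 'I_n.+1 => i]) (fun f => f ord0)) /=.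
  apply: eq_big => [i|i _].
    rewrite ffunE eqxx andbT; apply/fintype.forallP => k; by rewrite !ffunE.
  under eq_bigr do rewrite ffunE; by rewrite prodr_const card_ord.
move=> f /fintype.forallP H; apply/ffunP => i; rewrite ffunE.
case: i => i; elim: i => [|i IHi] hi; first by congr (f _); apply: val_inj.
rewrite (IHi (ltnW hi)) -(eqP (H (Ordinal hi))); congr (f _); apply: val_inj.
by rewrite /= full_cycleE.
Qed.

End Colourings.

Definition colour_type l n (al : 'I_l -> nat) (f : {ffun 'I_n -> 'I_l}) : bool :=
  [forall i, #|[set k | f k == i]| == al i].

(* The permutation character induced from the trivial character of a Young
   subgroup of type al. *)
Definition young_char l (al : 'I_l -> nat) n (g : 'S_n) : nat :=
  #|[set f : {ffun 'I_n -> 'I_l} | colour_fixed f g && colour_type al f]|.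

(* Q is the coefficient sequence of exp (\sum_(k >= 1) t k z^k / k). *)
Definition newton (R : pzRingType) (t Q : nat -> R) : Prop :=
  Q 0%N = 1 /\
  forall n, (0 < n)%N -> n%:R * Q n = \sum_(i < n) t (n - i)%N * Q i.

Section InducedPairing.
Variables (R : comNzRingType) (l : nat).

Lemma mcoeff_colsum n (g : 'S_n) (al : 'X_{1..l}) :
  (colsum (fun i => 'X_i : {mpoly R[l]}) g)@_al = (young_char al g)%:R.
Proof.
rewrite /colsum raddf_sum /= /young_char -sum1_card natr_sum big_mkcond /=.
rewrite [RHS]big_mkcond /=; apply: eq_bigr => f _; rewrite inE.
case: (colour_fixed f g) => //=.
have -> : \prod_i 'X_(f i) = 'X_[[multinom #|[set k | f k == i]| | i < l]] :> {mpoly R[l]}.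
  rewrite mpolyXE_id (partition_big f xpredT) //=; apply: eq_bigr => i _.
  rewrite (eq_bigr (fun=> 'X_i)); last by move=> k /eqP ->.
  by rewrite prodr_const mnmE; congr (_ ^+ _); apply: eq_card => k; rewrite inE.
rewrite mcoeffX (_ : colour_type al f = ([multinom #|[set k | f k == i]| | i < l] == al)).
  by case: eqP.
apply/fintype.forallP/eqP => [H|<- i]; last by rewrite mnmE.
by apply/mnmP => i; rewrite mnmE; apply/eqP.
Qed.

Variables (t Q : nat -> R).
Hypothesis tQ : newton t Q.

(** The coefficient of z^n in \prod_i Q(X_i z), where Q(z) = \sum_k Q_k z^k. *)
Definition Qmulti n : {mpoly R[l]} :=
  \sum_(m : 'X_{1..l < n.+1} | mdeg m == n) (\prod_i Q (m i)) *: 'X_[m].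

Lemma mcoeff_Qmulti n (m : 'X_{1..l}) :
  (Qmulti n)@_m = if mdeg m == n then \prod_i Q (m i) else 0.
Proof.
rewrite /Qmulti raddf_sum /=.
have [mk|mk] := boolP (mdeg m == n); last first.
  rewrite big1 // => i /eqP di; rewrite mcoeffZ mcoeffX; case: eqP => // eim; last by rewrite mulr0.
  by move: mk; rewrite -eim di eqxx.
have lt_mk : (mdeg m < n.+1)%N by rewrite (eqP mk).
rewrite (bigD1 (BMultinom lt_mk)) //= mcoeffZ mcoeffX eqxx mulr1 [X in _ + X]big1 ?addr0 // => i /andP[_ ne].
rewrite mcoeffZ mcoeffX; case: eqP => // eim; last by rewrite mulr0.
by rewrite -val_eqE /= eim eqxx in ne.
Qed.

Lemma mcoeff_XnM (i : 'I_l) j (p : {mpoly R[l]}) (m : 'X_{1..l}) :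
  ('X_i ^+ j * p)@_m = if (j <= m i)%N then p@_(m - U_(i) *+ j)%MM else 0.
Proof.
rewrite mpolyXn mulrC; case: ifPn => jm.
  rewrite -[in LHS](@submK _ (U_(i) *+ j)%MM m); last first.
    apply/mnm_lepP => k; rewrite mulmnE mnm1E; case: eqP => [<-|_]; lia.
  by rewrite addmC mcoeffMX.
rewrite mcoeffM big1 // => -[m1 m2] /= /eqP e; rewrite mcoeffX.
case: eqP => [e2|]; last by rewrite mulr0.
exfalso; move/negP: jm; apply; have : m i = (m1 + m2)%MM i by rewrite {1}e.
rewrite mnmDE -e2 mulmnE mnm1E eqxx; lia.
Qed.

(** The logarithmic derivative of \prod_i Q(X_i z) is a sum over i. On the coefficient of X^m this
    is the splitting of n = |m| into the exponents m_i, each m_i Q(m_i) being expanded by the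
    recursion for Q. *)
Lemma newton_Qmulti :
  newton (fun j => (t j)%:MP * \sum_(i < l) 'X_i ^+ j) Qmulti.
Proof.
case: tQ => Q0 HQ; split.
  apply/mpolyP => m; rewrite mcoeff_Qmulti mcoeff1 mdeg_eq0; case: eqP => // ->.
  by rewrite big1 // => i _; rewrite mnm0E.
move=> n n0; apply/mpolyP => m.
rewrite -[n%:R]mpolyC_nat mcoeffCM mcoeff_Qmulti raddf_sum /=.
under [RHS]eq_bigr => j _.
  rewrite -mulrA mcoeffCM mulr_suml raddf_sum /= mulr_sumr.
  under eq_bigr => i _ do rewrite mcoeff_XnM mcoeff_Qmulti.
  over.
case: (altP (mdeg m =P n)) => dm; last first.
  rewrite mulr0 big1 // => j _; rewrite big1 // => i _.
  case: ifP => jm; last by rewrite mulr0.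
  rewrite ifF ?mulr0 //; apply: contraNF dm => /eqP dj; move: dj.
  have le : (U_(i) *+ (n - j) <= m)%MM.
    by apply/mnm_lepP => k; rewrite mulmnE mnm1E; case: eqP => [<-|_]; lia.
  have := congr1 mdeg (submK le); rewrite mdegD mdegMn mdeg1 mul1n => <- ->.
  by have ltj := ltn_ord j; apply/eqP; lia.
rewrite exchange_big /= -{1}dm mdegE natr_sum mulr_suml; apply: eq_bigr => i _.
rewrite (bigD1 i) //= mulrA.
(* The recursion at m_i is re-indexed so that its range is n for every i; the added terms are
   zero. *)
have -> : (m i)%:R * Q (m i) = \sum_(j < n) if (n - j <= m i)%N then t (n - j)%N * Q (m i - (n - j))%N else 0.
  case: (posnP (m i)) => [mi0|mi0].
    rewrite mi0 mul0r big1 // => j _; rewrite ifF //; have := ltn_ord j; lia.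
  have le_mn : (m i <= n)%N by rewrite -dm mdegE (bigD1 i) //= leq_addr.
  rewrite HQ //.
  rewrite -(big_mkord xpredT (fun j => t (m i - j)%N * Q j)).
  rewrite -(big_mkord xpredT (fun j => if (n - j <= m i)%N then t (n - j)%N * Q (m i - (n - j))%N else 0)).
  rewrite [RHS](@big_cat_nat _ _ _ (n - m i)%N) //=; last by lia.
  rewrite [X in _ = X + _]big_nat_cond [X in _ = X + _]big1 ?add0r; last first.
    by move=> j; rewrite andbT => /andP[_ lt]; rewrite ifF //; lia.
  rewrite -{1}[(n - m i)%N]add0n big_addn.
  have -> : (n - (n - m i) = m i)%N by lia.
  rewrite !big_mkord; apply: eq_bigr => j _; have := ltn_ord j => ltj.
  rewrite ifT; last by lia.
  by congr (t _ * Q _); lia.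
rewrite mulr_suml; apply: eq_bigr => j _.
case: ifP => jm; last by rewrite mul0r mulr0.
rewrite ifT; last first.
  have le : (U_(i) *+ (n - j) <= m)%MM.
    by apply/mnm_lepP => k; rewrite mulmnE mnm1E; case: eqP => [<-|_]; lia.
  have := congr1 mdeg (submK le); rewrite mdegD mdegMn mdeg1 mul1n dm => H.
  by have ltj := ltn_ord j; apply/eqP; lia.
rewrite [in RHS](bigD1 i) //= -!mulrA; congr (_ * (_ * _)).
  by rewrite mnmBE mulmnE mnm1E eqxx mul1n.
apply: eq_bigr => k ki; rewrite mnmBE mulmnE mnm1E eq_sym (negbTE ki).
by rewrite mul0n subn0.
Qed.

(** Twisting chi by [colsum] in the indeterminates gives again a multiplicative family, with cycle
    values t_k p_k(X). Its sum is n! [Qmulti], and the coefficient of X^al isolates the character of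
    the Young subgroup of type al. *)
Lemma sum_chi_young (chi : forall n, 'S_n -> R) n (al : 'X_{1..l}) :
  mult_class_family chi -> (forall k, (0 < k)%N -> chi k (full_cycle k) = t k) ->
  mdeg al = n ->
  \sum_(g : 'S_n) chi n g * (young_char al g)%:R = (n`!)%:R * \prod_i Q (al i).
Proof.
move=> chiP chit dal.
pose chi' n (g : 'S_n) : {mpoly R[l]} := (chi n g)%:MP * colsum (fun i => 'X_i) g.
have chi'P : mult_class_family chi'.
  exact: mult_class_familyM (mult_class_family_rmorph (@mpolyC l R) chiP) (colsumP _).
have [Q0 HQ] := newton_Qmulti.
have := sum_chi_newton chi'P Q0.
move/(_ _ n)/(congr1 (mcoeff al)) => H; move: H.
rewrite -[(n`!)%:R]mpolyC_nat mcoeffCM mcoeff_Qmulti dal eqxx => <-.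
  rewrite raddf_sum /=; apply: eq_bigr => g _.
  by rewrite /chi' mcoeffCM mcoeff_colsum.
move=> k k0; rewrite HQ //; apply: eq_bigr => j _; have := ltn_ord j => ltj.
by rewrite /chi' colsum_cycle ?chit //; lia.
Qed.

End InducedPairing.

(** * Jacobi-Trudi determinants *)

Section JacobiTrudi.
Variable R : comNzRingType.
Implicit Types (h : nat -> R) (l D : nat) (x y : R).

(* h extended by zero to negative arguments, at k - c. *)
Definition subz h (k c : nat) : R := if (c <= k)%N then h (k - c)%N else 0.

Definition JT h l (la : 'I_l -> nat) : R :=
  \det (\matrix_(i < l, j < l) subz h (la i + j) i).

Definition nonincr l (la : 'I_l -> nat) : bool :=
  [forall i : 'I_l, forall j : 'I_l, (i <= j)%N ==> (la j <= la i)%N].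

Definition vstrip l (la mu : 'I_l -> nat) : bool :=
  [forall i, mu i <= la i <= (mu i).+1]%N.

Definition hstrip l (la mu : 'I_l -> nat) : bool :=
  [forall i, mu i <= la i]%N &&
  [forall i : 'I_l, forall j : 'I_l, (j == i.+1 :> nat) ==> (la j <= mu i)%N].

Lemma nonincrP l (la : 'I_l -> nat) :
  reflect (forall i j : 'I_l, (i <= j)%N -> (la j <= la i)%N) (nonincr la).
Proof.
apply: (iffP fintype.forallP) => [H i j ij|H i].
  by have /fintype.forallP/(_ j) := H i; rewrite ij.
by apply/fintype.forallP => j; apply/implyP; apply: H.
Qed.

Lemma vstripP l (la mu : 'I_l -> nat) :
  reflect (forall i, (mu i <= la i <= (mu i).+1)%N) (vstrip la mu).
Proof. exact: fintype.forallP. Qed.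

Lemma hstripP l (la mu : 'I_l -> nat) :
  reflect ((forall i, mu i <= la i)%N /\
           (forall i j : 'I_l, j = i.+1 :> nat -> (la j <= mu i)%N)) (hstrip la mu).
Proof.
apply: (iffP andP) => -[H1 H2]; split.
- exact/fintype.forallP.
- by move=> i j ij; have /fintype.forallP/(_ i)/fintype.forallP/(_ j) := H2; rewrite ij eqxx.
- exact/fintype.forallP.
- by apply/fintype.forallP => i; apply/fintype.forallP => j; apply/implyP => /eqP; apply: H2.
Qed.

Lemma eq_JT h h' l (la la' : 'I_l -> nat) : h =1 h' -> la =1 la' -> JT h la = JT h' la'.
Proof.
move=> eh el; congr (\det _); apply/matrixP => i j; rewrite !mxE el /subz.
by rewrite eh.
Qed.

Lemma det_sum_rows l (I : finType) (F : 'I_l -> I -> 'I_l -> R) :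
  \det (\matrix_(i, j) \sum_(k : I) F i k j) =
  \sum_(f : {ffun 'I_l -> I}) \det (\matrix_(i, j) F i (f i) j).
Proof.
rewrite /determinant exchange_big /=; apply: eq_bigr => s _.
rewrite -mulr_sumr; congr (_ * _).
rewrite (eq_bigr (fun i => \sum_k F i k (s i))); last by move=> i _; rewrite mxE.
rewrite bigA_distr_bigA /=; apply: eq_bigr => f _; apply: eq_bigr => i _.
by rewrite mxE.
Qed.

(* Row i of the Jacobi-Trudi matrix only depends on the beta-number
   la_i + l - 1 - i; for strictly decreasing beta-numbers the la_i are
   recovered without truncation. *)
Lemma JT_beta h l (la : 'I_l -> nat) :
  JT h la = \det (\matrix_(i < l, j < l) subz h (la i + (l.-1 - i) + j) l.-1).
Proof.
congr (\det _); apply/matrixP => i j; rewrite !mxE /subz.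
have := ltn_ord i => li.
have -> : (l.-1 <= la i + (l.-1 - i) + j)%N = (i <= la i + j)%N by lia.
case: ifP => // ij; congr h; lia.
Qed.

(** By multilinearity the determinant is a sum over choices of one beta-number per row. The last
    hypothesis makes the chosen numbers weakly decreasing, and a repetition gives two equal rows.
    What survives is strictly decreasing, hence the beta-numbers of a partition mu, and no sign has
    to be tracked. *)
Lemma JT_expand h l D (c : 'I_l -> nat -> R) (M : 'M[R]_l) :
  (forall i j, M i j = \sum_(g < D + l) c i g * subz h (g + j) l.-1) ->
  (forall i g, c i g != 0 -> (g < D + (l.-1 - i))%N) ->
  (forall i j g g', c i g != 0 -> c j g' != 0 -> (i < j)%N -> (g' <= g)%N) ->
  \det M = \sum_(mu : {ffun 'I_l -> 'I_D} | nonincr (fun i => mu i))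
             (\prod_i c i (mu i + (l.-1 - i))%N) * JT h (fun i => mu i).
Proof.
move=> HM Hlt Hni.
case: l c M HM Hlt Hni => [|l] c M HM Hlt Hni.
  have f0 : {ffun 'I_0 -> 'I_D} by apply: finfun; case.
  rewrite (big_pred1 f0) => [|f].
    by rewrite /JT big_ord0 mul1r; congr (\det _); apply/matrixP => -[].
  rewrite /= (_ : nonincr _ = true); last by apply/nonincrP; case.
  by apply/esym/eqP/ffunP; case.
case: D HM Hlt => [|D] HM Hlt.
  rewrite big_pred0 => [|f]; last by case: (f ord0).
  rewrite (expand_det_row _ ord_max) big1 // => j _; rewrite HM big1 ?mul0r // => g _.
  have [->|/Hlt] := eqVneq (c ord_max g) 0; first by rewrite mul0r.
  by rewrite /= subnn.
have -> : M = \matrix_(i, j) \sum_(g < D.+1 + l.+1) c i g * subz h (g + j) l.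
  by apply/matrixP => i j; rewrite mxE.
rewrite det_sum_rows.
pose T (f : {ffun 'I_l.+1 -> 'I_(D.+1 + l.+1)}) :=
  (\prod_i c i (f i)) * \det (\matrix_(i < l.+1, j < l.+1) subz h (f i + j) l).
rewrite (eq_bigr T); last first.
  move=> f _; rewrite /T.
  have -> : \matrix_(i < l.+1, j < l.+1) (c i (f i) * subz h (f i + j) l) =
     diag_mx (\row_i c i (f i)) *m \matrix_(i < l.+1, j < l.+1) subz h (f i + j) l.
    by apply/matrixP => i j; rewrite mul_diag_mx !mxE.
  rewrite det_mulmx det_diag; congr (_ * _); apply: eq_bigr => i _; by rewrite mxE.
pose str (f : {ffun 'I_l.+1 -> 'I_(D.+1 + l.+1)}) :=
  [forall i, f i < D.+1 + (l - i)]%N &&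
  [forall i : 'I_l.+1, forall j : 'I_l.+1, (i < j)%N ==> (f j < f i)%N].
rewrite (bigID str) /= [X in _ + X]big1 ?addr0; last first.
  move=> f; rewrite /T => nstr.
  have [/fintype.forallP c0|] := boolP [forall i, c i (f i) != 0]; last first.
    by case/fintype.forallPn => i; rewrite negbK => /eqP ci; rewrite (bigD1 i) //= ci !mul0r.
  move: nstr; rewrite negb_and; case/orP => nf; case/fintype.forallPn: nf => i.
    by case/negP; apply: Hlt.
  case/fintype.forallPn => j; rewrite negb_imply -leqNgt => /andP[ij le].
  rewrite [X in _ * X](determinant_alternate (i1 := i) (i2 := j)) ?mulr0 //.
    by apply: contraTneq ij => ->; rewrite ltnn.
  move=> k; rewrite !mxE; congr (subz _ (_ + _) _); apply/eqP; rewrite eqn_leq le.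
  by rewrite (Hni i j).
have mlt (mu : {ffun 'I_l.+1 -> 'I_D.+1}) (i : 'I_l.+1) : (mu i + (l - i) < D.+1 + l.+1)%N.
  by have := ltn_ord (mu i); have := ltn_ord i; lia.
pose up (mu : {ffun 'I_l.+1 -> 'I_D.+1}) : {ffun 'I_l.+1 -> 'I_(D.+1 + l.+1)} := [ffun i => Ordinal (mlt mu i)].
have chain f : str f -> forall d (i j : 'I_l.+1), j = (i + d)%N :> nat -> (f j + d <= f i)%N.
  case/andP => _ /fintype.forallP H; elim=> [|d IHd] i j ji.
    by move: ji; rewrite !addn0 => /val_inj ->.
  have lt : (i + d < l.+1)%N by have := ltn_ord j; lia.
  have := IHd i (Ordinal lt) erefl.
  have /fintype.forallP/(_ j)/implyP := H (Ordinal lt); rewrite /= ji addnS ltnS leqnn.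
  by move/(_ isT); lia.
(* This makes the truncated subtraction in the inverse of [up] exact. *)
have strge f (i : 'I_l.+1) : str f -> (l - i <= f i)%N.
  move=> sf; have := chain f sf (l - i)%N i ord_max; rewrite /=.
  by have := ltn_ord i; lia.
rewrite (reindex_onto up (fun f => [ffun i => inord (f i - (l - i))%N])) /=; last first.
  move=> f sf; apply/ffunP => i; apply: val_inj; rewrite /= ffunE /= ffunE.
  have /andP[/fintype.forallP/(_ i) lt _] := sf; rewrite inordK; have := strge _ i sf; lia.
apply: eq_big => [mu|mu _].
  apply/andP/nonincrP => [[sf _] i j|H].
    move=> ij; have := chain _ sf (j - i)%N i j; rewrite subnKC // !ffunE /= => /(_ erefl).
    by have := ltn_ord j; lia.
  split; last first.
    apply/eqP/ffunP => i; apply: val_inj; rewrite !ffunE /= addnK inord_val //.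
  apply/andP; split; apply/fintype.forallP => i.
    by rewrite ffunE /= ltn_add2r.
  apply/fintype.forallP => j; apply/implyP => ij; rewrite !ffunE /=.
  by have := H _ _ (ltnW ij); have := ltn_ord j; lia.
rewrite /T JT_beta; congr (_ * _).
  by apply: eq_bigr => i _; rewrite ffunE.
by congr (\det _); apply/matrixP => i j; rewrite !mxE ffunE.
Qed.

(** On generating functions, [mul1p y] is multiplication by 1 + y z and [mulgeo x] is division by 1
    - x z. *)
Definition mul1p y h (k : nat) : R := h k + (if k is k'.+1 then y * h k' else 0).

Definition mulgeo x h (k : nat) : R := \sum_(s < k.+1) x ^+ s * h (k - s)%N.

Lemma mulgeo0 x h : mulgeo x h 0 = h 0%N.
Proof. by rewrite /mulgeo big_ord1 mul1r. Qed.

Lemma mulgeoS x h k : mulgeo x h k.+1 = h k.+1 + x * mulgeo x h k.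
Proof.
rewrite /mulgeo big_ord_recl mul1r subn0; congr (_ + _); rewrite mulr_sumr.
by apply: eq_bigr => i _; rewrite exprS mulrA.
Qed.

Lemma mul1p_mulgeo x y h : mul1p y (mulgeo x h) =1 mulgeo x (mul1p y h).
Proof.
elim=> [|k IHk]; first by rewrite /mul1p !mulgeo0.
rewrite mulgeoS -IHk /mul1p mulgeoS; case: k {IHk} => [|k]; rewrite ?mulgeo0 ?mulgeoS; ring.
Qed.

Lemma prod_strip_exp l (P : pred 'I_l) x (e : 'I_l -> nat) :
  \prod_i (if P i then x ^+ e i else 0) =
  if [forall i, P i] then x ^+ (\sum_i e i) else 0.
Proof.
case: ifPn => [/fintype.forallP H|/fintype.forallPn[i /negbTE Pi]].
  by rewrite expr_sum; apply: eq_bigr => i _; rewrite H.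
by rewrite (bigD1 i) //= Pi mul0r.
Qed.

(** Each row is its old self plus y times the row with the beta-number lowered by one, so every part
    of la drops by 0 or 1. *)
Lemma JT_mul1p h y l D (la : 'I_l -> nat) : nonincr la -> (forall i, la i < D)%N ->
  JT (mul1p y h) la =
  \sum_(mu : {ffun 'I_l -> 'I_D} | nonincr (fun i => mu i) && vstrip la (fun i => mu i))
     y ^+ (\sum_i (la i - mu i)) * JT h (fun i => mu i).
Proof.
move=> /nonincrP ni ltD; rewrite JT_beta.
pose be (i : 'I_l) := (la i + (l.-1 - i))%N.
pose c i g := if (g <= be i <= g.+1)%N then y ^+ (be i - g) else 0.
have cP i g : c i g != 0 -> (g <= be i <= g.+1)%N by rewrite /c; case: ifP => //; rewrite eqxx.
rewrite (@JT_expand h l D c) => [|i j|i g /cP|i j g g' /cP + /cP].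
- rewrite big_mkcondr; apply: eq_bigr => mu _.
  rewrite (eq_bigr (fun i => if (mu i <= la i <= (mu i).+1)%N then y ^+ (la i - mu i) else 0)).
    by rewrite prod_strip_exp -/(vstrip _ _); case: ifP; rewrite ?mul0r.
  move=> i _; rewrite /c /be -addSn !leq_add2r; case: ifP => // _.
  by rewrite subnDr.
- rewrite mxE -/(be i).
  have bl : (be i < D + l)%N by rewrite /be; have := ltD i; have := ltn_ord i; lia.
  rewrite (bigD1 (Ordinal bl)) //= /c leqnn leqnSn subnn mul1r.
  case e: (be i) bl => [|b] bl.
    rewrite big1 => [|g]; last first.
      by rewrite -val_eqE /= => g0; rewrite ifF ?mul0r //; lia.
    rewrite addr0 /subz add0n; case: ifP => // lj.
    have -> : (j - l.-1 = 0)%N by have := ltn_ord j; lia.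
    by rewrite /mul1p addr0.
  have bl' : (b < D + l)%N by lia.
  rewrite (bigD1 (Ordinal bl')) /=; last by rewrite -val_eqE /=; lia.
  rewrite leqnSn leqnn subSnn expr1 big1 ?addr0; last first.
    move=> g /andP[]; rewrite -!val_eqE /= => g0 g1; rewrite ifF ?mul0r //; lia.
  rewrite /subz /mul1p; case: (ltngtP l.-1 (b.+1 + j)%N) => H.
  + rewrite (_ : (l.-1 <= b + j)%N); last by lia.
    have -> : (b.+1 + j - l.-1 = (b + j - l.-1).+1)%N by lia.
    by [].
  + by rewrite leqNgt (leq_trans _ H) ?mulr0 ?addr0 //; lia.
  + rewrite -H subnn addr0 (_ : (l.-1 <= b + j)%N = false) ?mulr0 ?addr0 //; lia.
- by rewrite /be => /andP[+ _]; have := ltD i; lia.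
- rewrite /be => H1 H2 ij; have := ni _ _ (ltnW ij); have := ltn_ord j; lia.
Qed.

(** Row i expands over all beta-numbers g up to that of la_i, so the ranges of different rows
    overlap. Row operations cut the range of row i off above the beta-number of la_(i+1). The
    condition left is la_(i+1) <= mu_i <= la_i, and the expansion applies. *)
Lemma JT_mulgeo h x l D (la : 'I_l -> nat) : nonincr la -> (forall i, la i < D)%N ->
  JT (mulgeo x h) la =
  \sum_(mu : {ffun 'I_l -> 'I_D} | nonincr (fun i => mu i) && hstrip la (fun i => mu i))
     x ^+ (\sum_i (la i - mu i)) * JT h (fun i => mu i).
Proof.
move=> /nonincrP ni ltD; rewrite JT_beta.
pose be (i : 'I_l) := (la i + (l.-1 - i))%N.
pose nx (i : 'I_l) := if insub i.+1 is Some j then (be j).+1 else 0%N.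
(* Subtracting x^(be_i - be_(i+1)) times row i + 1 from row i cancels exactly the terms with g <=
   be_(i+1). *)
pose U : 'M[R]_l := \matrix_(i, j)
  if i == j then 1 else if j == i.+1 :> nat then - x ^+ (be i - be j) else 0.
have detU : \det U = 1.
  rewrite -det_tr det_trig; last first.
    apply/is_trig_mxP => i j ij; rewrite !mxE ifF; last by rewrite -val_eqE /=; lia.
    rewrite ifF //; lia.
  by rewrite big1 // => i _; rewrite !mxE eqxx.
set M := \matrix_(i, j) _; rewrite -[\det M]mul1r -detU -det_mulmx.
pose c i g := if (nx i <= g <= be i)%N then x ^+ (be i - g) else 0.
have cP i g : c i g != 0 -> (nx i <= g <= be i)%N by rewrite /c; case: ifP => //; rewrite eqxx.
have row_geo b j : (b < D + l)%N -> (j < l)%N -> subz (mulgeo x h) (b + j) l.-1 =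
    \sum_(g < D + l | (g <= b)%N) x ^+ (b - g) * subz h (g + j) l.-1.
  move=> bl jl; rewrite /subz; case: ifP => lb; last first.
    by rewrite big1 // => g gb; rewrite ifF ?mulr0 //; lia.
  rewrite /mulgeo.
  rewrite -(big_mkord (fun g => g <= b)%N (fun g => x ^+ (b - g) * if (l.-1 <= g + j)%N then h (g + j - l.-1)%N else 0)).
  rewrite (@big_cat_nat _ _ _ b.+1) //= [X in _ + X]big_nat_cond [X in _ + X]big1 ?addr0; last first.
    by move=> g /andP[]; lia.
  rewrite big_nat_cond (eq_bigl (fun g => (0 <= g < b.+1)%N)); last by move=> g /=; lia.
  rewrite -big_nat (@big_cat_nat _ _ _ (l.-1 - j)%N) //=; last by lia.
  rewrite [X in X + _]big_nat_cond [X in X + _]big1 ?add0r; last first.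
    by move=> g /andP[lt _]; rewrite ifF ?mulr0 //; lia.
  rewrite big_nat_rev /= -{1}[(l.-1 - j)%N]add0n big_addn big_mkord.
  have -> : (b.+1 - (l.-1 - j) = (b + j - l.-1).+1)%N by lia.
  apply: eq_bigr => g _; have := ltn_ord g => lg.
  rewrite ifT; last by lia.
  congr (x ^+ _ * h _); lia.
rewrite (@JT_expand h l D c) => [|i j|i g /cP|i j g g' /cP + /cP].
- rewrite big_mkcondr; apply: eq_bigr => mu _.
  rewrite (eq_bigr (fun i => if (mu i <= la i)%N && [forall j : 'I_l, (j == i.+1 :> nat) ==> (la j <= mu i)%N]
       then x ^+ (la i - mu i) else 0)).
    rewrite prod_strip_exp; have -> : hstrip la (fun i => mu i) = [forall i, (mu i <= la i)%N && [forall j : 'I_l, (j == i.+1 :> nat) ==> (la j <= mu i)%N]].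
      apply/andP/fintype.forallP => [[/fintype.forallP H1 /fintype.forallP H2] i|H].
        by rewrite H1 H2.
      by split; apply/fintype.forallP => i; have /andP[] := H i.
    by case: ifP; rewrite ?mul0r.
  move=> i _; rewrite /c subnDr; congr (if _ then _ else _).
  rewrite leq_add2r andbC; congr (_ && _); rewrite /nx /be.
  case: insubP => [j _ /= ji|ni'] /=.
    apply/idP/fintype.forallP => [H k|/(_ j)]; last first.
      by rewrite ji eqxx /=; have := ltn_ord j; lia.
    apply/implyP => /eqP ki; have -> : k = j by apply: val_inj; rewrite /= ki ji.
    have := ltn_ord j; lia.
  apply/esym/fintype.forallP => k; apply/implyP => /eqP ki; have := ltn_ord k; lia.
- have bl k : (be k < D + l)%N by rewrite /be; have := ltD k; have := ltn_ord k; lia.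
  rewrite mxE (bigD1 i) //= !mxE eqxx mul1r -/(be i) (row_geo _ _ (bl i)) //.
  rewrite /c /nx; case: insubP => [k _ /= ki|ni'] /=.
    have bk : (be k < be i)%N.
      by rewrite /be; have := ni i k; have := ltn_ord k; lia.
    rewrite (bigD1 k) /=; last by rewrite -val_eqE /=; lia.
    rewrite !mxE -/(be k) ifF; last by rewrite -val_eqE /=; lia.
    rewrite ki eqxx (row_geo _ _ (bl k)) // [X in _ + (_ + X)]big1 ?addr0; last first.
      move=> k' /andP[k1 k2]; rewrite !mxE ifF; last by rewrite eq_sym; apply: negbTE.
      rewrite ifF ?mul0r //; apply: contraNF k2 => /eqP e; apply/eqP/val_inj; by rewrite /= e ki.
    rewrite mulr_sumr big_mkcond [X in _ + X]big_mkcond -big_split /=; apply: eq_bigr => g _.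
    case: (leqP g (be k)) => gk.
      rewrite ifT; last by lia.
      rewrite mul0r mulrA mulNr -exprD.
      have -> : (be i - be k + (be k - g) = be i - g)%N by lia.
      by rewrite mulNr subrr.
    by rewrite addr0; case: ifP; rewrite ?mul0r.
  rewrite [X in _ + X]big1 ?addr0; last first.
    move=> k ki; rewrite !mxE ifF; last by rewrite eq_sym; apply: negbTE.
    rewrite ifF ?mul0r //; apply/eqP => e; have := ltn_ord k; lia.
  rewrite big_mkcond; apply: eq_bigr => g _ /=; by case: ifP; rewrite ?mul0r.
- by rewrite /be => /andP[_]; have := ltD i; lia.
- move=> /andP[H1 H2] /andP[H3 H4] ij; apply: leq_trans H1; apply: leq_trans H4 _.
  rewrite /nx; case: insubP => [k _ /= ki|] /=; last by have := ltn_ord j; lia.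
  rewrite /be; have := ni k j; have := ltn_ord j; lia.
Qed.

Lemma JT_recr h l (la : 'I_l.+1 -> nat) : h 0%N = 1 -> la ord_max = 0%N ->
  JT h la = JT h (fun i : 'I_l => la (widen_ord (leqnSn l) i)).
Proof.
move=> h0 la0; rewrite {1}/JT (expand_det_row _ ord_max) (bigD1 ord_max) //=.
rewrite [X in _ + X]big1 ?addr0; last first.
  move=> j jm; rewrite mxE la0 /subz add0n ifF ?mul0r //=.
  by have := ltn_ord j; move: jm; rewrite -val_eqE /=; lia.
rewrite mxE la0 /subz add0n leqnn subnn h0 mul1r /cofactor addnn -signr_odd odd_double mul1r.
congr (\det _); apply/matrixP => i j; rewrite !mxE.
have e k : lift ord_max k = widen_ord (leqnSn l) k :> 'I_l.+1.
  by apply: val_inj; rewrite /= /bump leqNgt ltn_ord.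
by rewrite !e.
Qed.

End JacobiTrudi.

(** * Supersymmetric complete functions and factorization of their determinants *)

Section SuperH.
Variable R : comNzRingType.
Implicit Types (h : nat -> R) (l D : nat) (x y : R) (a b : seq R).

Definition delta0 (k : nat) : R := (k == 0%N)%:R.

(* The coefficients of prod_b (1 + b z) / prod_a (1 - a z). *)
Definition hs a b : nat -> R := foldr (@mulgeo R) (foldr (@mul1p R) delta0 b) a.

Lemma eq_mulgeo x h h' : h =1 h' -> mulgeo x h =1 mulgeo x h'.
Proof. by move=> eh k; apply: eq_bigr => i _; rewrite eh. Qed.

Lemma eq_mul1p x h h' : h =1 h' -> mul1p x h =1 mul1p x h'.
Proof. by move=> eh k; rewrite /mul1p eh; case: k => // k; rewrite eh. Qed.

Lemma hs_consr a y b : hs a (y :: b) =1 mul1p y (hs a b).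
Proof.
elim: a => //= x a IHa k; rewrite -/(hs a b) mul1p_mulgeo.
exact: eq_mulgeo.
Qed.

Lemma hs0 a b : hs a b 0 = 1.
Proof.
elim: a => [|x a IHa]; last by rewrite /= mulgeo0.
elim: b => //= y b IHb; by rewrite /mul1p addr0.
Qed.

Lemma hs_nil_big b k : (size b < k)%N -> hs [::] b k = 0.
Proof.
elim: b k => [|y b IHb] [|k] // bk.
by rewrite hs_consr /mul1p !IHb ?mulr0 ?addr0 //; apply: leqW.
Qed.

Lemma JT_delta0 l (la : 'I_l -> nat) : nonincr la ->
  JT delta0 la = [forall i, la i == 0%N]%:R.
Proof.
move=> /nonincrP ni; case: (boolP [forall i, la i == 0%N]) => l0; last first.
  case/fintype.forallPn: l0 => i li; have l0 : (0 < l)%N by have := ltn_ord i; lia.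
  case: l la ni i li l0 => // l la ni i li _.
  rewrite /JT (expand_det_row _ ord0) big1 // => j _; rewrite mxE /subz /delta0 leq0n subn0.
  have := ni ord0 i isT; case: eqP; rewrite ?mul0r //; lia.
move/fintype.forallP: l0 => l0.
rewrite (@eq_JT _ _ delta0 _ _ (fun=> 0%N)) => [||i]; rewrite ?(eqP (l0 i)) //.
rewrite /JT -(det1 R l); congr (\det _); apply/matrixP => i j; rewrite !mxE add0n /subz /delta0.
case: (ltngtP i j) => ij.
- by rewrite subn_eq0 leqNgt ij -val_eqE ltn_eqF.
- by rewrite -val_eqE gtn_eqF.
- by rewrite ij subnn eqxx -val_eqE /= ij eqxx.
Qed.

(* Entries of column j can be computed without the first j variables of a. *)
Lemma JT_drop a b l s (la : 'I_l -> nat) : (s <= size a)%N ->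
  JT (hs a b) la =
  \det (\matrix_(i < l, j < l) subz (hs (drop (minn j s) a) b) (la i + j) i).
Proof.
elim: s => [|s IHs] sa.
  by congr (\det _); apply/matrixP => i j; rewrite !mxE minn0 drop0.
rewrite {}IHs ?(ltnW sa) //.
pose x := nth 0 a s.
have dropS : drop s a = x :: drop s.+1 a by rewrite (drop_nth 0 sa).
(* Subtracting x times column j - 1 from column j, for j > s, cancels the factor 1 / (1 - x z)
   there. Columns j - 1 and j still carry the same variables at that stage. *)
pose U : 'M[R]_l := \matrix_(i, j)
  if i == j then 1 else if (j == i.+1 :> nat) && (s < j)%N then - x else 0.
have detU : \det U = 1.
  rewrite -det_tr det_trig; last first.
    apply/is_trig_mxP => i j ij; rewrite !mxE ifF; last by rewrite -val_eqE /=; lia.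
    rewrite ifF //; lia.
  by rewrite big1 // => i _; rewrite !mxE eqxx.
rewrite -[LHS]mulr1 -detU -det_mulmx; congr (\det _); apply/matrixP => i j; rewrite !mxE.
rewrite (bigD1 j) //= !mxE eqxx mulr1.
case: (leqP j s) => js.
  rewrite big1 ?addr0; last first.
    by move=> k kj; rewrite !mxE (negbTE kj) ifF ?mulr0 //; apply/negP => /andP[/eqP]; lia.
  by rewrite (minn_idPl (leqW js)).
have j1 : (j.-1 < l)%N by have := ltn_ord j; lia.
rewrite (bigD1 (Ordinal j1)) /=; last by rewrite -val_eqE /=; lia.
rewrite big1 ?addr0; last first.
  move=> k /andP[kj kj1]; rewrite !mxE (negbTE kj) ifF ?mulr0 //; apply/negP => /andP[/eqP jk _].
  by case/eqP: kj1; apply: val_inj; rewrite /= jk.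
rewrite !mxE ifF; last by rewrite -val_eqE /=; lia.
rewrite /= prednK ?eqxx ?js //=; last by lia.
have -> : minn j.-1 s = s by lia.
rewrite (minn_idPr js) dropS /= -/(hs _ _) /subz.
case: (ltngtP i (la i + j)) => ij.
- rewrite ifT; last by lia.
  have -> : (la i + j - i = (la i + j.-1 - i).+1)%N by lia.
  rewrite mulgeoS; ring.
- by rewrite ifF ?mul0r ?addr0 //; lia.
rewrite -ij ifF; last by lia.
by rewrite mul0r addr0 subnn mulgeo0.
Qed.

(** After the column operations the columns from p on involve b only, and [hs [::] b] vanishes above
    degree [size b]. In the first p rows the subscripts there exceed [size b], so the matrix is
    block triangular. *)
Lemma JT_split a b p k (la : 'I_(p + k) -> nat) : size a = p ->
  (forall i : 'I_p, size b <= la (lshift k i))%N ->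
  JT (hs a b) la = JT (hs a b) (fun i => la (lshift k i)) *
                   JT (hs [::] b) (fun i => la (rshift p i)).
Proof.
move=> sa big_la; rewrite (@JT_drop a b _ p) ?sa //.
pose M := (\matrix_(i < p + k, j < p + k) subz (hs (drop (minn j p) a) b) (la i + j) i).
rewrite -/M -(submxK M).
have -> : ursubmx M = 0.
  apply/matrixP => i j; rewrite !mxE /= (minn_idPr _) ?leq_addr // drop_oversize ?sa //.
  rewrite /subz; case: ifP => // ij; rewrite hs_nil_big //.
  by have := big_la i; have := ltn_ord i; lia.
rewrite det_lblock (@JT_drop a b _ p) ?sa //; congr (_ * _).
  by congr (\det _); apply/matrixP => i j; rewrite !mxE.
congr (\det _); apply/matrixP => i j; rewrite !mxE /= (minn_idPr _) ?leq_addr //.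
rewrite drop_oversize ?sa // /subz addnCA leq_add2l; case: ifP => // ij.
by congr hs; lia.
Qed.

Section Square.
Variable a : seq R.
Let p := size a.

(* sg b m is row m of the square Jacobi-Trudi matrix after column operations;
   shifting m amounts to a bidiagonal matrix with diagonal a. *)
Let sg b (m : nat) : 'rV[R]_p := \row_j subz (hs (drop j a) b) (m + j) p.-1.

Let C : 'M[R]_p := \matrix_(i, j)
  if i == j then nth 0 a j else if (i == j.+1 :> nat) then 1 else 0.

Let det_Cy y : \det (C + y%:M) = \prod_(j < p) (nth 0 a j + y).
Proof.
rewrite det_trig.
  by apply: eq_bigr => i _; rewrite !mxE eqxx mulr1n.
apply/is_trig_mxP => i j ij; rewrite !mxE -val_eqE ltn_eqF //= mulr0n addr0.
rewrite ifF //; lia.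
Qed.

Let sg_shift m : sg [::] m.+1 = sg [::] m *m C.
Proof.
apply/rowP => j; rewrite !mxE (bigD1 j) //= !mxE eqxx.
have := ltn_ord j => lj.
rewrite (drop_nth 0 lj) /= -/(hs _ _).
case: (ltnP j.+1 p) => jp.
  rewrite (bigD1 (Ordinal jp)) /=; last by rewrite -val_eqE /=; lia.
  rewrite big1 ?addr0; last first.
    move=> i /andP[i1 i2]; rewrite !mxE (negbTE i1) ifF ?mulr0 //.
    by apply: contraNF i2 => /eqP e; apply/eqP/val_inj.
  rewrite !mxE ifF; last by rewrite -val_eqE /=; lia.
  rewrite eqxx /= mulr1 /subz addSnnS addnS.
  case: (ltngtP p.-1 (m + j).+1) => ij.
  - rewrite ifT; last by lia.
    have -> : ((m + j).+1 - p.-1 = (m + j - p.-1).+1)%N by lia.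
    rewrite mulgeoS -[RHS]addrC; congr (_ + _); rewrite mulrC //.
  - by rewrite ifF ?mul0r ?addr0 //; lia.
  rewrite -ij ifF; last by lia.
  by rewrite subnn mulgeo0 mul0r add0r.
rewrite big1 ?addr0; last first.
  move=> i i1; rewrite !mxE (negbTE i1) ifF ?mulr0 //.
  by apply/eqP => e; have := ltn_ord i; lia.
have jE : p.-1 = j by lia.
rewrite /subz jE !leq_addl !addnK mulgeoS drop_oversize //=.
by rewrite /delta0 /= add0r mulrC.
Qed.

(** A factor 1 + y z turns row m + 1 into row m + 1 plus y times row m, that is, row m multiplied by
    C + y. *)
Let sg_prod b m : (size b <= m)%N ->
  sg b m = sg [::] (m - size b)%N *m (\prod_(y <- b) (C + y%:M)).
Proof.
elim: b m => [|y b IHb] m; first by rewrite big_nil subn0 => _; rewrite -[1]/(1%:M) mulmx1.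
case: m => // m; rewrite ltnS => bm.
have -> : sg (y :: b) m.+1 = sg b m.+1 + y *: sg b m.
  apply/rowP => j; rewrite !mxE /subz.
  case: (ltngtP p.-1 (m.+1 + j)%N) => ij.
  - rewrite ifT; last by lia.
    have -> : (m.+1 + j - p.-1 = (m + j - p.-1).+1)%N by lia.
    by rewrite hs_consr /mul1p.
  - by rewrite ifF ?mulr0 ?addr0 //; lia.
  rewrite -ij [X in _ + _ * (if X then _ else _)](_ : _ = false); last by lia.
  by rewrite subnn mulr0 addr0 !hs0.
rewrite !IHb //; last exact: leqW.
rewrite big_cons subSS subSn // sg_shift.
by rewrite -mulmxE mulmxA mulmxDr mul_mx_scalar mulmxDl -scalemxAl.
Qed.

Let sqmx b (be : 'I_p -> nat) : 'M[R]_p := \matrix_(i, j) sg b (be i) 0 j.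

Let JT_sqmx b (la : 'I_p -> nat) :
  JT (hs a b) la = \det (sqmx b (fun i => la i + (p.-1 - i))%N).
Proof.
rewrite (@JT_drop a b _ p) //; congr (\det _); apply/matrixP => i j; rewrite !mxE.
have -> : minn j p = j by have := ltn_ord j; lia.
rewrite /subz; have -> : (p.-1 <= la i + (p.-1 - i) + j)%N = (i <= la i + j)%N.
  by have := ltn_ord i; lia.
by case: ifP => // ij; congr hs; have := ltn_ord i; lia.
Qed.

(** The part at least [size b] of every row lets all factors C + y be pulled out on the right at
    once; the determinant of C + y is the product of the a_i + y. *)
Lemma JT_square b (mu : 'I_p -> nat) :
  JT (hs a b) (fun i => mu i + size b)%N =
  (\prod_(i < p) \prod_(y <- b) (nth 0 a i + y)) * JT (hs a [::]) mu.
Proof.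
rewrite !JT_sqmx.
have -> : sqmx b (fun i => mu i + size b + (p.-1 - i))%N =
    sqmx [::] (fun i => mu i + (p.-1 - i))%N *m \prod_(y <- b) (C + y%:M).
  apply/row_matrixP => i; rewrite row_mul.
  have e c be : row i (sqmx c be) = sg c (be i).
    by apply/rowP => j; rewrite !mxE.
  rewrite !e sg_prod; last by lia.
  by congr (sg _ _ *m _); lia.
rewrite det_mulmx mulrC; congr (_ * _); rewrite exchange_big /=.
elim: b => [|y b IHb]; first by rewrite !big_nil det1.
by rewrite !big_cons det_mulmx det_Cy IHb.
Qed.

(* Newton interpolation of t^m at the points a, evaluated at a_r. *)
Let sg_interp m (r : 'I_p) :
  \sum_(j < p) sg [::] m 0 j * \prod_(i < p | (j < i)%N) (nth 0 a r - nth 0 a i) =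
  nth 0 a r ^+ m.
Proof.
pose v (j : nat) := \prod_(i < p | (j < i)%N) (nth 0 a r - nth 0 a i).
rewrite -/(v _); elim: m => [|m IHm].
  have lp : (p.-1 < p)%N by have := ltn_ord r; lia.
  rewrite (bigD1 (Ordinal lp)) //= [X in _ + X]big1 ?addr0.
    rewrite !mxE /subz add0n leqnn subnn hs0 mul1r big_pred0 // => i /=.
    by have := ltn_ord i; lia.
  move=> j; rewrite -val_eqE /= => jp; rewrite !mxE /subz add0n ifF ?mul0r //.
  by have := ltn_ord j; lia.
rewrite exprS -IHm mulr_sumr.
pose u (j : nat) := if insub j is Some j' then sg [::] m 0 j' else 0.
have uE (j : 'I_p) : u j = sg [::] m 0 j by rewrite /u valK.
have up : u p = 0 by rewrite /u insubF // ltnn.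
have sgS (j : 'I_p) : sg [::] m.+1 0 j = nth 0 a j * u j + u j.+1.
  rewrite sg_shift mxE (bigD1 j) //= -uE !mxE eqxx mulrC; congr (_ + _).
  rewrite /u; case: insubP => [k _ /= kj|jp].
    rewrite (bigD1 k) /=; last by rewrite -val_eqE /=; lia.
    rewrite big1 ?addr0; last first.
      move=> i /andP[i1 i2]; rewrite !mxE (negbTE i1) ifF ?mulr0 //.
      by apply: contraNF i2 => /eqP e; apply/eqP/val_inj; rewrite /= kj.
    rewrite [C _ _]mxE ifF; last by rewrite -val_eqE /=; lia.
    by rewrite kj eqxx mulr1.
  rewrite big1 // => i i1; rewrite !mxE (negbTE i1) ifF ?mulr0 //.
  by apply/eqP => e; have := ltn_ord i; lia.
under eq_bigr do rewrite sgS mulrDl.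
under [RHS]eq_bigr => j _.
  rewrite -uE mulrCA -[X in _ * (X * _)](subrK (nth 0 a j)) -/(v j).
  rewrite [X in u j * X]mulrDl mulrDr addrC.
  over.
rewrite !big_split /=; congr (_ + _).
  by apply: eq_bigr => j _; rewrite -mulrA mulrCA.
pose F j := u j * \prod_(i < p | (j <= i)%N) (nth 0 a r - nth 0 a i).
have FE (j : 'I_p) : F j = u j * ((nth 0 a r - nth 0 a j) * v j).
  rewrite /F (bigD1 j) //=; congr (_ * (_ * _)); apply: eq_bigl => i.
  by rewrite -val_eqE /=; lia.
have F0 : F 0%N = 0 by rewrite /F (bigD1 r) //= subrr mul0r mulr0.
have Fp : F p = 0 by rewrite /F up mul0r.
rewrite -[RHS](eq_bigr _ (fun j _ => FE j)).
rewrite -(big_mkord xpredT (fun j => F j.+1)) -(big_mkord xpredT F).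
by apply: (addrI (F 0%N)); rewrite -big_nat_recl // big_nat_recr //= Fp F0 addr0 add0r.
Qed.

(** The Newton basis matrix V turns the rows [sg] into powers of the a_r. It therefore factors both
    alternants, and for la = 0 the remaining factor has determinant 1. No division by the
    Vandermonde determinant occurs. *)
Lemma JT_bialternant (la : 'I_p -> nat) :
  JT (hs a [::]) la * \det (\matrix_(i < p, r < p) nth 0 a r ^+ (p.-1 - i)) =
  \det (\matrix_(i < p, r < p) nth 0 a r ^+ (la i + (p.-1 - i))).
Proof.
pose V : 'M[R]_p := \matrix_(j, r) \prod_(i < p | (j < i)%N) (nth 0 a r - nth 0 a i).
have key (be : 'I_p -> nat) : sqmx [::] be *m V = \matrix_(i < p, r < p) nth 0 a r ^+ (be i).
  apply/matrixP => i r; rewrite !mxE -sg_interp; apply: eq_bigr => j _.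
  by rewrite !mxE.
rewrite -!key !det_mulmx -(@JT_sqmx [::] la).
have -> : sqmx [::] (fun i => p.-1 - i)%N = sqmx [::] (fun i => 0%N + (p.-1 - i))%N by [].
suff -> : \det (sqmx [::] (fun i => 0%N + (p.-1 - i))%N) = 1 by rewrite mul1r.
rewrite -JT_sqmx /JT -det_tr det_trig.
  by rewrite big1 // => i _; rewrite !mxE /subz add0n leqnn subnn hs0.
by apply/is_trig_mxP => i j ij; rewrite !mxE /subz add0n ifF //; lia.
Qed.
End Square.
End SuperH.

(** * Hooks, positivity and conjugation *)

Definition hook p q l (la : 'I_l -> nat) : bool :=
  [forall i : 'I_l, (p <= i)%N ==> (la i <= q)%N].

Lemma hookP p q l (la : 'I_l -> nat) :
  reflect (forall i : 'I_l, (p <= i)%N -> (la i <= q)%N) (hook p q la).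
Proof.
by apply: (iffP fintype.forallP) => H i; [have /implyP := H i|apply/implyP; apply: H].
Qed.

(** The witness is the largest vertical strip, one box from each non-empty row: a variable in b buys
    one column of the hook. *)
Lemma hook_vstrip p q l D (la : 'I_l -> nat) : nonincr la -> (forall i, la i < D)%N ->
  reflect (exists mu : {ffun 'I_l -> 'I_D},
     [/\ nonincr (fun i => mu i), vstrip la (fun i => mu i) & hook p q (fun i => mu i)])
    (hook p q.+1 la).
Proof.
move=> /nonincrP ni ltD; apply: (iffP (hookP _ _ _)) => [H|[mu [_ /vstripP v /hookP h]] i pi].
  have lt i : ((la i).-1 < D)%N by have := ltD i; lia.
  exists [ffun i => Ordinal (lt i)]; split.
  - by apply/nonincrP => i j ij; rewrite !ffunE /=; have := ni i j ij; lia.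
  - by apply/vstripP => i; rewrite !ffunE /=; lia.
  - by apply/hookP => i pi; rewrite !ffunE /=; have := H i pi; lia.
by have := v i; have := h i pi; lia.
Qed.

(** The witness is the largest horizontal strip, whose removal replaces la_i by la_(i+1): a variable
    in a buys one row of the hook. *)
Lemma hook_hstrip p q l D (la : 'I_l -> nat) : nonincr la -> (forall i, la i < D)%N ->
  reflect (exists mu : {ffun 'I_l -> 'I_D},
     [/\ nonincr (fun i => mu i), hstrip la (fun i => mu i) & hook p q (fun i => mu i)])
    (hook p.+1 q la).
Proof.
move=> /nonincrP ni ltD; apply: (iffP (hookP _ _ _)) => [H|[mu [_ /hstripP[v1 v2] /hookP h]] i pi].
  pose nx (i : 'I_l) := if insub i.+1 is Some j then la j else 0%N.
  have nx_le i : (nx i <= la i)%N.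
    by rewrite /nx; case: insubP => // j _ /= ji; apply: ni; rewrite ji.
  have lt i : (nx i < D)%N by have := ltD i; have := nx_le i; lia.
  exists [ffun i => Ordinal (lt i)]; split.
  - apply/nonincrP => i j ij; rewrite !ffunE /= /nx.
    case: insubP => // k _ /= kj; case: insubP => [k' _ /= ki|]; last by have := ltn_ord k; lia.
    by apply: ni; lia.
  - apply/hstripP; split=> [i|i j ji]; rewrite !ffunE //=.
    rewrite /nx; case: insubP => [k _ /= ki|]; last by have := ltn_ord j; lia.
    by rewrite (_ : k = j) //; apply: val_inj; rewrite /= ki ji.
  - apply/hookP => i pi; rewrite !ffunE /= /nx.
    by case: insubP => // k _ /= ki; apply: H; lia.
have i1 : (i.-1 < l)%N by have := ltn_ord i; lia.
have := v2 (Ordinal i1) i; rewrite /= prednK; last by lia.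
move/(_ erefl)/leq_trans; apply; apply: h => /=; lia.
Qed.

(** In the branching rules all weights are positive, so a sum of non-negative terms is positive
    exactly when some strip leads to a positive term. Non-negativity and the criterion have to be
    carried through the induction together. *)
Lemma JT_hs_pos (R : realDomainType) (a b : seq R) l (la : 'I_l -> nat) :
  all (fun x => 0 < x) a -> all (fun x => 0 < x) b -> nonincr la ->
  0 <= JT (hs a b) la /\ (0 < JT (hs a b) la) = hook (size a) (size b) la.
Proof.
pose D l' (la' : 'I_l' -> nat) := (\max_i la' i).+1.
have ltD l' (la' : 'I_l' -> nat) i : (la' i < D l' la')%N by rewrite ltnS (leq_bigmax i).
have step (x : R) h l' (la' : 'I_l' -> nat) (P : (('I_l' -> nat) -> bool)) (Q : ('I_l' -> nat) -> bool) :
    0 < x -> (forall mu : 'I_l' -> nat, nonincr mu -> 0 <= JT h mu /\ (0 < JT h mu) = Q mu) ->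
    let S := \sum_(mu : {ffun 'I_l' -> 'I_(D l' la')} | nonincr (fun i => mu i) && P (fun i => mu i))
       x ^+ (\sum_i (la' i - mu i)) * JT h (fun i => mu i) in
    0 <= S /\ (0 < S <-> exists mu : {ffun 'I_l' -> 'I_(D l' la')},
     [/\ nonincr (fun i => mu i), P (fun i => mu i) & Q (fun i => mu i)]).
  move=> x0 Hmu S.
  have t0 (mu : {ffun 'I_l' -> 'I_(D l' la')}) : nonincr (fun i => mu i) && P (fun i => mu i) ->
      0 <= x ^+ (\sum_i (la' i - mu i)) * JT h (fun i => mu i).
    by case/andP => n _; apply: mulr_ge0; [exact/exprn_ge0/ltW|case: (Hmu _ n)].
  split; first exact: sumr_ge0.
  have S0 : 0 <= S by apply: sumr_ge0.
  rewrite lt0r S0 andbT; split=> [|[mu [n Pm Qm]]].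
    rewrite /S psumr_neq0 // => /hasP[mu _ /andP[/andP[n Pm]]].
    rewrite pmulr_rgt0 ?exprn_gt0 // => pos; exists mu; split=> //.
    by case: (Hmu _ n) => _ <-.
  rewrite /S psumr_neq0 //; apply/hasP; exists mu; first exact: mem_index_enum.
  rewrite n Pm pmulr_rgt0 ?exprn_gt0 //=.
  by case: (Hmu _ n) => _ ->.
move=> + b0; elim: b b0 l la => [_|y b IHb /= /andP[y0 b0]] l la a0 ni; last first.
  have e : hs a (y :: b) =1 mul1p y (hs a b) by exact: hs_consr.
  rewrite (eq_JT e (frefl la)) (JT_mul1p _ _ ni (ltD l la)).
  have [] := step y (hs a b) l la (vstrip la) (@hook (size a) (size b) l) y0 _.
    by move=> mu nm; apply: IHb.
  move=> H1 H2; split=> //; apply/idP/(hook_vstrip _ _ ni (ltD l la)); tauto.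
elim: a a0 l la ni => [_|x a IHa /= /andP[x0 a0]] l la ni; last first.
  rewrite -/(hs a [::]) (JT_mulgeo _ _ ni (ltD l la)).
  have [] := step x (hs a [::]) l la (hstrip la) (@hook (size a) 0 l) x0 _.
    by move=> mu nm; apply: IHa.
  move=> H1 H2; split=> //; apply/idP/(hook_hstrip _ _ ni (ltD l la)); tauto.
rewrite /hs /= (JT_delta0 _ ni); rewrite ler0n ltr0n; split=> //.
rewrite lt0b; apply: eq_forallb => i; by rewrite leq0n /= leqn0.
Qed.

Definition cj q l (la : 'I_l -> nat) (j : 'I_q) : nat := #|[set i : 'I_l | j < la i]%N|.

Section Conj.
Variables (q l : nat).

Lemma cjP (la : 'I_l -> nat) (j : 'I_q) (i : 'I_l) : nonincr la ->
  (i < cj la j)%N = (j < la i)%N.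
Proof.
move=> /nonincrP ni; rewrite /cj.
have cI k : (k <= l)%N -> #|[set x : 'I_l | x < k]%N| = k.
  move=> kl; rewrite -sum1_card (eq_bigl (fun x : 'I_l => (x < k)%N)) => [|x]; last by rewrite inE.
  by rewrite (big_ord_narrow kl) sum1_card card_ord.
case: (ltnP j (la i)) => ji.
  have := subset_leq_card (_ : [set x : 'I_l | x < i.+1]%N \subset [set x | (j < la x)%N]).
  rewrite cI //; apply; apply/subsetP => x; rewrite !inE ltnS => xi.
  exact: leq_trans ji (ni _ _ xi).
apply/negbTE; rewrite -leqNgt.
have := subset_leq_card (_ : [set x | (j < la x)%N] \subset [set x : 'I_l | x < i]%N).
rewrite cI; last exact: ltnW; apply; apply/subsetP => x; rewrite !inE => jx.
rewrite ltnNge; apply: contraL jx => ix; rewrite -leqNgt; exact: leq_trans (ni _ _ ix) ji.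
Qed.

Lemma nonincr_cj (la : 'I_l -> nat) : nonincr (@cj q l la).
Proof.
apply/nonincrP => i j ij; apply: subset_leq_card; apply/subsetP => x; rewrite !inE.
exact: leq_ltn_trans.
Qed.

Lemma cj_le (la : 'I_l -> nat) (j : 'I_q) : (cj la j <= l)%N.
Proof. by rewrite -[l in (_ <= l)%N]card_ord; apply: max_card. Qed.

Lemma sum_cj (la : 'I_l -> nat) : (forall i, la i <= q)%N ->
  (\sum_i la i = \sum_(j < q) cj la j)%N.
Proof.
move=> le; rewrite (eq_bigr (fun i : 'I_l => \sum_(j < q) (j < la i))%N); last first.
  move=> i _; rewrite -[LHS]card_ord -sum1_card -(big_ord_narrow (F := fun=> 1%N) (le i)).
  by rewrite big_mkcond; apply: eq_bigr => j _; case: ifP.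
rewrite exchange_big /=; apply: eq_bigr => j _; rewrite /cj -sum1_card [RHS]big_mkcond.
by apply: eq_bigr => i _; rewrite inE; case: ifP.
Qed.
End Conj.

Lemma cjK q l (la : 'I_l -> nat) i : nonincr la -> (la i <= q)%N ->
  cj (@cj q l la) i = la i.
Proof.
move=> ni le; rewrite /cj -sum1_card.
rewrite (eq_bigl (fun j : 'I_q => (j < la i)%N)); last by move=> j; rewrite inE cjP.
by rewrite (big_ord_narrow le) sum1_card card_ord.
Qed.

Lemma hstrip_cj q l (la mu : 'I_l -> nat) : nonincr la -> nonincr mu ->
  (forall i, la i <= q)%N -> (forall i, mu i <= q)%N ->
  hstrip (@cj q l la) (@cj q l mu) = vstrip la mu.
Proof.
move=> nl nm lq mq; apply/hstripP/vstripP => [[H1 H2] i|H].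
  apply/andP; split.
    rewrite leqNgt; apply/negP => lt; have lt' : (la i < q)%N by have := mq i; lia.
    have e1 := cjP (Ordinal lt') i nl; have e2 := cjP (Ordinal lt') i nm.
    by have := H1 (Ordinal lt'); rewrite /= ltnn in e1; rewrite /= lt in e2; lia.
  rewrite leqNgt; apply/negP => lt.
  have lt1 : ((mu i).+1 < q)%N by have := lq i; lia.
  have := H2 (Ordinal (ltnW lt1)) (Ordinal lt1) erefl.
  have e1 := cjP (Ordinal lt1) i nl; have e2 := cjP (Ordinal (ltnW lt1)) i nm.
  by rewrite /= lt in e1; rewrite /= ltnn in e2; lia.
split=> [j|i j ji].
  apply: subset_leq_card; apply/subsetP => i; rewrite !inE => /leq_trans; apply.
  by have /andP[] := H i.
apply: subset_leq_card; apply/subsetP => k; rewrite !inE ji.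
by have /andP[_] := H k; lia.
Qed.

(** Both sides obey the same branching rule when a variable is added, because conjugation exchanges
    vertical and horizontal strips and preserves their sizes. *)
Lemma JT_dual (R : comNzRingType) (b : seq R) q l (la : 'I_l -> nat) :
  nonincr la -> (forall i, la i <= q)%N ->
  JT (hs [::] b) la = JT (hs b [::]) (@cj q l la).
Proof.
elim: b la => [|y b IHb] la ni le.
  rewrite /hs /= !JT_delta0 ?nonincr_cj //; congr (nat_of_bool _)%:R.
  apply/fintype.forallP/fintype.forallP => H j.
    by rewrite /cj cards_eq0; apply/eqP/setP => i; rewrite !inE (eqP (H i)).
  rewrite -(cjK ni (le j)) /cj cards_eq0; apply/eqP/setP => i; rewrite !inE.
  by rewrite -/(cj la i) (eqP (H i)).
have e : hs [::] (y :: b) =1 mul1p y (hs [::] b) by [].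
have e' : hs (y :: b) [::] =1 mulgeo y (hs b [::]) by [].
rewrite (eq_JT e (frefl la)) (eq_JT e' (frefl _)).
rewrite (@JT_mul1p _ _ _ _ q.+1 la) // (@JT_mulgeo _ _ _ _ l.+1) ?nonincr_cj //; last first.
  by move=> j; rewrite ltnS cj_le.
have lt (mu : {ffun 'I_l -> 'I_q.+1}) (j : 'I_q) : (cj (fun i => mu i) j < l.+1)%N.
  by rewrite ltnS cj_le.
have lt' (nu : {ffun 'I_q -> 'I_l.+1}) (i : 'I_l) : (cj (fun i => nu i) i < q.+1)%N.
  by rewrite ltnS cj_le.
pose up (mu : {ffun 'I_l -> 'I_q.+1}) : {ffun 'I_q -> 'I_l.+1} := [ffun j => Ordinal (lt mu j)].
pose dn (nu : {ffun 'I_q -> 'I_l.+1}) : {ffun 'I_l -> 'I_q.+1} := [ffun j => Ordinal (lt' nu j)].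
have upE mu : (fun i => up mu i : nat) =1 cj (fun i => mu i) by move=> i; rewrite ffunE.
have dnE nu : (fun i => dn nu i : nat) =1 cj (fun i => nu i) by move=> i; rewrite ffunE.
have eqcj (k m : nat) (f g : 'I_k -> nat) : f =1 g -> @cj m k f =1 cj g.
  by move=> fg j; apply: eq_card => i; rewrite !inE fg.
have le_ord (k m : nat) (f : {ffun 'I_k -> 'I_m.+1}) i : (f i <= m)%N by rewrite -ltnS.
have eqni (k : nat) (f g : 'I_k -> nat) : f =1 g -> nonincr f = nonincr g.
  move=> fg; apply: eq_forallb => i; apply: eq_forallb => j; by rewrite !fg.
have eqhs (k : nat) (f f' g g' : 'I_k -> nat) : f =1 f' -> g =1 g' -> hstrip f g = hstrip f' g'.
  move=> ff gg; congr andb; apply: eq_forallb => i; rewrite ?ff ?gg //.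
  apply: eq_forallb => j; by rewrite ff.
rewrite [RHS](reindex_onto up dn) /=; last first.
  move=> nu /andP[nn _]; apply/ffunP => j; apply: val_inj.
  by rewrite /= ffunE /= (eqcj _ _ _ _ (dnE nu)) cjK.
apply: eq_big => [mu|mu /andP[nm vm]].
  apply/andP/andP => [[nm vm]|[/andP[nu hu] /eqP du]].
    rewrite (eqni _ _ _ (upE mu)) nonincr_cj /= (eqhs _ _ _ _ _ (frefl _) (upE mu)).
    rewrite hstrip_cj // ; split=> //; apply/eqP/ffunP => i; apply: val_inj.
    by rewrite /= ffunE /= (eqcj _ _ _ _ (upE mu)) cjK.
  have nm : nonincr (fun i => mu i).
    by rewrite -du (eqni _ _ _ (dnE _)) nonincr_cj.
  split=> //; move: hu; rewrite (eqhs _ _ _ _ _ (frefl _) (upE mu)) hstrip_cj //.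
rewrite IHb // (eq_JT (frefl _) (upE mu)); congr (y ^+ _ * _).
have /vstripP v := vm.
rewrite sumnB; last by move=> i _; have /andP[] := v i.
rewrite sumnB; last first.
  move=> j _; rewrite ffunE /=; apply: subset_leq_card; apply/subsetP => i; rewrite !inE.
  by move=> /leq_trans; apply; have /andP[] := v i.
rewrite (@sum_cj q) // (@sum_cj q _ (fun i => mu i)) //; congr (_ - _)%N.
by apply: eq_bigr => j _; rewrite -upE.
Qed.

(** * Evaluation of Schur functions *)

Section SuperNewton.
Variable R : comNzRingType.
Implicit Types (h t Q u v : nat -> R) (x y : R) (a b : seq R).

(** Newton's recursion gives n Q_n; this condition recovers Q_n without dividing, so that integers
    and polynomials over them are covered. *)
Definition torsion_free := forall n (x : R), n.+1%:R * x = 0 -> x = 0.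

Lemma newton_uniq t Q (Q' : nat -> R) : torsion_free -> newton t Q -> newton t Q' -> Q =1 Q'.
Proof.
move=> tf [Q0 HQ] [Q0' HQ']; elim/ltn_ind => -[|n] IHn; first by rewrite Q0 Q0'.
apply/eqP; rewrite -subr_eq0; apply/eqP; apply: (tf n).
rewrite mulrBr HQ // HQ' //; apply/eqP; rewrite subr_eq0; apply/eqP.
by apply: eq_bigr => i _; rewrite IHn.
Qed.

Lemma eq_newton t (t' : nat -> R) Q (Q' : nat -> R) : (forall n, (0 < n)%N -> t n = t' n) -> Q =1 Q' ->
  newton t Q -> newton t' Q'.
Proof.
move=> et eQ [Q0 HQ]; split; first by rewrite -eQ.
move=> n n0; rewrite -eQ HQ //; apply: eq_bigr => i _; rewrite -eQ et //.
by have := ltn_ord i; lia.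
Qed.

Lemma newton_mulgeo t h x : newton t h -> newton (fun j => t j + x ^+ j) (mulgeo x h).
Proof.
case=> h0 Hh; split=> [|n _]; first by rewrite mulgeo0.
have : n%:R * mulgeo x h n = (\sum_(i < n) t (n - i)%N * mulgeo x h i) +
   (\sum_(i < n) x ^+ (n - i) * mulgeo x h i).
  elim: n => [|n IHn]; first by rewrite !big_ord0 mul0r addr0.
  have -> : \sum_(i < n.+1) t (n.+1 - i)%N * mulgeo x h i =
      n.+1%:R * h n.+1 + x * \sum_(i < n) t (n - i)%N * mulgeo x h i.
    rewrite Hh // big_ord_recl mulgeo0 [in RHS]big_ord_recl -addrA; congr (_ + _).
    rewrite mulr_sumr -big_split /=; apply: eq_bigr => i _.
    by rewrite mulgeoS subSS; ring.
  have -> : \sum_(i < n.+1) x ^+ (n.+1 - i) * mulgeo x h i =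
      x * mulgeo x h n + x * \sum_(i < n) x ^+ (n - i) * mulgeo x h i.
    rewrite big_ord_recr /= subSnn expr1 addrC; congr (_ + _); rewrite mulr_sumr.
    by apply: eq_bigr => i _; rewrite subSn ?exprS ?mulrA // ltnW.
  move: IHn; set P := \sum_(i < n) _; set S := \sum_(i < n) _ => IHn.
  have -> : P = n%:R * mulgeo x h n - S by rewrite IHn addrK.
  rewrite mulgeoS -natr1; ring.
by move=> ->; rewrite -big_split; apply: eq_bigr => i _; rewrite mulrDl.
Qed.

Lemma newton_mul1p t h y : newton t h -> newton (fun j => t j - (- y) ^+ j) (mul1p y h).
Proof.
case=> h0 Hh; split=> [|[//|n] _]; first by rewrite /mul1p addr0.
have C : \sum_(i < n.+1) (- y) ^+ (n.+1 - i) * mul1p y h i = - y * h n.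
  elim: n => [|n IHn]; first by rewrite big_ord1 /mul1p addr0 expr1.
  rewrite big_ord_recr /= subSnn expr1.
  have -> : \sum_(i < n.+1) (- y) ^+ (n.+2 - i) * mul1p y h i = - y * (- y * h n).
    rewrite -IHn mulr_sumr; apply: eq_bigr => i _.
    by rewrite subSn ?exprS ?mulrA // ltnW.
  rewrite /mul1p; ring.
have A : \sum_(i < n.+1) t (n.+1 - i)%N * mul1p y h i = n.+1%:R * h n.+1 + y * (n%:R * h n).
  rewrite Hh // big_ord_recl [in RHS]big_ord_recl {1}/mul1p addr0 -addrA; congr (_ + _).
  case: n {C} => [|n]; first by rewrite !big_ord0 mul0r mulr0 addr0.
  rewrite Hh // mulr_sumr -big_split; apply: eq_bigr => i _.
  by rewrite /mul1p /= /bump /= add1n subSS; ring.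
under eq_bigr do rewrite mulrBl.
rewrite sumrB A C /mul1p -natr1; ring.
Qed.

(** The power sums are p_k(a) + (-1)^(k+1) p_k(b), the shape of Thoma's formula on k-cycles. *)
Lemma newton_hs a b :
  newton (fun j => \sum_(x <- a) x ^+ j - \sum_(y <- b) (- y) ^+ j) (hs a b).
Proof.
elim: a => [|x a IHa]; last first.
  apply: eq_newton (newton_mulgeo x IHa) => // n _.
  by rewrite big_cons; ring.
elim: b => [|y b IHb]; last first.
  by apply: eq_newton (newton_mul1p y IHb) => // n _; rewrite !big_nil big_cons; ring.
split=> // -[//|n] _; rewrite /hs /= /delta0 mulr0 big1 // => i _.
by rewrite !big_nil subr0 mul0r.
Qed.

Definition conv u v k := \sum_(i < k.+1) u i * v (k - i)%N.

Lemma convC u v : conv u v =1 conv v u.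
Proof.
move=> k; rewrite /conv (reindex_inj rev_ord_inj); apply: eq_bigr => i _ /=.
by rewrite mulrC subSS subKn // -ltnS.
Qed.

Lemma conv_delta0 v : conv (delta0 R) v =1 v.
Proof.
move=> k; rewrite /conv big_ord_recl mul1r subn0 big1 ?addr0 // => i _.
by rewrite /delta0 mul0r.
Qed.

Lemma conv_mul1p y u v : conv (mul1p y u) v =1 mul1p y (conv u v).
Proof.
case=> [|k]; first by rewrite /conv /mul1p !big_ord1 !addr0.
rewrite /conv /mul1p mulr_sumr [in LHS]big_ord_recl [X in _ = X + _]big_ord_recl.
rewrite addr0 -!addrA; congr (_ + _); rewrite -big_split; apply: eq_bigr => i _.
by rewrite /= /bump /= add1n subSS mulrDl mulrA.
Qed.

Lemma mul1pK x h : mul1p (- x) (mulgeo x h) =1 h.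
Proof.
case=> [|k]; first by rewrite /mul1p mulgeo0 addr0.
by rewrite /mul1p mulgeoS mulNr addrK.
Qed.

Lemma mulgeoK x h : mulgeo x (mul1p (- x) h) =1 h.
Proof. by move=> k; rewrite -mul1p_mulgeo mul1pK. Qed.

Lemma eq_conv u (u' : nat -> R) v (v' : nat -> R) : u =1 u' -> v =1 v' -> conv u v =1 conv u' v'.
Proof. by move=> eu ev k; apply: eq_bigr => i _; rewrite eu ev. Qed.

Lemma conv_mulgeo x u v : conv (mulgeo x u) v =1 mulgeo x (conv u v).
Proof.
move=> k; rewrite -[LHS](mulgeoK x); apply: eq_mulgeo => i.
by rewrite -conv_mul1p; apply: eq_conv => // j; apply: mul1pK.
Qed.

Lemma hs_conv a b : hs a b =1 conv (hs a [::]) (hs [::] b).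
Proof.
elim: a => [|x a IHa] k; first by rewrite [RHS]conv_delta0.
by rewrite /= -!/(hs _ _) conv_mulgeo; apply: eq_mulgeo.
Qed.

Lemma hs_cat a (a' : seq R) : hs (a ++ a') [::] =1 conv (hs a [::]) (hs a' [::]).
Proof.
elim: a => [|x a IHa] k; first by rewrite [RHS]conv_delta0.
by rewrite /= -!/(hs _ _) conv_mulgeo; apply: eq_mulgeo.
Qed.

Lemma hs_opp b k : hs [::] (map -%R b) k = (-1) ^+ k * hs [::] b k.
Proof.
elim: b k => [|y b IHb] k; first by case: k => [|k]; rewrite /= /delta0 ?mul1r ?mulr0.
rewrite map_cons !hs_consr /mul1p IHb; case: k => [|k]; first by rewrite !addr0.
by rewrite IHb exprS; ring.
Qed.

Lemma hs_inv b k : (0 < k)%N ->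
  \sum_(i < k.+1) (-1) ^+ i * hs [::] b i * hs b [::] (k - i)%N = 0.
Proof.
move=> k0; rewrite (eq_bigr (fun i : 'I_k.+1 => hs [::] (map -%R b) i * hs b [::] (k - i)%N)).
  rewrite -/(conv (hs [::] (map -%R b)) (hs b [::]) k).
  transitivity (delta0 R k); last by rewrite /delta0; case: (k) k0.
  elim: b k {k0} => [|y b IHb] k; first by rewrite conv_delta0.
  have e : hs [::] (map -%R (y :: b)) =1 mul1p (- y) (hs [::] (map -%R b)) by [].
  rewrite (eq_conv e (frefl _)) conv_mul1p.
  rewrite (_ : mul1p _ _ k = mul1p (- y) (mulgeo y (conv (hs [::] (map -%R b)) (hs b [::]))) k).
    by rewrite mul1pK.
  apply: eq_mul1p => i; rewrite convC [LHS]conv_mulgeo; apply: eq_mulgeo => j; exact: convC.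
by move=> i _; rewrite hs_opp.
Qed.

Lemma hs_inv' b k : (0 < k)%N ->
  \sum_(i < k.+1) (-1) ^+ i * hs b [::] i * hs [::] b (k - i)%N = 0.
Proof.
move=> k0; transitivity ((-1) ^+ k * 0 : R); last by rewrite mulr0.
rewrite -[X in _ = _ * X](hs_inv b k0) mulr_sumr.
rewrite [RHS](reindex_inj rev_ord_inj); apply: eq_bigr => i _ /=.
rewrite subSS subKn; last by rewrite -ltnS.
rewrite !mulrA -exprD mulrAC; congr (_ * _ * _).
have -> : (k + (k - i) = (k - i).*2 + i)%N by have := ltn_ord i; lia.
by rewrite exprD -mul2n exprM sqrrN !expr1n mul1r.
Qed.
End SuperNewton.

Lemma torsion_free_int : torsion_free int.
Proof. by move=> n x /eqP; rewrite mulf_eq0 pnatr_eq0 => /eqP. Qed.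

Lemma torsion_free_mpoly (A : comNzRingType) n : torsion_free A -> torsion_free {mpoly A[n]}.
Proof.
move=> tf k p; rewrite -mpolyC_nat => /mpolyP kp; apply/mpolyP => m.
by have := kp m; rewrite mcoeffCM mcoeff0 => /tf.
Qed.

Section SymEval.
Variables (A B : comNzRingType) (N : nat) (phi : {rmorphism {mpoly A[N]} -> B}).
Let xs := [seq phi 'X_i | i <- enum 'I_N].

Lemma phi_mesym k : phi (mesym N A k) = hs [::] xs k.
Proof.
have cf b i : hs [::] b i = (\prod_(y <- b) (y *: 'X + 1) : {poly B})`_i.
  elim: b i => [|y b IHb] i; first by rewrite big_nil coef1 /hs /= /delta0 eq_sym.
  rewrite hs_consr big_cons mulrDl mul1r coefD -scalerAl coefZ coefXM /mul1p addrC.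
  by case: i => [|i]; rewrite !IHb /= ?mulr0.
rewrite cf /xs big_map big_enum /= bigA_distr coef_sum /mesym rmorph_sum /= big_mkcond /=.
apply: eq_bigr => h _.
have -> : \prod_i (if i \in h then phi 'X_i *: 'X else 1) = (\prod_(i in h) phi 'X_i) *: 'X^#|h|.
  rewrite -big_mkcond /= -mul_polyC rmorph_prod -prodr_const -big_split /=.
  by apply: eq_bigr => i _; rewrite mul_polyC.
rewrite coefZ coefXn eq_sym; case: eqP => _; last by rewrite mulr0.
by rewrite mulr1 rmorph_prod.
Qed.

Lemma newton_rmorph (S T : comNzRingType) (f : {rmorphism S -> T}) t Q :
  newton t Q -> newton (f \o t) (f \o Q).
Proof.
case=> Q0 HQ; split=> [|n n0] /=; first by rewrite Q0 rmorph1.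
rewrite -(rmorph_nat f n) -rmorphM HQ // rmorph_sum; apply: eq_bigr => i _.
by rewrite rmorphM.
Qed.

Lemma phi_hpoly k : torsion_free B -> phi (hpoly A k N) = hs xs [::] k.
Proof.
move=> tf; pose one (_ : nat) : A := 1.
have n1 : newton one one.
  by split=> // n _; rewrite mulr1 (eq_bigr (fun=> 1)) => [|i _]; rewrite ?mulr1 // sumr_const card_ord.
have H := newton_rmorph phi (newton_Qmulti N n1).
suff H' : newton (fun j => \sum_(x <- xs) x ^+ j - \sum_(y <- [::]) (- y) ^+ j) (fun i => phi (hpoly A i N)).
  exact: (newton_uniq tf H' (newton_hs xs [::]) k).
apply: eq_newton H => [n _|n] /=.
  rewrite mpolyC1 mul1r big_nil subr0 /xs big_map big_enum rmorph_sum; apply: eq_bigr => i _.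
  by rewrite rmorphXn.
congr (phi _); apply/mpolyP => m; rewrite mcoeff_Qmulti mcoeff_hpoly.
by case: eqP => // _; rewrite big1.
Qed.

End SymEval.

Lemma det_rmorph (S T : comNzRingType) (f : {rmorphism S -> T}) n (M : 'M[S]_n) :
  f (\det M) = \det (\matrix_(i, j) f (M i j)).
Proof. by rewrite -det_map_mx; congr (\det _); apply/matrixP => i j; rewrite !mxE. Qed.

Definition part_fun (la : seq nat) (i : 'I_(size la)) : nat := nth 0%N la i.

Lemma rmorph_schur (A B : comNzRingType) N (phi : {rmorphism {mpoly A[N]} -> B}) la :
  torsion_free B ->
  phi (schur A la N) = JT (hs [seq phi 'X_i | i <- enum 'I_N] [::]) (@part_fun la).
Proof.
move=> tf; rewrite /= det_rmorph; congr (\det _); apply/matrixP => i j; rewrite !mxE /subz.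
by case: ifP => _; rewrite ?phi_hpoly ?rmorph0.
Qed.

Lemma map_nth_enum (T : Type) (x0 : T) (s : seq T) :
  [seq nth x0 s (i : 'I_(size s)) | i <- enum 'I_(size s)] = s.
Proof.
rewrite -[RHS](mkseq_nth x0) /mkseq -val_enum_ord -map_comp; exact: eq_map.
Qed.

Lemma sf_eval_schur (A : comNzRingType) la (a : seq A) : torsion_free A ->
  sf_eval (schur A la) a = JT (hs a [::]) (@part_fun la).
Proof.
move=> tf; rewrite /sf_eval (rmorph_schur (meval (fun i : 'I_(size a) => nth 0 a i)) la tf).
rewrite (eq_map (g := fun i : 'I_(size a) => nth 0 a i)) ?map_nth_enum // => i /=.
by rewrite mevalXU.
Qed.

(* The coefficients of 1 / (1 - y_1 z + y_2 z^2 - ...): the polynomial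
   expressing h_k through e_1, e_2, ..., and e_k through h_1, h_2, .... *)
Section Swap.
Variables (A : comNzRingType) (D : nat).

Definition swap_var (i : nat) : {mpoly A[D]} := if insub i.-1 is Some j then 'X_j else 0.

Fixpoint swap_rec (n k : nat) : {mpoly A[D]} :=
  if n is n'.+1 then
    if k is k'.+1 then
      \sum_(i < k) (-1) ^+ i * swap_var i.+1 * swap_rec n' (k - i.+1)
    else 1
  else 1.

Definition swap_poly k := swap_rec k k.

Lemma swap_polyE k : (0 < k)%N ->
  swap_poly k = \sum_(i < k) (-1) ^+ i * swap_var i.+1 * swap_poly (k - i.+1).
Proof.
have H n m j : (j <= n)%N -> (j <= m)%N -> swap_rec n j = swap_rec m j.
  elim: n m j => [|n IHn] [|m] [|j] //= jn jm; apply: eq_bigr => i _.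
  by congr (_ * _); apply: IHn; lia.
rewrite /swap_poly; case: k => // k _; rewrite [LHS]/=; apply: eq_bigr => i _.
by congr (_ * _); apply: H; lia.
Qed.

Lemma comp_swap_poly M (y : nat -> {mpoly A[M]}) (u : nat -> {mpoly A[M]}) k :
  u 0%N = 1 -> (k <= D)%N ->
  (forall m, (0 < m)%N -> u m = \sum_(i < m) (-1) ^+ i * y i.+1 * u (m - i.+1)%N) ->
  swap_poly k \mPo [tuple y i.+1 | i < D] = u k.
Proof.
move=> u0 + Hu; elim/ltn_ind: k => -[|k] IHk kD; first by rewrite /swap_poly /= comp_mpoly1.
rewrite swap_polyE // Hu // rmorph_sum /=; apply: eq_bigr => i _.
have iD : (i < D)%N by have := ltn_ord i; lia.
rewrite !rmorphM /= rmorphXn rmorphN1 IHk; [|lia|lia]; congr (_ * _ * _).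
by rewrite /swap_var insubT /= comp_mpolyXU -tnth_nth tnth_mktuple.
Qed.

End Swap.

Lemma mesym_hpoly_rec (A : comNzRingType) M : torsion_free A -> forall k, (0 < k)%N ->
  hpoly A k M = \sum_(i < k) (-1) ^+ i * mesym M A i.+1 * hpoly A (k - i.+1) M /\
  mesym M A k = \sum_(i < k) (-1) ^+ i * hpoly A i.+1 M * mesym M A (k - i.+1).
Proof.
move=> tf k k0; have tf' := torsion_free_mpoly (n := M) tf.
pose ys := [seq 'X_i : {mpoly A[M]} | i <- enum 'I_M].
have eE i : mesym M A i = hs [::] ys i by exact: (phi_mesym idfun).
have hE i : hpoly A i M = hs ys [::] i by exact: (phi_hpoly idfun i tf').
have step (u v : nat -> {mpoly A[M]}) : v 0%N = 1 -> u 0%N = 1 ->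
    \sum_(i < k.+1) (-1) ^+ i * u i * v (k - i)%N = 0 ->
    v k = \sum_(i < k) (-1) ^+ i * u i.+1 * v (k - i.+1)%N.
  move=> v0 u0; rewrite big_ord_recl u0 !mul1r subn0 => /eqP.
  rewrite addr_eq0 => /eqP ->; rewrite -sumrN; apply: eq_bigr => i _.
  by rewrite /bump /= ?add1n exprS !mulN1r !mulNr opprK.
split.
  rewrite hE (step (hs [::] ys)) ?hs0 ?hs_inv //; apply: eq_bigr => i _; by rewrite eE hE.
rewrite eE (step (hs ys [::])) ?hs0 ?hs_inv' //; apply: eq_bigr => i _; by rewrite eE hE.
Qed.

Section SchurEval2.
Variables (la : seq nat) (a b : seq int).
Let p := size a.
Let B : comNzRingType := {mpoly int[p]}.

Let tfB : torsion_free B.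
Proof. exact: torsion_free_mpoly torsion_free_int. Qed.

Let xy N : {rmorphism {mpoly int[p + N]} -> {mpoly B[N]}} :=
  mmap (@mpolyC N B \o @mpolyC p int) (@xy_var int p N).

Let xy_lshift N i : xy N 'X_(lshift N i) = ('X_i)%:MP.
Proof. by rewrite [LHS]mmapX mmap1U /xy_var (unsplitK (inl i)). Qed.

Let xy_rshift N i : xy N 'X_(rshift p i) = 'X_i.
Proof. by rewrite [LHS]mmapX mmap1U /xy_var (unsplitK (inr i)). Qed.

Let xy_hpoly N k : xy N (hpoly int k (p + N)) =
  \sum_(i < k.+1) (hpoly int i p)%:MP * hpoly B (k - i) N.
Proof.
have tf := torsion_free_mpoly (n := N) tfB.
rewrite phi_hpoly //; set L := map _ _.
pose xs := [seq ('X_i : B)%:MP_[N] | i <- enum 'I_p].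
pose ys := [seq 'X_i : {mpoly B[N]} | i <- enum 'I_N].
have -> : hs L [::] k = hs (xs ++ ys) [::] k.
  apply: (newton_uniq tf (newton_hs L [::])).
  apply: eq_newton (newton_hs (xs ++ ys) [::]) => // n _.
  have sE (S : comNzRingType) m (f : 'I_m -> S) :
      \sum_(x <- [seq f i | i <- enum 'I_m]) x ^+ n = \sum_i f i ^+ n.
    by rewrite big_map big_enum.
  congr (_ - _); rewrite big_cat !sE /= [RHS]big_split_ord /=.
  under [X in _ = X + _]eq_bigr do rewrite xy_lshift.
  by under [X in _ = _ + X]eq_bigr do rewrite xy_rshift.
rewrite hs_cat; apply: eq_bigr => i _; congr (_ * _).
  exact: esym (phi_hpoly (@mpolyC N B : {rmorphism _ -> _}) i tf).
exact: esym (phi_hpoly idfun (k - i)%N tf).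
Qed.

(** [omega] is defined through the polynomial that expresses a symmetric function in the e_i. So an
    explicit such polynomial T is built, by putting the swap polynomials in place of the h_k(y) in
    the coproduct; uniqueness identifies it with [symf], and substituting the h_i for its variables
    yields the e_k(y). *)
Lemma sf_eval2_schur :
  sf_eval2 (id_tens_omega (Delta (schur int la))) a b = JT (hs a b) (@part_fun la).
Proof.
pose F : symfun B := Delta (schur int la) p.
have [D0 bD0] := symfun_bound (sf_valP F).
pose mx := (\max_(i < size la) part_fun i)%N.
(* D has to bound both the degree of F, for [omegaE], and every subscript la_i + j - i, so that the
   swap polynomials have enough variables. *)
pose D := (D0 + mx + size la)%N.
have bD N : (msize (F N) <= D)%N by apply: leq_trans (bD0 N) _; rewrite /D -addnA leq_addr.
pose TT k : {mpoly B[D]} := \sum_(i < k.+1) (hpoly int i p)%:MP * swap_poly B D (k - i).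
pose l := size la.
pose T := \det (\matrix_(i < l, j < l) if (i <= part_fun i + j)%N then TT (part_fun i + j - i)%N else 0).
have leD (i j : 'I_l) : (part_fun i + j - i <= D)%N.
  have le : (part_fun i <= mx)%N by exact: leq_bigmax.
  by have := ltn_ord j; rewrite /D /l; lia.
(* This is used twice, with (y, u) = (e, h) to recognize F and with (y, u) = (h, e) to compute
   [omega]. *)
have compT M (y u : nat -> {mpoly B[M]}) : u 0%N = 1 ->
    (forall m, (0 < m)%N -> u m = \sum_(i < m) (-1) ^+ i * y i.+1 * u (m - i.+1)%N) ->
    T \mPo [tuple y i.+1 | i < D] =
    \det (\matrix_(i < l, j < l) if (i <= part_fun i + j)%N then
      \sum_(k < (part_fun i + j - i).+1) (hpoly int k p)%:MP * u (part_fun i + j - i - k)%N else 0).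
  move=> u0 Hu; rewrite /T det_rmorph; congr (\det _); apply/matrixP => i j; rewrite !mxE.
  case: ifP => _; last by rewrite rmorph0.
  rewrite rmorph_sum; apply: eq_bigr => k _; rewrite rmorphM /= comp_mpolyC (comp_swap_poly u0) //.
  by apply: leq_trans (leD i j); rewrite leq_subr.
have hp0 M : hpoly B 0 M = 1.
  by apply/mpolyP => m; rewrite mcoeff_hpoly mcoeff1 mdeg_eq0.
have FE : F D = T \mPo [tuple mesym D B i.+1 | i < D].
  rewrite (compT D (mesym D B) (fun k => hpoly B k D)) //; last first.
    by move=> m m0; have [] := mesym_hpoly_rec D tfB m0.
  rewrite [LHS](det_rmorph (xy D)); congr (\det _); apply/matrixP => i j; rewrite !mxE.
  by case: ifP => _; rewrite ?rmorph0 ?xy_hpoly.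
have symfF : symf (F D) = T.
  by apply: msym_fundamental_un; rewrite -symfP //; apply: symfun_sym (sf_valP F) _.
rewrite /sf_eval2 /sf_eval /id_tens_omega -/p -/F; set bC := map _ b.
rewrite (omegaE _ bD) symfF (compT _ (fun k => hpoly B k _) (fun k => mesym _ B k)) ?mesym0E //; last first.
  by move=> m m0; have [] := mesym_hpoly_rec (size bC) tfB m0.
pose psi : {rmorphism {mpoly B[size bC]} -> int} :=
  (meval (fun i : 'I_p => nth 0 a i)) \o (meval (fun i : 'I_(size bC) => nth 0 bC i)).
rewrite -[LHS]/(psi _) det_rmorph; congr (\det _); apply/matrixP => i j; rewrite !mxE /subz.
case: ifP => _; last by rewrite rmorph0.
rewrite hs_conv /conv rmorph_sum; apply: eq_bigr => k _; rewrite rmorphM; congr (_ * _).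
  rewrite /= mevalC (phi_hpoly (meval (fun i : 'I_p => nth 0 a i)) k torsion_free_int).
  congr hs; rewrite -[RHS](map_nth_enum 0); apply: eq_map => i' /=.
  by rewrite mevalXU.
rewrite phi_mesym; congr hs; rewrite -[RHS](map_nth_enum 0).
rewrite (eq_map (g := fun i' : 'I_(size bC) => nth 0 b i')); last first.
  by move=> i' /=; rewrite mevalXU (nth_map 0) ?mevalC // -[X in (_ < X)%N](size_map (@mpolyC p int)).
by rewrite /bC size_map.
Qed.
End SchurEval2.

(** * Young symmetrizers and Specht modules *)

Section Boxes.
Variables (la : seq nat) (n : nat).
Hypothesis la_n : is_part_of n la.

Let row (k : nat) := reshape_index la k.
Let col (k : nat) := reshape_offset la k.

Let sumla : sumn la = n.
Proof. by case/andP: la_n => _ /eqP. Qed.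

Lemma part_noninc i j : (i <= j)%N -> (nth 0 la j <= nth 0 la i)%N.
Proof.
move=> ij; case/andP: la_n => /andP[srt _] _.
case: (ltnP j (size la)) => jl; last by rewrite nth_default.
by apply: (sorted_leq_nth (leT := geq) _ _ _ srt); rewrite ?inE //; [move=> x y z /= yx zy; exact: leq_trans zy yx|exact: leqnn|exact: leq_ltn_trans jl].
Qed.

Let col_lt (k : 'I_n) : (col k < nth 0 la (row k))%N.
Proof. by apply: reshape_offsetP; rewrite sumla. Qed.

Let box_inj (k k' : 'I_n) : row k = row k' -> col k = col k' -> k = k'.
Proof.
move=> er ec; apply: val_inj; rewrite /= -(reshape_indexK la k) -(reshape_indexK la k').
by rewrite -/(row k) -/(col k) er ec.
Qed.

Let box_ex r c : (c < nth 0 la r)%N -> exists k : 'I_n, row k = r /\ col k = c.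
Proof.
move=> cr; have := flatten_indexP cr; rewrite sumla => lt.
by exists (Ordinal lt); rewrite /row /col /= flatten_indexKl // flatten_indexKr.
Qed.

Lemma card_row r : #|[set k : 'I_n | row k == r]| = nth 0 la r.
Proof.
rewrite -[RHS]card_ord.
have lt (c : 'I_(nth 0 la r)) : (flatten_index la r c < n)%N.
  by rewrite -sumla flatten_indexP.
rewrite -(card_imset (f := fun c => Ordinal (lt c))).
  apply: eq_card => k; rewrite inE; apply/eqP/imsetP => [rk|[c _ ->]]; last first.
    by rewrite /row /= flatten_indexKl.
  have ck : (col k < nth 0 la r)%N by rewrite -rk col_lt.
  exists (Ordinal ck) => //; apply: box_inj.
    by rewrite /row /= flatten_indexKl.
  by rewrite /col /= flatten_indexKr.
move=> c c' /(congr1 (fun k : 'I_n => col k)); rewrite /col /= !flatten_indexKr //.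
exact: val_inj.
Qed.

(** A filling of the boxes by numbers without repetition in a column. *)
Definition col_inj (f : 'I_n -> nat) : Prop :=
  forall k k' : 'I_n, col k = col k' -> f k = f k' -> k = k'.

Let cut (f : 'I_n -> nat) r : nat := #|[set k : 'I_n | f k < r]%N|.

Let colcut (f : 'I_n -> nat) j r : nat := #|[set k : 'I_n | (col k == j) && (f k < r)]%N|.

Let cut_col f r : cut f r = (\sum_(j < n) colcut f j r)%N.
Proof.
rewrite /cut -sum1_card; rewrite (eq_bigl (fun k => f k < r)%N); last by move=> k; rewrite inE.
have ck (k : 'I_n) : (col k < n)%N.
  by rewrite /col /reshape_offset; apply: leq_ltn_trans (leq_subr _ _) (ltn_ord k).
rewrite (partition_big (fun k => Ordinal (ck k)) xpredT) //=.
apply: eq_bigr => j _; rewrite /colcut -sum1_card; apply: eq_bigl => k.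
by rewrite inE andbC -val_eqE.
Qed.

Let colcut_le (f : 'I_n -> nat) (j r : nat) : col_inj f ->
  (colcut f j r <= colcut (fun k => row k) j r)%N.
Proof.
move=> fi; rewrite /colcut.
set A := [set k | _]; set B := [set k | _].
have [/existsP[k0 /andP[/eqP ck0 rk0]]|nex] := boolP [exists k : 'I_n, (col k == j) && (r <= row k)%N].
  apply: (@leq_trans r).
    rewrite cardE -(size_map f) -[r in (_ <= r)%N](size_iota 0); apply: uniq_leq_size.
      rewrite map_inj_in_uniq ?enum_uniq // => k k'.
      rewrite !mem_enum !inE => /andP[/eqP ck _] /andP[/eqP ck' _].
      by apply: fi; rewrite ck ck'.
    move=> x /mapP[k + ->]; rewrite mem_enum inE => /andP[_ lt].
    by rewrite mem_iota.
  rewrite cardE -(size_map (fun k : 'I_n => row k)) -[r in (r <= _)%N](size_iota 0).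
  apply: uniq_leq_size; first exact: iota_uniq.
  move=> r'; rewrite mem_iota /= add0n => rr.
  have [k [rk ck]] : exists k : 'I_n, row k = r' /\ col k = j.
    apply: box_ex; rewrite -ck0; apply: leq_trans (col_lt k0) _; apply: part_noninc; lia.
  by apply/mapP; exists k => //; rewrite mem_enum inE ck rk eqxx.
apply: subset_leq_card; apply/subsetP => k; rewrite !inE => /andP[ck _]; rewrite ck /=.
rewrite ltnNge; apply: contra nex => rk; apply/existsP; exists k; by rewrite ck.
Qed.

(** A column has at most r distinct entries below r, and at most as many as it has boxes; the
    filling by row numbers attains both bounds. Hence the content of a column-injective filling is
    dominated by la. *)
Lemma col_inj_cut f r : col_inj f -> (cut f r <= cut (fun k => row k) r)%N.
Proof. by move=> fi; rewrite !cut_col leq_sum // => j _; apply: colcut_le. Qed.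

(** Equality in the dominance order forces equality in each column, so the entries of a column are
    exactly its row numbers, in some order q. *)
Lemma col_inj_row (f : 'I_n -> nat) : col_inj f ->
  (forall r, cut (fun k => row k) r <= cut f r)%N ->
  exists2 q : 'S_n, q \in col_stab la n & forall k, f k = row (q k).
Proof.
move=> fi fcut.
have eqc j r : colcut f j r = colcut (fun k => row k) j r.
  case: (ltnP j n) => jn; last first.
    apply: eq_card => k; rewrite !inE ltn_eqF //; apply: leq_trans jn.
    by rewrite /col /reshape_offset; apply: leq_ltn_trans (leq_subr _ _) (ltn_ord k).
  have e : (\sum_(j < n) colcut f j r == \sum_(j < n) colcut (fun k => row k) j r)%N.
    by rewrite -!cut_col eqn_leq fcut col_inj_cut.
  have := leqif_sum (fun (j : 'I_n) (_ : true) => leqif_eq (colcut_le j r fi)).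
  by case=> _; rewrite e => /esym/fintype.forallP/(_ (Ordinal jn))/eqP.
have ex k : exists k' : 'I_n, (row k' == f k) && (col k' == col k).
  have [/existsP //|nex] := boolP [exists k' : 'I_n, (row k' == f k) && (col k' == col k)].
  (* If the value f k were not a row number of the column of k, passing from f k to f k + 1 would
     leave the count of rows unchanged but increase the count of entries. *)
  exfalso; have := eqc (col k) (f k).+1; rewrite /colcut.
  have -> : [set k' : 'I_n | (col k' == col k) && (row k' < (f k).+1)%N] =
    [set k' : 'I_n | (col k' == col k) && (row k' < f k)%N].
    apply/setP => k'; rewrite !inE ltnS leq_eqVlt; case: eqP => // ck /=.
    have [e|//] := eqVneq (row k') (f k); case/negP: nex; apply/existsP; exists k'.
    by rewrite e ck !eqxx.
  rewrite -[RHS]/(colcut (fun k => row k) (col k) (f k)) -eqc => e.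
  have : (#|[set k' : 'I_n | (col k' == col k) && (f k' < f k)%N]| < #|[set k' : 'I_n | (col k' == col k) && (f k' < (f k).+1)%N]|)%N.
    apply: proper_card; apply/properP; split.
      by apply/subsetP => k'; rewrite !inE => /andP[-> /= lt]; apply: ltnW.
    by exists k; rewrite !inE eqxx ?ltnn //=.
  by rewrite e ltnn.
pose q k := xchoose (ex k).
have qP k : row (q k) = f k /\ col (q k) = col k.
  by have /andP[/eqP ? /eqP ?] := xchooseP (ex k).
have q_inj : injective q.
  move=> k k' e; apply: fi; first by rewrite -(qP k).2 -(qP k').2 e.
  by rewrite -(qP k).1 -(qP k').1 e.
exists (perm q_inj) => [|k]; last by rewrite permE (qP k).1.
rewrite inE; apply/fintype.forallP => k; rewrite permE; apply/eqP; exact: (qP k).2.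
Qed.

Lemma row_col_stab (g : 'S_n) : g \in row_stab la n -> g \in col_stab la n -> g = 1%g.
Proof.
rewrite !inE => /fintype.forallP gr /fintype.forallP gc; apply/permP => k; rewrite perm1.
by apply: box_inj; apply/eqP.
Qed.

Lemma cut_row r : cut (fun k => row k) r = (\sum_(i < r) nth 0 la i)%N.
Proof.
rewrite /cut -sum1_card (eq_bigl (fun k : 'I_n => row k < r)%N); last by move=> k; rewrite inE.
elim: r => [|r IHr]; first by rewrite big_ord0 big_pred0.
rewrite big_ord_recr /= -IHr -card_row (bigID (fun k : 'I_n => row k < r)%N) /=; congr (_ + _)%N.
  by apply: eq_bigl => k; lia.
by rewrite -sum1_card; apply: eq_bigl => k; rewrite inE; lia.
Qed.

End Boxes.

(** For a full-rank factorization M = c r, the equation M^2 = k M forces r c = k. *)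
Lemma mxtrace_quasi_idem (F : fieldType) m (M : 'M[F]_m) k :
  M *m M = k *: M -> \tr M = k * (\rank M)%:R.
Proof.
move=> MM; have := mulmx_base M; have := row_base_free M; have := col_base_full M.
move: (col_base M) (row_base M) => c r cfull rfree cr.
rewrite -{1}cr mxtrace_mulC; suff -> : r *m c = k%:M by rewrite mxtrace_scalar mulr_natr.
have e : c *m (r *m c *m r) = c *m (k%:M *m r).
  transitivity (M *m M); first by rewrite -[X in _ = X *m _]cr -[X in _ = _ *m X]cr !mulmxA.
  by rewrite MM mul_scalar_mx -scalemxAr cr.
exact: row_free_inj rfree _ _ (row_full_inj cfull e).
Qed.

Section YoungSymmetrizer.
Variables (F : numFieldType) (la : seq nat) (n : nat).
Hypothesis la_n : is_part_of n la.
Let G := [set: 'S_n].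
Let Rw := row_stab la n.
Let Cl := col_stab la n.
Notation row k := (reshape_index la k).
Notation col k := (reshape_offset la k).

Lemma row_stabP (g : 'S_n) :
  reflect (forall k, row (g k) = row k) (g \in Rw).
Proof.
rewrite inE; apply: (iffP fintype.forallP) => H k; [exact/eqP|exact/eqP].
Qed.

Lemma col_stabP (g : 'S_n) :
  reflect (forall k, col (g k) = col k) (g \in Cl).
Proof.
rewrite inE; apply: (iffP fintype.forallP) => H k; [exact/eqP|exact/eqP].
Qed.

Lemma row_stab_group : group_set Rw.
Proof.
apply/group_setP; split; first by apply/row_stabP => k; rewrite perm1.
move=> g h /row_stabP gr /row_stabP hr; apply/row_stabP => k; by rewrite permM hr gr.
Qed.

Lemma col_stab_group : group_set Cl.
Proof.
apply/group_setP; split; first by apply/col_stabP => k; rewrite perm1.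
move=> g h /col_stabP gr /col_stabP hr; apply/col_stabP => k; by rewrite permM hr gr.
Qed.

Let RG := Group row_stab_group.
Let CG := Group col_stab_group.

Section Rep.
Variables (m : nat) (rG : mx_representation F G m).

Definition row_sum : 'M[F]_m := \sum_(p in Rw) rG p.
Definition col_sum : 'M[F]_m := \sum_(q in Cl) (-1) ^+ q *: rG q.
Definition ysym : 'M[F]_m := row_sum *m col_sum.

Lemma repr_permM x y : rG (x * y)%g = rG x *m rG y.
Proof. by rewrite repr_mxM ?inE. Qed.

Lemma ysymE : ysym = \sum_(p in Rw) \sum_(q in Cl) (-1) ^+ q *: rG (p * q)%g.
Proof.
rewrite /ysym mulmx_suml; apply: eq_bigr => p _; rewrite mulmx_sumr; apply: eq_bigr => q _.
by rewrite repr_permM scalemxAr.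
Qed.

Lemma row_sumM p : p \in Rw -> row_sum *m rG p = row_sum.
Proof.
move=> pR; rewrite /row_sum mulmx_suml [RHS](reindex_inj (mulIg p)) /=.
by apply: eq_big => [g|g _]; rewrite ?repr_permM // (groupMr _ (pR : p \in RG)).
Qed.

Lemma col_sumM q : q \in Cl -> rG q *m col_sum = (-1) ^+ q *: col_sum.
Proof.
move=> qC; rewrite /col_sum mulmx_sumr [in RHS](reindex_inj (mulgI q)) scaler_sumr /=.
apply: eq_big => [g|g _]; first by rewrite (groupMl _ (qC : q \in CG)).
by rewrite repr_permM scalerA odd_permM signr_addb mulrA -signr_addb addbb mul1r scalemxAr.
Qed.

(* If two boxes of a row are sent by h to a column, a transposition of these
   boxes changes the sign of the left-hand side; otherwise h is in Rw * Cl. *)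
Lemma row_h_col h : exists s : F, row_sum *m rG h *m col_sum = s *: ysym.
Proof.
have [/existsP[x /existsP[y /and3P[ne /eqP er /eqP ec]]]|nex] := boolP
   [exists x : 'I_n, exists y : 'I_n, [&& x != y, row x == row y & col (h x) == col (h y)]].
  exists 0; rewrite scale0r; set X := _ *m _.
  have tR : tperm x y \in Rw.
    by apply/row_stabP => k; case: tpermP => [->|->|].
  have tC : (tperm x y ^ h)%g \in Cl.
    by rewrite tpermJ; apply/col_stabP => k; case: tpermP => [->|->|].
  have : X = - X.
    rewrite {1}/X -(row_sumM tR) -[_ *m _ *m rG h]mulmxA -repr_permM.
    have -> : (tperm x y * h = h * tperm x y ^ h)%g by rewrite conjgE mulKVg.
    rewrite repr_permM mulmxA -[_ *m _ *m col_sum]mulmxA col_sumM // tpermJ odd_tperm.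
    by rewrite (inj_eq (@perm_inj _ h)) ne expr1 scaleN1r mulmxN.
  move=> e; have : X *+ 2 = 0 by rewrite mulr2n {2}e subrr.
  by move/eqP; rewrite -scaler_nat scaler_eq0 pnatr_eq0 => /eqP.
have fi : col_inj la (fun k : 'I_n => row (h^-1 k)%g).
  move=> k k' ck rk; apply: (@perm_inj _ h^-1%g); apply/eqP/negPn/negP => ne.
  case/negP: nex; apply/existsP; exists (h^-1 k)%g; apply/existsP; exists (h^-1 k')%g.
  by rewrite ne rk !permKV ck !eqxx.
have [q qC qE] : exists2 q : 'S_n, q \in Cl & forall k, row (h^-1 k)%g = row (q k).
  apply: (col_inj_row la_n fi) => r; rewrite eq_leq //.
  rewrite -(card_imset _ (@perm_inj _ h)); apply: eq_card => k; rewrite inE.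
  apply/imsetP/idP => [[k' + ->]|rk]; first by rewrite inE permK.
  by exists (h^-1 k)%g; rewrite ?permKV // inE.
have hqR : (h * q)%g \in Rw.
  by apply/row_stabP => k; rewrite permM -qE permK.
have qC' : q^-1%g \in Cl by exact: (groupVr (qC : q \in CG)).
exists ((-1) ^+ q); rewrite -[h](mulgK q) repr_permM mulmxA (row_sumM hqR).
by rewrite -mulmxA (col_sumM qC') -scalemxAr odd_permV.
Qed.

Lemma ysym_h_ysym h : exists s : F, ysym *m rG h *m ysym = s *: ysym.
Proof.
have [s Hs] : exists s : 'S_n -> F, forall g, row_sum *m rG g *m col_sum = s g *: ysym.
  have ex g : exists s : F, row_sum *m rG g *m col_sum == s *: ysym.
    by have [s ->] := row_h_col g; exists s.
  by exists (fun g => xchoose (ex g)) => g; apply/eqP; apply: (xchooseP (ex g)).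
exists (\sum_(q in Cl) \sum_(p in Rw) (-1) ^+ q * s (q * h * p)%g).
rewrite /ysym !mulmxA.
have expR X Y : X *m row_sum *m Y = \sum_(p in Rw) X *m rG p *m Y.
  by rewrite /row_sum mulmx_sumr mulmx_suml.
have expC X Y : X *m col_sum *m Y = \sum_(q in Cl) (-1) ^+ q *: (X *m rG q *m Y).
  rewrite /col_sum mulmx_sumr mulmx_suml; apply: eq_bigr => q _.
  by rewrite -scalemxAr -scalemxAl.
have -> : row_sum *m col_sum *m rG h *m row_sum *m col_sum =
   \sum_(q in Cl) \sum_(p in Rw) (-1) ^+ q *: (row_sum *m rG (q * h * p)%g *m col_sum).
  rewrite expC !mulmx_suml; apply: eq_bigr => q _; rewrite -!scalemxAl expR scaler_sumr.
  by apply: eq_bigr => p _; rewrite !repr_permM !mulmxA.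
rewrite scaler_suml; apply: eq_bigr => q _; rewrite scaler_suml; apply: eq_bigr => p _.
by rewrite Hs scalerA.
Qed.
End Rep.

Let aG := regular_repr F G.
Let N : F := #|G|%:R.
Let C := ysym aG.

Let N_neq0 : N != 0.
Proof. by rewrite pnatr_eq0 -lt0n cardG_gt0. Qed.

Lemma tr_regular (g : 'S_n) : \tr (aG g) = N * (g == 1%g)%:R.
Proof.
rewrite /mxtrace; have [->|g1] := eqVneq g 1%g.
  rewrite repr_mx1 mulr1 /N (eq_bigr (fun=> 1)) ?sumr_const ?card_ord // => i _.
  by rewrite mxE eqxx.
rewrite mulr0 big1 // => i _; rewrite mxE mxE eqxx /=.
case: eqP => // e; case/eqP: g1.
have := congr1 (fun j => enum_val j) e; rewrite gring_indexK ?inE //.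
by move/(congr1 (mulg (enum_val i)^-1)); rewrite mulKg mulVg.
Qed.

Definition ycoef (u : 'S_n) : F :=
  \sum_(p in Rw) \sum_(q in Cl) (-1) ^+ q * (u == p * q)%g%:R.

Lemma ysum_ycoef (f : 'S_n -> F) :
  \sum_(p in Rw) \sum_(q in Cl) (-1) ^+ q * f (p * q)%g = \sum_u ycoef u * f u.
Proof.
under [RHS]eq_bigr do rewrite mulr_suml; rewrite [RHS]exchange_big /=; apply: eq_bigr => p _.
under [RHS]eq_bigr do rewrite mulr_suml; rewrite [RHS]exchange_big /=; apply: eq_bigr => q _.
rewrite (bigD1 (p * q)%g) //= eqxx mulr1 big1 ?addr0 // => u /negbTE ->.
by rewrite mulr0 mul0r.
Qed.

Lemma tr_ysym m (rG : mx_representation F G m) :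
  \tr (ysym rG) = \sum_u ycoef u * \tr (rG u).
Proof.
rewrite -ysum_ycoef ysymE raddf_sum; apply: eq_bigr => p _; rewrite raddf_sum.
by apply: eq_bigr => q _; rewrite /= mxtraceZ.
Qed.

Lemma ysym_ycoef m (rG : mx_representation F G m) : ysym rG = \sum_u ycoef u *: rG u.
Proof.
apply/matrixP => i j; rewrite ysymE !summxE.
under [RHS]eq_bigr do rewrite mxE; rewrite -(ysum_ycoef (fun u => rG u i j)).
apply: eq_bigr => p _; rewrite summxE; apply: eq_bigr => q _; by rewrite mxE.
Qed.

Lemma ycoef1 : ycoef 1 = 1.
Proof.
have R1 : 1%g \in Rw := group1 RG; have C1 : 1%g \in Cl := group1 CG.
rewrite /ycoef (bigD1 1%g) //= (bigD1 1%g) //= mulg1 eqxx odd_perm1 mulr1.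
rewrite big1 ?addr0 => [|q /andP[_ q1]]; last by rewrite mul1g eq_sym (negbTE q1) mulr0.
rewrite big1 ?addr0 // => p /andP[pR p1]; rewrite big1 // => q qC.
case: eqP => [e|_]; last by rewrite mulr0.
case/eqP: p1; apply: (row_col_stab pR); rewrite -/Cl.
have -> : p = q^-1%g by apply: (mulIg q); rewrite -e mulVg.
exact: (groupVr (qC : q \in CG)).
Qed.

Lemma tr_ysym_aG h : \tr (C *m aG h) = N * ycoef h^-1.
Proof.
rewrite /C ysym_ycoef mulmx_suml raddf_sum (bigD1 h^-1%g) //= big1 ?addr0.
  by rewrite -scalemxAl mxtraceZ -repr_permM tr_regular mulVg eqxx mulr1 mulrC.
move=> u uh; rewrite -scalemxAl mxtraceZ -repr_permM tr_regular.
rewrite (_ : (u * h == 1)%g = false) ?mulr0 //; apply: contraNF uh => /eqP e.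
by apply/eqP; apply: (mulIg h); rewrite e mulVg.
Qed.

Let Kex : exists K : 'S_n -> F, forall h, C *m aG h *m C = K h *: C.
Proof.
have ex h : exists s : F, C *m aG h *m C == s *: C.
  by have [s e] := ysym_h_ysym aG h; exists s; rewrite /C e.
by exists (fun g => xchoose (ex g)) => g; apply/eqP; apply: (xchooseP (ex g)).
Qed.

Let tr_C : \tr C = N.
Proof. by rewrite -[C]mulmx1 -(repr_mx1 aG) tr_ysym_aG invg1 ycoef1 mulr1. Qed.

Let C_neq0 : C != 0.
Proof. by apply: contraTneq N_neq0 => C0; rewrite -tr_C C0 mxtrace0 eqxx. Qed.

(* kappa = n! / dim of the Specht module *)
Lemma ysym_sq : exists kappa : F, [/\ kappa != 0, kappa \is Num.real,
  C *m C = kappa *: C &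
  forall h, C *m aG h *m C = (kappa * ycoef h^-1) *: C].
Proof.
have [K KE] := Kex; pose kappa := K 1%g.
have CC : C *m C = kappa *: C by rewrite -KE repr_mx1 mulmx1.
have trk : N = kappa * (\rank C)%:R by rewrite -tr_C (mxtrace_quasi_idem CC).
have k0 : kappa != 0 by apply: contraNneq N_neq0 => k0; rewrite trk k0 mul0r.
exists kappa; split=> //.
  have r0 : (\rank C)%:R != 0 :> F by rewrite pnatr_eq0 mxrank_eq0 C_neq0.
  by rewrite -(mulfK r0 kappa) -trk rpred_div ?rpred_nat.
move=> h; rewrite KE; congr (_ *: _); apply: (mulIf N_neq0).
have := congr1 mxtrace (KE h); rewrite mxtrace_mulC mulmxA CC -scalemxAl !mxtraceZ.
by rewrite tr_ysym_aG tr_C => <-; rewrite -mulrA [N * _]mulrC.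
Qed.

Definition yclass (u : 'S_n) : F := \sum_(h : 'S_n) ycoef (h * u * h^-1)%g.

Lemma yclassJ u g : yclass (u ^ g)%g = yclass u.
Proof.
rewrite /yclass [RHS](reindex_inj (mulIg g^-1%g)) /=; apply: eq_bigr => h _.
by rewrite conjgE invMg invgK !mulgA.
Qed.

Lemma sum_yclass (f : 'S_n -> F) : (forall u g, f (u ^ g)%g = f u) ->
  \sum_u yclass u * f u = N * \sum_u ycoef u * f u.
Proof.
move=> fJ; under eq_bigr do rewrite mulr_suml.
rewrite exchange_big /= (eq_bigr (fun=> \sum_u ycoef u * f u)) => [|h _].
  by rewrite sumr_const /N mulr_natl; congr (_ *+ _); apply: eq_card => x; rewrite !inE.
rewrite (reindex_inj (conjg_inj h)); apply: eq_bigr => u _ /=.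
by rewrite fJ conjgE !mulgA mulgV mul1g mulgK.
Qed.

(** The inverse q^-1 p^-1 of p q is conjugate to p^-1 q^-1, which carries the same sign. *)
Lemma yclassV u : yclass u^-1%g = yclass u.
Proof.
have E v : yclass v = \sum_(p in Rw) \sum_(q in Cl) \sum_h (-1) ^+ q * (h * v * h^-1 == p * q)%g%:R.
  rewrite /yclass /ycoef exchange_big; apply: eq_bigr => p _; rewrite exchange_big //.
rewrite !E (reindex_inj invg_inj) /=; apply: eq_big => [p|p pR].
  exact: (groupV RG).
rewrite (reindex_inj invg_inj) /=; apply: eq_big => [q|q qC].
  exact: (groupV CG).
rewrite (reindex_inj (mulgI q)) /=; apply: eq_bigr => h _; rewrite odd_permV.
congr (_ * _%:R); congr nat_of_bool.
have -> : (q * h * u^-1 * (q * h)^-1 = q * (h * u * h^-1)^-1 * q^-1)%g.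
  by rewrite !invMg invgK !mulgA.
have -> : (p^-1 * q^-1 = q * (p * q)^-1 * q^-1)%g by rewrite invMg !mulgA mulgV mul1g.
by rewrite (inj_eq (mulIg _)) (inj_eq (mulgI _)) (inj_eq invg_inj).
Qed.

(** Replacing one factor by its value at u^-1 turns the sum into traces of C h C h^-1 in the regular
    representation. Once C h C is evaluated, what remains is the trace of C^3 = kappa^2 C. *)
Lemma yclass_norm kappa :
  C *m C = kappa *: C -> (forall h, C *m aG h *m C = (kappa * ycoef h^-1) *: C) ->
  \sum_u yclass u * yclass u = kappa ^+ 2 * N.
Proof.
move=> CC CK; rewrite sum_yclass; last exact: yclassJ.
rewrite -(eq_bigr _ (fun u _ => congr1 (fun x => ycoef u * x) (yclassV u))) mulr_sumr.
have expC Y Z : Y *m C *m Z = \sum_u ycoef u *: (Y *m aG u *m Z).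
  rewrite /C ysym_ycoef mulmx_sumr mulmx_suml; apply: eq_bigr => u _.
  by rewrite -scalemxAr -scalemxAl.
have trCC h : \sum_u ycoef u * (N * ycoef (h * u^-1 * h^-1)%g) = \tr (C *m aG h *m C *m aG h^-1%g).
  rewrite expC raddf_sum; apply: eq_bigr => u _; rewrite /= mxtraceZ -(mulmxA C) -repr_permM -(mulmxA C) -repr_permM tr_ysym_aG.
  by rewrite !invMg invgK mulgA.
transitivity (\sum_h \sum_u ycoef u * (N * ycoef (h * u^-1 * h^-1)%g)).
  rewrite exchange_big; apply: eq_bigr => u _; rewrite /yclass mulrCA mulr_sumr.
  by rewrite mulr_sumr.
rewrite (eq_bigr (fun h => ycoef h * (kappa * ycoef h^-1%g) * N)) => [|h _]; last first.
  rewrite trCC CK -scalemxAl mxtraceZ tr_ysym_aG invgK; ring.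
rewrite -mulr_suml; congr (_ * _).
apply: (mulIf (N_neq0)); rewrite -tr_C -!mxtraceZ scaler_suml; congr mxtrace.
rewrite (eq_bigr (fun h => ycoef h *: (C *m aG h *m C))) => [|h _]; last by rewrite CK scalerA.
by rewrite -expC CC -scalemxAl CC scalerA.
Qed.
End YoungSymmetrizer.

Section YoungPairing.
Variables (F : numFieldType) (la : seq nat) (n : nat).
Hypothesis la_n : is_part_of n la.
Let l := size la.
Let Rw := row_stab la n.
Let Cl := col_stab la n.
Let RG := Group (row_stab_group la n).
Let CG := Group (col_stab_group la n).
Notation row k := (reshape_index la k).
Notation col k := (reshape_offset la k).
Let yc : 'S_n -> F := ycoef F la (n:=n).

Let S (f : {ffun 'I_n -> 'I_l}) : F :=
  \sum_(p in Rw) \sum_(q in Cl) (-1) ^+ q * (colour_fixed f (p * q)%g)%:R.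

Let pairE al : \sum_u yc u * (young_char al u)%:R = \sum_(f | colour_type al f) S f.
Proof.
rewrite -(ysum_ycoef la (fun u => (young_char al u)%:R)) [RHS]exchange_big /=.
apply: eq_bigr => p _; rewrite [RHS]exchange_big /=; apply: eq_bigr => q _.
rewrite -mulr_sumr; congr (_ * _); rewrite /young_char -sum1_card natr_sum.
rewrite big_mkcond [RHS]big_mkcond; apply: eq_bigr => f _; rewrite inE andbC.
by case: (colour_type al f); case: (colour_fixed f _).
Qed.

(** If two boxes of a column have the same colour, multiplying q by their transposition preserves
    the condition and changes the sign. *)
Let S0 (f : {ffun 'I_n -> 'I_l}) : ~ col_inj la (fun k => f k) -> S f = 0.
Proof.
move=> nfi; rewrite /S big1 // => p _.
have [x [y [ne cxy fxy]]] : exists x y : 'I_n, [/\ x != y, col x = col y & f x = f y].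
  have [/existsP[x /existsP[y /and3P[ne /eqP cxy /eqP fxy]]]|nex] := boolP
     [exists x : 'I_n, exists y : 'I_n, [&& x != y, col x == col y & f x == f y]].
    by exists x, y.
  case: nfi => x y cxy fxy; apply/eqP/negPn/negP => ne; case/negP: nex.
  apply/existsP; exists x; apply/existsP; exists y; rewrite ne cxy eqxx /=.
  by apply/eqP/val_inj.
have tC : tperm x y \in Cl.
  by apply/col_stabP => k; case: tpermP => [->|->|].
set T := \sum_(q in Cl) _.
suff e : T = - T.
  by have: T *+ 2 = 0; [rewrite mulr2n {2}e subrr|move/eqP; rewrite -mulr_natr mulf_eq0 pnatr_eq0 orbF => /eqP].
rewrite {1}/T (reindex_inj (mulIg (tperm x y))) /= -sumrN; apply: eq_big => [q|q qC].
  by rewrite (groupMr _ (tC : _ \in CG)).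
rewrite odd_permM odd_tperm ne signr_addb mulrN1 mulNr; congr (- (_ * _%:R)); congr nat_of_bool.
have fT k : f (tperm x y k) = f k by case: tpermP => [->|->|].
by apply: eq_forallb => k; rewrite !permM fT.
Qed.

Lemma cut_type (al : 'I_l -> nat) (f : {ffun 'I_n -> 'I_l}) r : colour_type al f ->
  #|[set k : 'I_n | f k < r]%N| = (\sum_(i < l | (i < r)%N) al i)%N.
Proof.
move=> /fintype.forallP ft; rewrite -sum1_card.
rewrite (eq_bigl (fun k : 'I_n => f k < r)%N); last by move=> k; rewrite inE.
rewrite (partition_big f (fun i : 'I_l => (i < r)%N)) //=; apply: eq_bigr => i ir.
rewrite -(eqP (ft i)) -sum1_card; apply: eq_bigl => k; rewrite inE.
by case: eqP => [->|_]; rewrite ?ir ?andbF.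
Qed.

(** The hypothesis says that al is not dominated by la, so no colouring of type al is injective on
    columns. *)
Lemma young_pairing0 (al : 'I_l -> nat) r :
  (\sum_(i < r) nth 0 la i < \sum_(i < l | (i < r)%N) al i)%N ->
  \sum_u yc u * (young_char al u)%:R = 0.
Proof.
move=> lt; rewrite pairE big1 // => f ft; apply: S0 => fi.
have := col_inj_cut la_n r fi; rewrite (cut_type r ft) (cut_row la_n); lia.
Qed.

(** For type la the surviving colourings are the row numberings moved by a column permutation, one
    for each q in the column stabilizer. Summing over them recovers the coefficient of the identity
    in C^2. *)
Lemma young_pairing_kappa kappa :
  ysym la (regular_repr F [set: 'S_n]) *m ysym la (regular_repr F [set: 'S_n]) =
    kappa *: ysym la (regular_repr F [set: 'S_n]) ->
  \sum_u yc u * (young_char (@part_fun la) u)%:R = kappa.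
Proof.
move=> CC.
(* C has coefficient 1 at the identity, so kappa is the coefficient of C^2 there. *)
have kE : kappa = \sum_(p in Rw) \sum_(q in Cl) \sum_(p' in Rw) \sum_(q' in Cl)
     (-1) ^+ q * ((-1) ^+ q' * ((p * q)^-1 == p' * q')%g%:R).
  have N0 : #|[set: 'S_n]|%:R != 0 :> F by rewrite pnatr_eq0 -lt0n cardG_gt0.
  apply: (mulIf N0).
  have := congr1 mxtrace CC; rewrite mxtraceZ.
  have -> : \tr (ysym la (regular_repr F [set: 'S_n])) = #|[set: 'S_n]|%:R.
    rewrite -[ysym _ _]mulmx1 -(repr_mx1 (regular_repr F [set: 'S_n])) tr_ysym_aG //.
    by rewrite invg1 ycoef1 // mulr1.
  move=> <-; rewrite {2}ysym_ycoef mulmx_sumr raddf_sum mulr_suml.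
  rewrite (eq_bigr (fun u => yc u * yc u^-1%g * #|[set: 'S_n]|%:R)); last first.
    by move=> u _; rewrite -scalemxAr /= mxtraceZ tr_ysym_aG // mulrCA mulrC.
  rewrite -!mulr_suml; congr (_ * _); rewrite -(ysum_ycoef la (fun u => yc u^-1%g)).
  apply: eq_bigr => p _; apply: eq_bigr => q _; rewrite /yc /ycoef mulr_sumr.
  by apply: eq_bigr => p' _; rewrite mulr_sumr.
have lt (k : 'I_n) : (row k < l)%N.
  by apply: reshape_indexP; case/andP: la_n => _ /eqP ->.
pose Fq (q : 'S_n) : {ffun 'I_n -> 'I_l} := [ffun k => Ordinal (lt (q k))].
have Fq_inj : {in Cl &, injective Fq}.
  move=> q q' qC qC' e; apply: (mulgI q^-1%g); rewrite mulVg; apply/esym.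
  apply: (@row_col_stab la n); last exact: (groupM (groupVr (qC : q \in CG)) (qC' : q' \in CG)).
  apply/row_stabP => k; rewrite permM; have /ffunP/(_ (q^-1 k)%g)/(congr1 val) := e.
  by rewrite !ffunE /= permKV.
have Fq_type q : colour_type (@part_fun la) (Fq q).
  apply/fintype.forallP => i; apply/eqP; rewrite /part_fun -(card_row la_n).
  rewrite -[RHS](card_preimset _ (@perm_inj _ q)); apply: eq_card => k.
  by rewrite !inE ffunE -val_eqE.
rewrite pairE (bigID (mem (Fq @: Cl))) /= [X in _ + X]big1 ?addr0; last first.
  move=> f /andP[ft nf]; apply: S0 => fi.
  have [r|q qC qE] := col_inj_row la_n fi.
    rewrite (cut_row la_n) (cut_type _ ft) /part_fun.
    rewrite -(big_mkord xpredT (fun i => nth 0%N la i)).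
    rewrite -(big_mkord (fun i => i < r)%N (fun i => nth 0%N la i)).
    rewrite (@big_nat_widen _ _ _ 0 r (l + r)) ?leq_addl //.
    rewrite (@big_nat_widen _ _ _ 0 l (l + r)) ?leq_addr // big_mkcond [X in (_ <= X)%N]big_mkcond /=.
    by rewrite leq_sum // => i _; case: (ltnP i l) => il; rewrite ?andbT // nth_default // if_same.
  case/negP: nf; apply/imsetP; exists q => //; apply/ffunP => k; apply: val_inj.
  by rewrite ffunE /= qE.
rewrite (eq_bigl (mem (Fq @: Cl))) => [|f]; last first.
  by rewrite /= andb_idl // => /imsetP[q _ ->].
rewrite big_imset //= kE.
(* After replacing q by q q0^-1, the colouring is fixed exactly when q0^-1 p q is a row permutation
   p', that is, q0 p' = p q. *)
have SE q0 : q0 \in Cl -> S (Fq q0) = \sum_(p in Rw) \sum_(q in Cl) \sum_(p' in Rw)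
   (-1) ^+ q0 * ((-1) ^+ q * (q0 * p' == p * q)%g%:R).
  move=> qC0; apply: eq_bigr => p _; rewrite (reindex_inj (mulIg q0^-1%g)) /=.
  apply: eq_big => [q|q qC]; first by rewrite (groupMr _ (groupVr (qC0 : _ \in CG))).
  rewrite odd_permM odd_permV signr_addb -!mulr_sumr mulrA [(-1) ^+ q * _]mulrC; congr (_ * _).
  have -> : colour_fixed (Fq q0) (p * (q * q0^-1))%g = ((q0^-1 * (p * q))%g \in Rw).
    apply/fintype.forallP/row_stabP => H k.
      have /eqP/(congr1 val) := H (q0^-1 k)%g; rewrite !ffunE /= permKV => <-.
      by rewrite !permM permKV.
    have := H (q0 k); rewrite !permM permK => e; apply/eqP/val_inj; rewrite !ffunE /=.
    by rewrite permKV e.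
  have [hR|hR] := boolP (_ \in Rw).
    rewrite (bigD1 (q0^-1 * (p * q))%g) //= mulKVg eqxx big1 ?addr0 // => p' /andP[_ ne].
    by case: eqP => // e; rewrite -e mulKg eqxx in ne.
  rewrite big1 // => p' pR; case: eqP => // e; by rewrite -e mulKg pR in hR.
rewrite (eq_bigr _ SE) exchange_big /=; apply: eq_bigr => p _.
rewrite exchange_big /=; apply: eq_bigr => q _; rewrite exchange_big /=.
rewrite (reindex_inj invg_inj) /=; apply: eq_big => [p'|p' _]; first exact: (groupV RG).
rewrite (reindex_inj invg_inj) /=; apply: eq_big => [q'|q' _]; first exact: (groupV CG).
rewrite odd_permV mulrCA; congr (_ * (_ * _%:R)); congr nat_of_bool.
by rewrite -[RHS](inj_eq invg_inj) invgK invMg eq_sym.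
Qed.
End YoungPairing.

(** * The class function of Jacobi-Trudi type *)

Lemma JT_bialternant_size (R : comNzRingType) (a : seq R) l (la : 'I_l -> nat) :
  size a = l ->
  JT (hs a [::]) la * \det (\matrix_(i < l, r < l) nth 0 a r ^+ (l.-1 - i)) =
  \det (\matrix_(i < l, r < l) nth 0 a r ^+ (la i + (l.-1 - i))).
Proof. by move=> e; case: l / e la => la; apply: JT_bialternant. Qed.

Lemma mcoeffMXm (R : comNzRingType) l (p : {mpoly R[l]}) (m k : 'X_{1..l}) :
  (p * 'X_[m])@_k = if (m <= k)%MM then p@_(k - m) else 0.
Proof.
case: ifPn => mk; first by rewrite -[in LHS](submK mk) addmC mcoeffMX.
rewrite mcoeffM big1 // => -[m1 m2] /= /eqP e; rewrite mcoeffX.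
case: eqP => [e2|]; last by rewrite mulr0.
case/negP: mk; apply/mnm_lepP => i; have -> : k i = (m1 + m2)%MM i by rewrite {1}e.
by rewrite mnmDE e2 leq_addl.
Qed.

Lemma eq_young_char l n (al al' : 'I_l -> nat) (g : 'S_n) :
  al =1 al' -> young_char al g = young_char al' g.
Proof.
move=> e; apply: eq_card => f; rewrite !inE; congr (_ && _).
by apply: eq_forallb => i; rewrite e.
Qed.

Lemma young_charJ l n (al : 'I_l -> nat) (g h : 'S_n) :
  young_char al (g ^ h)%g = young_char al g.
Proof.
have e : al =1 [multinom al i | i < l] by move=> i; rewrite mnmE.
rewrite !(eq_young_char _ e).
have := mcfJ (colsumP (fun i : 'I_l => 'X_i : {mpoly int[l]})) g h.
move/(congr1 (mcoeff [multinom al i | i < l])); rewrite !mcoeff_colsum.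
by move/eqP; rewrite eqr_nat => /eqP.
Qed.

Section JTCharacter.
Variables (la : seq nat) (n : nat).
Hypothesis la_n : is_part_of n la.
Let l := size la.
Let pf : 'I_l -> nat := @part_fun la.

Definition jt_ok (w : 'S_l) : bool := [forall i : 'I_l, i <= pf i + w i]%N.
Definition jt_type (w : 'S_l) (i : 'I_l) : nat := (pf i + w i - i)%N.

(** The Jacobi-Trudi determinant with each product of h's replaced by the permutation character of
    the corresponding Young subgroup; [jt_ok w] excludes negative subscripts. *)
Definition jt_char (R : comNzRingType) (u : 'S_n) : R :=
  \sum_(w : 'S_l) (-1) ^+ w * (if jt_ok w then (young_char (jt_type w) u)%:R else 0).

Lemma jt_charJ R u g : jt_char R (u ^ g)%g = jt_char R u.
Proof. by apply: eq_bigr => w _; rewrite young_charJ. Qed.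

Lemma rmorph_jt_char (R S : comNzRingType) (phi : {rmorphism R -> S}) u :
  phi (jt_char R u) = jt_char S u.
Proof.
rewrite rmorph_sum; apply: eq_bigr => w _; rewrite rmorphM rmorph_sign.
by case: ifP; rewrite ?rmorph_nat ?rmorph0.
Qed.

Let sum_pf : (\sum_i pf i = n)%N.
Proof.
by case/andP: la_n => _ /eqP <-; rewrite sumnE (big_nth 0%N) big_mkord.
Qed.

Lemma mdeg_jt_type w : jt_ok w -> mdeg [multinom jt_type w i | i < l] = n.
Proof.
move=> /fintype.forallP ok.
rewrite mdegE (eq_bigr (fun i : 'I_l => (pf i + w i) - i)%N); last by move=> i _; rewrite mnmE.
rewrite sumnB; last by move=> i _; apply: ok.
rewrite big_split /= sum_pf [X in (_ + X - _)%N](_ : _ = \sum_(i < l) i)%N ?addnK //.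
by rewrite [RHS](reindex_inj (@perm_inj _ w)).
Qed.

Lemma sum_chi_jt (R : comNzRingType) (chi : forall k, 'S_k -> R) (t Q : nat -> R) :
  mult_class_family chi -> newton t Q ->
  (forall k, (0 < k)%N -> chi k (full_cycle k) = t k) ->
  \sum_(g : 'S_n) chi n g * jt_char R g = (n`!)%:R * JT Q pf.
Proof.
move=> chiP tQ chit; rewrite /JT /determinant mulr_sumr.
under eq_bigr do rewrite mulr_sumr; rewrite exchange_big; apply: eq_bigr => w _ /=.
under eq_bigr do rewrite mulrCA; rewrite -mulr_sumr [RHS]mulrCA; congr (_ * _).
rewrite (eq_bigr (fun i : 'I_l => if (i <= pf i + w i)%N then Q (jt_type w i) else 0)); last first.
  by move=> i _; rewrite mxE.
case: (boolP (jt_ok w)) => ok; last first.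
  case/fintype.forallPn: ok => i /negbTE wi; rewrite [X in _ * X](bigD1 i) //= wi mul0r mulr0.
  by rewrite big1 // => g _; rewrite mulr0.
rewrite (eq_bigr (fun i => Q (jt_type w i))); last first.
  by move=> i _; move/fintype.forallP: ok => ->.
pose al := [multinom jt_type w i | i < l].
have e : jt_type w =1 al by move=> i; rewrite mnmE.
rewrite (eq_bigr (fun i => Q (al i))); last by move=> i _; rewrite -e.
rewrite -(sum_chi_young tQ chiP chit).
  by apply: eq_bigr => g _; rewrite (eq_young_char _ e).
exact: mdeg_jt_type.
Qed.

Section Norm.
Variable F : numFieldType.

Let hp k : {mpoly F[l]} := hpoly F k l.

Let tfF : torsion_free F.
Proof. by move=> k x /eqP; rewrite mulf_eq0 pnatr_eq0 => /eqP. Qed.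

Let hpE k : hp k = hs [seq 'X_i | i <- enum 'I_l] [::] k.
Proof. exact: (phi_hpoly idfun k (torsion_free_mpoly tfF)). Qed.

(** Pairing [jt_char] with the power-sum products in l indeterminates gives n! s_la; the coefficient
    of X^al is the pairing with one Young subgroup. *)
Let jt_young al : mdeg al = n ->
  \sum_(g : 'S_n) jt_char F g * (young_char (al : 'X_{1..l}) g)%:R =
  (n`!)%:R * (JT hp pf)@_al.
Proof.
move=> dal; have nt : newton (fun k => \sum_(i < l) ('X_i : {mpoly F[l]}) ^+ k) hp.
  apply: eq_newton (newton_hs [seq 'X_i : {mpoly F[l]} | i <- enum 'I_l] [::]) => [k _|k].
    by rewrite big_nil subr0 big_map big_enum.
  by rewrite hpE.
have H := sum_chi_jt (colsumP (fun i : 'I_l => 'X_i : {mpoly F[l]})) nt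
  (fun k k0 => colsum_cycle _ k0).
rewrite -mcoeffCM mpolyC_nat -H raddf_sum; apply: eq_bigr => g _ /=.
by rewrite -(rmorph_jt_char (@mpolyC l F)) [in RHS]mulrC /= mcoeffCM mcoeff_colsum.
Qed.

Let det_monomials (be : 'I_l -> nat) :
  \det (\matrix_(i < l, r < l) ('X_r : {mpoly F[l]}) ^+ be i) =
  \sum_(s : 'S_l) (-1) ^+ s * 'X_[[multinom be (s r) | r < l]].
Proof.
rewrite /determinant (reindex_inj invg_inj); apply: eq_bigr => s _ /=.
rewrite odd_permV; congr (_ * _); rewrite mpolyXE_id (reindex_inj (@perm_inj _ s)).
by apply: eq_bigr => i _; rewrite mxE permK mnmE.
Qed.

Let bet : 'X_{1..l} := [multinom (pf i + (l.-1 - i))%N | i < l].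

Let pf_noninc (i j : 'I_l) : (i <= j)%N -> (pf j <= pf i)%N.
Proof. exact: part_noninc la_n _ _. Qed.

(** With delta_i = l - 1 - i, the exponent la + delta minus the w-image of delta is [jt_type w]. The
    sum is thus the coefficient of X^(la + delta) in s_la a_delta = a_(la + delta), which is 1
    because la + delta is strictly decreasing. *)
Let key : \sum_(w : 'S_l) (-1) ^+ w * (if jt_ok w then (JT hp pf)@_[multinom jt_type w i | i < l] else 0) = 1.
Proof.
have szX : size [seq 'X_i : {mpoly F[l]} | i <- enum 'I_l] = l by rewrite size_map size_enum_ord.
have nX (r : 'I_l) : nth 0 [seq 'X_i : {mpoly F[l]} | i <- enum 'I_l] r = 'X_r.
  by rewrite (nth_map r) ?size_enum_ord // nth_ord_enum.
have := JT_bialternant_size pf szX; rewrite -(eq_JT hpE (frefl _)).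
have E (be : 'I_l -> nat) : \matrix_(i < l, r < l) nth 0 [seq 'X_i : {mpoly F[l]} | i <- enum 'I_l] r ^+ be i
    = \matrix_(i < l, r < l) 'X_r ^+ be i.
  by apply/matrixP => i r; rewrite !mxE nX.
rewrite !E !det_monomials => /(congr1 (mcoeff bet)).
rewrite mulr_sumr !raddf_sum /=.
rewrite [X in _ = X](bigD1 1%g) //= odd_perm1 mul1r.
have -> : [multinom (pf ((1%g : 'S_l) r) + (l.-1 - (1%g : 'S_l) r))%N | r < l] = bet.
  by apply/mnmP => i; rewrite !mnmE perm1.
have sgnE (s : bool) (p : {mpoly F[l]}) m : ((-1) ^+ s * p)@_m = (-1) ^+ s * p@_m.
  by case: s; rewrite ?expr1 ?expr0 ?mulN1r ?mul1r ?mcoeffN.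
rewrite mcoeffX eqxx [X in _ + X]big1 ?addr0 => [E1|s s1]; last first.
  rewrite sgnE mcoeffX; case: eqP => [/mnmP e|_]; last by rewrite mulr0.
  case/eqP: s1; apply/permP => i; rewrite perm1; apply: val_inj.
  have := e i; rewrite !mnmE => ei.
  case: (ltngtP (s i) i) => [lt|lt|//]; have := pf_noninc (ltnW lt);
  by have := ltn_ord i; have := ltn_ord (s i); lia.
rewrite -[RHS]/(true%:R) -E1; apply: eq_bigr => w _; rewrite mulrCA sgnE mcoeffMXm; congr (_ * _).
have lw (r : 'I_l) : (w r < l)%N by [].
have ltl (r : 'I_l) : (r < l)%N by [].
have -> : ([multinom (l.-1 - w r)%N | r < l] <= bet)%MM = jt_ok w.
  apply/mnm_lepP/fintype.forallP => H r.
    by have := H r; rewrite !mnmE; have := lw r; have := ltl r; lia.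
  by rewrite !mnmE; have := H r; have := lw r; have := ltl r; lia.
case: ifP => // ok; congr mcoeff; apply/mnmP => r; rewrite mnmBE !mnmE /jt_type.
by have := lw r; have := ltl r; lia.
Qed.

Lemma jt_char_norm : \sum_(u : 'S_n) jt_char F u * jt_char F u = (n`!)%:R.
Proof.
transitivity ((n`!)%:R * 1 : F); last by rewrite mulr1.
rewrite -[X in _ = _ * X]key mulr_sumr.
under eq_bigr => u _ do rewrite {2}/jt_char mulr_sumr.
rewrite exchange_big; apply: eq_bigr => w _ /=.
under eq_bigr do rewrite mulrCA; rewrite -mulr_sumr [RHS]mulrCA; congr (_ * _).
case: ifP => ok; last by rewrite mulr0 big1 // => u _; rewrite mulr0.
have e : jt_type w =1 [multinom jt_type w i | i < l] by move=> i; rewrite mnmE.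
rewrite -jt_young; first by apply: eq_bigr => u _; rewrite (eq_young_char _ e).
exact: mdeg_jt_type.
Qed.

Let aG := regular_repr F [set: 'S_n].

(** Only w = 1 contributes. Otherwise the first index i moved by w satisfies w i > i, so the parts
    of [jt_type w] up to i add up to more than those of la and dominance fails. *)
Lemma ycoef_jt kappa : ysym la aG *m ysym la aG = kappa *: ysym la aG ->
  \sum_u ycoef F la u * jt_char F u = kappa.
Proof.
move=> CC; under eq_bigr do rewrite mulr_sumr; rewrite exchange_big /= (bigD1 1%g) //=.
have ok1 : jt_ok 1%g by apply/fintype.forallP => i; rewrite perm1 leq_addl.
rewrite [X in _ + X]big1 ?addr0 => [|w w1].
  under eq_bigr do rewrite odd_perm1 mul1r ok1.
  rewrite -[RHS](young_pairing_kappa la_n CC); apply: eq_bigr => u _.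
  by congr (_ * _%:R); apply: eq_young_char => i; rewrite /jt_type perm1 addnK.
case: (boolP (jt_ok w)) => [/fintype.forallP ok|_]; last by rewrite big1 // => u _; rewrite !mulr0.
under eq_bigr do rewrite mulrCA; rewrite -mulr_sumr.
have [i wi least] : exists2 i : 'I_l, w i != i & forall j : 'I_l, (j < i)%N -> w j = j.
  have [i wi] : exists i, w i != i.
    apply/existsP; apply: contraNT w1 => /existsPn H; apply/eqP/permP => i.
    by rewrite perm1; have := H i; rewrite negbK => /eqP.
  exists [arg min_(j < i | w j != j) (j : nat)]; first by case: arg_minnP.
  case: arg_minnP => // k _ kmin j jk; apply/eqP/negPn/negP => /kmin; by rewrite leqNgt jk.
rewrite (@young_pairing0 _ _ _ la_n _ i.+1) ?mulr0 //.
have iw : (i < w i)%N.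
  rewrite ltn_neqAle eq_sym val_eqE wi leqNgt; apply/negP => lt.
  by have := least _ lt => /perm_inj e; rewrite e ltnn in lt.
pose D j := (pf j + w j - j)%N.
have -> : (\sum_(j < l | (j < i.+1)%N) jt_type w j = \sum_(j < l | (j < i)%N) pf j + (pf i + w i - i))%N.
  rewrite (bigD1 i) //= addnC; congr (_ + _)%N; apply: eq_big => [j|j]; first by rewrite -val_eqE /=; lia.
  by rewrite -val_eqE /= => ji; rewrite /jt_type least ?addnK //; lia.
rewrite (big_ord_widen_cond l xpredT) //= (bigD1 i) //= addnC.
rewrite (eq_bigl (fun j : 'I_l => (j < i)%N)) ?ltn_add2l; last by move=> j; rewrite -val_eqE /=; lia.
by rewrite /pf /part_fun -addnBA ?(ltnW iw) // -[X in (X < _)%N]addn0 ltn_add2l subn_gt0.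
Qed.

(* ycoef, averaged over conjugation, equals kappa times the character of
   Jacobi-Trudi type: both have the right norms and inner product. *)
Lemma yclass_jt kappa : kappa \is Num.real ->
  ysym la aG *m ysym la aG = kappa *: ysym la aG ->
  (forall h, ysym la aG *m aG h *m ysym la aG = (kappa * ycoef F la h^-1) *: ysym la aG) ->
  forall u, yclass F la u = kappa * jt_char F u.
Proof.
move=> kr CC CK.
have Nn : #|[set: 'S_n]|%:R = (n`!)%:R :> F by rewrite cardsT card_Sn.
have realS (f : 'S_n -> F) : (forall u, f u \is Num.real) ->
    \sum_u f u * f u = 0 -> forall u, f u = 0.
  move=> fr /eqP; rewrite psumr_eq0 => [/allP H u|u _].
    by have := H u (mem_index_enum _); rewrite mulf_eq0 orbb => /eqP.
  by rewrite -expr2 real_exprn_even_ge0.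
have jr u : jt_char F u \is Num.real.
  rewrite rpred_sum // => w _; rewrite rpredM ?rpredX ?rpredN ?rpred1 //.
  by case: ifP; rewrite ?rpred_nat ?rpred0.
have yr u : yclass F la u \is Num.real.
  rewrite rpred_sum // => h _; rewrite rpred_sum // => p _; rewrite rpred_sum // => q _.
  by rewrite rpredM ?rpredX ?rpredN ?rpred1 ?rpred_nat.
move=> u; apply/eqP; rewrite -subr_eq0; apply/eqP; move: u; apply: realS.
  by move=> u; rewrite rpredB ?rpredM.
have := yclass_norm CC CK; have := jt_char_norm.
have : \sum_u yclass F la u * jt_char F u = (n`!)%:R * kappa.
  by rewrite (@sum_yclass F la n (jt_char F) (fun u g => jt_charJ F u g)) Nn (ycoef_jt CC).
rewrite Nn => yj jj yy.
rewrite (eq_bigr (fun u => yclass F la u * yclass F la u - kappa * (yclass F la u * jt_char F u) *+ 2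
   + kappa ^+ 2 * (jt_char F u * jt_char F u))); last by move=> u _; ring.
rewrite big_split sumrB /= sumrMnl -!mulr_sumr yy yj jj; ring.
Qed.
End Norm.
End JTCharacter.

(** * Specht modules and traces of the Young symmetrizer *)

Section SpechtMultiplicity.
Variables (F : numClosedFieldType) (la : seq nat) (n : nat).
Hypothesis la_n : is_part_of n la.
Let G := [set: 'S_n].
Let aG := regular_repr F G.
Let C := ysym la aG.
Let e1 : 'rV[F]_#|G| := delta_mx 0 (gring_index G 1).
Let v0 := young_symmetrizer F la n.
Let V := cyclic_mx aG v0.

Let charG : ([pchar F]^'.-group G)%g.
Proof. by rewrite /pgroup pcharf'_nat pnatr_eq0 -lt0n cardG_gt0. Qed.

Let e1G (g : 'S_n) : e1 *m aG g = delta_mx 0 (gring_index G g).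
Proof. by rewrite /e1 -rowE rowK gring_indexK ?inE // mul1g. Qed.

Let e1C : e1 *m C = v0.
Proof.
rewrite /C ysymE mulmx_sumr; apply: eq_bigr => p _; rewrite mulmx_sumr.
by apply: eq_bigr => q _; rewrite -scalemxAr e1G.
Qed.

Let CE : (C \in enveloping_algebra_mx aG)%MS.
Proof.
rewrite /C ysym_ycoef; rewrite linear_sum summx_sub //= => g _.
by rewrite linearZ scalemx_sub // envelop_mx_id ?inE.
Qed.

Let v0_neq0 : v0 != 0.
Proof.
apply/eqP => /rowP/(_ (gring_index G 1)); rewrite -e1C /C ysym_ycoef mulmx_sumr summxE mxE.
rewrite (bigD1 1%g) //= -scalemxAr e1G !mxE !eqxx ycoef1 // mulr1 big1 ?addr0.
  by move/eqP; rewrite oner_eq0.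
move=> u u1; rewrite -scalemxAr e1G !mxE eqxx /=; case: eqP => [e|]; last by rewrite mulr0.
by have := congr1 enum_val e; rewrite !gring_indexK ?inE // => e'; rewrite -e' eqxx in u1.
Qed.

Section Kappa.
Variable kappa : F.
Hypothesis kappa0 : kappa != 0.
Hypothesis CC : C *m C = kappa *: C.
Hypothesis CgC : forall h, C *m aG h *m C = (kappa * ycoef F la h^-1) *: C.

Let v0C : v0 *m C = kappa *: v0.
Proof. by rewrite -e1C -mulmxA CC -scalemxAr. Qed.

Let VC m (U : 'M[F]_(m, #|G|)) : (U <= V)%MS -> (U *m C <= v0)%MS.
Proof.
move=> UV; apply/row_subP => i; rewrite row_mul.
have /cyclic_mxP[A AE ->] := submx_trans (row_sub i U) UV.
have [a ->] := envelop_mxP AE.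
rewrite mulmx_sumr mulmx_suml summx_sub // => g _.
rewrite -scalemxAr -scalemxAl -e1C -2!mulmxA [C *m _]mulmxA CgC -!scalemxAr e1C.
by rewrite !scalemx_sub.
Qed.

(** Left multiplication by u in the group algebra. The regular representation acts on the right, so
    this is the module endomorphism that sends the identity element to u. *)
Let left_mul (u : 'rV[F]_#|G|) : 'M[F]_#|G| := \matrix_i (u *m aG (enum_val i)).

Let left_mul_hom u m (U : 'M[F]_(m, #|G|)) : (U <= dom_hom_mx aG (left_mul u))%MS.
Proof.
apply/hom_mxP => g _; rewrite -!mulmxA; congr (_ *m _); apply/row_matrixP => i.
rewrite !row_mul rowK -rowE rowK gring_indexK ?inE // rowK -mulmxA -repr_mxM ?inE //.
Qed.

Let e1_left_mul u : e1 *m left_mul u = u.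
Proof. by rewrite /e1 -rowE rowK gring_indexK ?inE // repr_mx1 mulmx1. Qed.

(** C maps V into the line of v0. A submodule N with N C nonzero therefore contains v0 and is V. If
    N C = 0, the image u of the identity element under a Maschke projection P onto N is zero, and P
    with it. *)
Lemma specht_simple : mxsimple aG V.
Proof.
split; [exact: cyclic_mx_module|by rewrite cyclic_mx_eq0|move=> N modN NV N0].
have [NC0|NC] := eqVneq (N *m C) 0; last first.
  apply: cyclic_mx_sub => //.
  have [i Ni] : exists i, row i (N *m C) != 0.
    apply/existsP; apply: contraNT NC => /existsPn H; apply/eqP/row_matrixP => i.
    by rewrite row0; apply/eqP; rewrite -[_ == _]negbK.
  have : (row i (N *m C) <= v0)%MS by apply: submx_trans (row_sub _ _) (VC NV).
  case/sub_rVP => k rk; have k0 : k != 0 by apply: contraNneq Ni => k0; rewrite rk k0 scale0r.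
  have -> : v0 = k^-1 *: row i (N *m C) by rewrite rk scalerA mulVf // scale1r.
  apply: scalemx_sub; apply: submx_trans (row_sub _ _) _.
  exact: (mxmodule_envelop modN CE (submx_refl N)).
have [N' modN' defN dxN] := mx_Maschke_pchar aG charG modN (submx1 N).
move/mxdirect_addsP in dxN.
pose P := proj_mx N N'.
have homP : (1%:M <= dom_hom_mx aG P)%MS.
  by apply: submx_trans (proj_mx_hom dxN modN modN'); rewrite defN.
pose u := e1 *m P.
have uN : (u <= N)%MS by apply: proj_mx_sub.
have /cyclic_mxP[A AE uE] := submx_trans uN NV.
have uC : u *m C = 0 by apply/eqP; rewrite -submx0 -NC0 submxMr.
have homC B : (B \in enveloping_algebra_mx aG)%MS -> B *m P = P *m B.
  by move=> BE; have := hom_envelop_mxC homP BE; rewrite !mul1mx.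
have u0 : u = 0.
  (* As u lies in V, it is e1 C A for some A in the group algebra; hence u = u P = e1 P C A = u C A,
     and u C = 0. *)
  rewrite -(proj_mx_id dxN uN) -/P uE -mulmxA (homC A AE) -e1C -mulmxA.
  by rewrite (mulmxA C) (homC C CE) -(mulmxA P) (mulmxA e1) -/u (mulmxA u) uC mul0mx.
case/eqP: N0; rewrite -(proj_mx_id dxN (submx_refl N)) -/P.
suff -> : P = 0 by rewrite mulmx0.
apply/row_matrixP => i; rewrite row0 rowE -(gring_valK i) -e1G -mulmxA homC.
  by rewrite mulmxA -/u u0 mul0mx.
by rewrite envelop_mx_id ?inE.
Qed.

Let spec := specht F la n.

Lemma ysym_submod (U : 'M[F]_#|G|) (modU : mxmodule aG U) m (W : 'M[F]_(m, \rank U)) :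
  val_submod (W *m ysym la (submod_repr modU)) = val_submod W *m C.
Proof.
rewrite ysym_ycoef /C ysym_ycoef !mulmx_sumr linear_sum; apply: eq_bigr => g _.
by rewrite -!scalemxAr linearZ /= val_submodJ ?inE.
Qed.

(** The symmetrizer acts on V with image the line of v0, hence with rank 1, and its square is kappa
    times itself. *)
Lemma tr_ysym_specht : \tr (ysym la spec) = kappa.
Proof.
pose S := ysym la spec.
have vS m (W : 'M[F]_(m, \rank V)) : val_submod (W *m S) = val_submod W *m C.
  exact: ysym_submod.
have SS : S *m S = kappa *: S.
  apply: val_submod_inj; rewrite vS linearZ /= -[S in LHS]mul1mx -[S in RHS]mul1mx vS.
  by rewrite -mulmxA CC -scalemxAr.
rewrite -/S (mxtrace_quasi_idem SS) -[RHS]mulr1; congr (_ * _).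
suff -> : \rank S = 1%N by [].
have rS : (\rank S <= 1)%N.
  have <- : \rank (val_submod S) = \rank S by rewrite val_submodE mxrankMfree // /row_free val_submod1.
  apply: leq_trans (mxrankS (_ : _ <= v0)%MS) (rank_leq_row _).
  by rewrite -[S]mul1mx vS; apply: VC; apply: val_submodP.
apply/eqP; rewrite eqn_leq rS lt0n mxrank_eq0; apply: contraNneq v0_neq0 => S0.
have := vS _ (in_submod V v0); rewrite in_submodK ?cyclic_mx_id // v0C S0 mulmx0 linear0.
by move/esym/eqP; rewrite scaler_eq0 (negbTE kappa0).
Qed.

Lemma tr_ysym_rsim m1 m2 (rG1 : mx_representation F G m1) (rG2 : mx_representation F G m2) :
  mx_rsim rG1 rG2 -> \tr (ysym la rG1) = \tr (ysym la rG2).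
Proof.
move=> rs; rewrite !tr_ysym; apply: eq_bigr => g _.
by rewrite (mxtrace_rsim rs) ?inE.
Qed.

(** Realize the irreducible as U inside the regular representation. If u C is nonzero for some row u
    of U, left multiplication by u maps v0 to u C, and Schur's lemma makes it an isomorphism of V
    onto U. *)
Lemma tr_ysym_irr m (rG : mx_representation F G m) : mx_irreducible rG ->
  ~ mx_rsim rG spec -> \tr (ysym la rG) = 0.
Proof.
move=> irrG nsim.
have [U [modU sU]] := rsim_regular_submod_pchar irrG charG.
rewrite (tr_ysym_rsim sU).
have simU : mxsimple aG U by apply/submod_mx_irr; apply: mx_rsim_irr sU irrG.
have [UC|UC] := eqVneq (U *m C) 0.
  suff -> : ysym la (submod_repr modU) = 0 by rewrite mxtrace0.
  apply: val_submod_inj; rewrite -[ysym _ _]mul1mx ysym_submod linear0.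
  by apply/eqP; rewrite -submx0 -UC submxMr ?val_submodP.
have [i Ui] : exists i, row i (U *m C) != 0.
  apply/existsP; apply: contraNT UC => /existsPn H; apply/eqP/row_matrixP => i.
  by rewrite row0; apply/eqP; rewrite -[_ == _]negbK.
case: nsim; apply: mx_rsim_trans sU _; apply: mx_rsim_sym.
apply/(mx_rsim_iso (cyclic_mx_module aG v0) modU).
pose f := left_mul (row i U).
have v0f : v0 *m f = row i (U *m C).
  rewrite row_mul -e1C -mulmxA; have := hom_envelop_mxC (left_mul_hom (row i U) (1%:M : 'M_#|G|)) CE.
  by rewrite !mul1mx => ->; rewrite mulmxA e1_left_mul.
have Vf := hom_cyclic_mx (left_mul_hom (row i U) v0).
apply: (mx_Schur_iso specht_simple simU (left_mul_hom (row i U) V)).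
  rewrite Vf cyclic_mx_sub // v0f.
  apply: submx_trans (row_sub _ _) _; exact: (mxmodule_envelop modU CE (submx_refl U)).
by rewrite (eqmx_eq0 Vf) cyclic_mx_eq0 v0f.
Qed.

Lemma tr_ysym_multiplicity m (rG : mx_representation F G m) :
  \tr (ysym la rG) = kappa * (multiplicity spec rG)%:R.
Proof.
rewrite tr_ysym; pose sG := DecSocleType rG.
have S1 : Socle sG = 1%:M by apply: reducible_Socle1; apply: mx_Maschke_pchar charG.
have trE g : \tr (rG g) = \sum_(W : sG) \tr (socle_repr W g) *+ socle_mult W.
  rewrite -(mxtrace_Socle sG) ?inE //; apply/esym/mxtrace_rsim; rewrite ?inE //.
  by apply: rsim_submod1; rewrite S1.
under eq_bigr do rewrite trE mulr_sumr.
rewrite exchange_big /= /multiplicity natr_sum mulr_sumr [RHS]big_mkcond; apply: eq_bigr => W _.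
transitivity (\tr (ysym la (socle_repr W)) *+ socle_mult W).
  rewrite tr_ysym -sumrMnl; apply: eq_bigr => g _; by rewrite mulrnAr.
case: boolp.asboolP => [sim|nsim].
  by rewrite (tr_ysym_rsim sim) tr_ysym_specht mulr_natr.
rewrite tr_ysym_irr ?mul0rn //; apply/submod_mx_irr; exact: socle_simple.
Qed.
End Kappa.

(** Traces are class functions, so the Young symmetrizer may be averaged over conjugation before it
    is replaced by kappa times [jt_char]; then kappa cancels. *)
Lemma multiplicity_specht m (rG : mx_representation F G m) :
  (n`!)%:R * (multiplicity (specht F la n) rG)%:R = \sum_u \tr (rG u) * jt_char la F u.
Proof.
have [kappa [k0 kr CC CK]] := ysym_sq F la_n.
apply: (mulfI k0); rewrite mulrCA -(tr_ysym_multiplicity k0 CC CK) tr_ysym.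
have := sum_yclass la (f := fun u => \tr (rG u)) _; rewrite cardsT card_Sn => <-.
  rewrite mulr_sumr; apply: eq_bigr => u _.
  by rewrite (yclass_jt la_n kr CC CK) -mulrA [\tr _ * _]mulrC.
move=> u g; rewrite conjgE !repr_mxM ?inE // mxtrace_mulC.
by rewrite repr_mxK ?inE.
Qed.
End SpechtMultiplicity.

(** * Traces of Yang-Baxter representations *)

Section TraceFamily.
Variables (K : realType) (d : nat) (R : involutive_Rmatrix K d).
Notation F := (K[i]%C).

Lemma mxtrace_tcoef n (X : 'M[F]_(tdim d n)) : \tr X = \sum_x tcoef X x x.
Proof.
rewrite /mxtrace (reindex (@enum_rank {ffun 'I_n -> 'I_d})) //=.
exact/onW_bij/enum_rank_bij.
Qed.

Lemma mxtrace_legs k m (X : 'M[F]_(tdim d k)) (Y : 'M[F]_(tdim d m)) :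
  \tr (on_legs (@lshift k m) X *m on_legs (@rshift k m) Y) = \tr X * \tr Y.
Proof.
have lr (i : 'I_k) (j : 'I_m) : lshift m i != rshift k j.
  by rewrite eq_lrshift.
rewrite !mxtrace_tcoef big_distrlr /= pair_big /=.
pose G (p : {ffun 'I_k -> 'I_d} * {ffun 'I_m -> 'I_d}) : {ffun 'I_(k + m) -> 'I_d} :=
  [ffun i => match split i with inl a => p.1 a | inr b => p.2 b end].
have Gl p a : G p (lshift m a) = p.1 a by rewrite ffunE (unsplitK (inl a)).
have Gr p b : G p (rshift k b) = p.2 b by rewrite ffunE (unsplitK (inr b)).
rewrite (reindex G) /=; last first.
  exists (fun f : {ffun 'I_(k + m) -> 'I_d} =>
    ([ffun a => f (lshift m a)], [ffun b => f (rshift k b)])) => [[p q]|f] _.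
    by congr pair; apply/ffunP => i; rewrite ffunE ?Gl ?Gr.
  apply/ffunP => i; rewrite ffunE; case: (split_ordP i) => j -> /=; by rewrite ffunE.
apply: eq_bigr => p _; rewrite (tcoef_legs2 lr) ifT; last first.
  by apply/fintype.forallP => i; rewrite eqxx implybT.
have -> : [ffun l => G p (lshift m l)] = p.1 by apply/ffunP => i; rewrite ffunE Gl.
by have -> : [ffun l => G p (rshift k l)] = p.2 by apply/ffunP => i; rewrite ffunE Gr.
Qed.

Lemma rho_word n w : all (fun k => k < n.-1)%N w ->
  rho_R R n (word_perm n w) = word_mx (Radj R n) w.
Proof.
move=> aw; apply: (word_mx_eq (@Radj_sq _ _ R n) (@Radj_comm _ _ R n) (@Radj_braid _ _ R n)) => //.
  exact: perm_word_all.
exact: perm_wordK.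
Qed.

Lemma Radj_lshift k m i : (i < k.-1)%N ->
  Radj R (k + m) i = on_legs (@lshift k m) (Radj R k i).
Proof.
move=> ik; have h1 : (i.+1 < k)%N by lia.
have h2 : (i.+1 < k + m)%N by lia.
rewrite (RadjE _ h1) (RadjE _ h2) on_legs_comp; last exact: lshift_inj.
by apply: eq_on_legs => l; apply: val_inj; rewrite /= !val_site.
Qed.

Lemma Radj_rshift k m i : (i < m.-1)%N ->
  Radj R (k + m) (k + i) = on_legs (@rshift k m) (Radj R m i).
Proof.
move=> im; have h1 : (i.+1 < m)%N by lia.
have h2 : ((k + i).+1 < k + m)%N by lia.
rewrite (RadjE _ h1) (RadjE _ h2) on_legs_comp; last exact: rshift_inj.
by apply: eq_on_legs => l; apply: val_inj; rewrite /= !val_site; lia.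
Qed.

Lemma tr_conj n m (rG : mx_representation F [set: 'S_n] m) g h :
  \tr (rG (g ^ h)%g) = \tr (rG g).
Proof.
rewrite conjgE !repr_mxM ?inE // mxtrace_mulC.
by rewrite repr_mxK ?inE.
Qed.

Lemma card_tdim n : tdim d n = (d ^ n)%N.
Proof. by rewrite /tdim card_ffun !card_ord. Qed.

Lemma tr_rho_family : mult_class_family (fun n (g : 'S_n) => \tr (rho_R R n g)).
Proof.
split=> [|n g h|k m u v au av].
- by rewrite repr_mx1 mxtrace1 card_tdim.
- exact: tr_conj.
have au' : all (fun i => i < (k + m).-1)%N u by apply: sub_all au => i; lia.
have av' : all (fun i => i < (k + m).-1)%N (map (addn k) v).
  by rewrite all_map; apply: sub_all av => i /=; lia.
rewrite !rho_word ?all_cat ?au' // word_mx_cat -mxtrace_legs; congr (\tr (_ *m _)).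
  elim: u au {au'} => [_|i u IHu /= /andP[ik au]]; first by rewrite /= on_legs1.
  rewrite IHu // Radj_lshift // -on_legsM //; exact: lshift_inj.
elim: v av {av'} => [_|i v IHv /= /andP[im av]]; first by rewrite /= on_legs1.
rewrite IHv // Radj_rshift // -on_legsM //; exact: rshift_inj.
Qed.

Lemma porbits_full_cycle n : (0 < n)%N -> #|porbits (full_cycle n)| = 1%N.
Proof.
case: n => // n _; set c := full_cycle _.
have P (i : 'I_n.+1) : porbit c i = porbit c ord0.
  have H j : (j <= i)%N -> (c ^+ j)%g i = (i - j)%N :> nat.
    elim: j => [|j IHj] ji; first by rewrite expg0 perm1 subn0.
    rewrite expgSr permM full_cycleE IHj; last exact: ltnW.
    by case: eqP; lia.
  rewrite -(porbit_perm c i i); congr porbit; apply: val_inj.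
  by rewrite /= H // subnn.
rewrite (_ : porbits c = [set porbit c ord0]) ?cards1 //.
apply/setP => X; rewrite inE; apply/imsetP/eqP => [[i _ ->]|->]; first exact: P.
by exists ord0.
Qed.

Lemma tr_cycle1 : \tr (rho_R R 1 (full_cycle 1)) = d%:R.
Proof. by rewrite repr_mx1 mxtrace1 card_tdim expn1. Qed.

Lemma tr_cycle n : (0 < n)%N ->
  \tr (rho_R R n (full_cycle n)) = (d ^ n)%:R * chi_R R (full_cycle n).
Proof.
move=> n0; rewrite /chi_R mulrA mulfV ?mul1r // pnatr_eq0 -lt0n expn_gt0.
by rewrite (Rmx_dim R).
Qed.

(* The Newton coefficients of the traces on cycles are the multiplicities of
   the trivial representations. *)
Definition rho_t k : F := \tr (rho_R R k (full_cycle k)).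
Definition rho_Q n : F := (n`!)%:R^-1 * \sum_(g : 'S_n) \tr (rho_R R n g).

Lemma sum_tr_rho n : \sum_(g : 'S_n) \tr (rho_R R n g) = (n`!)%:R * rho_Q n.
Proof. by rewrite /rho_Q mulrA mulfV ?mul1r // pnatr_eq0 -lt0n fact_gt0. Qed.

Lemma rho_newton : newton rho_t rho_Q.
Proof.
split=> [|n n0].
  rewrite /rho_Q fact0 invr1 mul1r (eq_bigr (fun=> 1)) => [|g _].
    by rewrite sumr_const card_Sn.
  by rewrite -(mcf1 tr_rho_family); congr (\tr (rho_R _ _ _)); apply/permP; case.
have := sum_chi_step tr_rho_family n0 (fun i _ => sum_tr_rho i).
case: n n0 => // n _; rewrite sum_tr_rho factS mulnC natrM -mulrA => e.
by apply: (mulfI _ e); rewrite pnatr_eq0 -lt0n fact_gt0.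
Qed.

Lemma mult_JT la n : is_part_of n la ->
  (multiplicity (specht F la n) (rho_R R n))%:R = JT rho_Q (@part_fun la).
Proof.
move=> la_n; have n0 : (n`!)%:R != 0 :> F by rewrite pnatr_eq0 -lt0n fact_gt0.
apply: (mulfI n0); rewrite (multiplicity_specht la_n).
exact: (sum_chi_jt la_n tr_rho_family rho_newton).
Qed.

Lemma rho_Q_nat n : exists q : nat, rho_Q n = q%:R.
Proof.
case: n => [|n]; first by exists 1%N; case: rho_newton.
(* For a single row the Jacobi-Trudi determinant is 1 by 1. *)
exists (multiplicity (specht F [:: n.+1] n.+1) (rho_R R n.+1)).
rewrite mult_JT; last by rewrite /is_part_of /is_part /= addn0 eqxx.
by rewrite /JT [\det _]det_mx11 mxE /subz /part_fun /= addn0 subn0.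
Qed.

End TraceFamily.

(** * Thoma parameters and the generating function of the [rho_Q] *)

Section Thoma.
Import boolp ereal topology normedtype sequences numFieldNormedType.Exports.
Variable K : realType.

Lemma lim_series_finite (u : nat -> K) p : (forall i, (p <= i)%N -> u i = 0) ->
  limn (series u) = \sum_(i < p) u i.
Proof.
move=> u0; apply: lim_near_cst => //.
exists p => // n /= pn; rewrite /series /= (big_cat_nat _ (n := p)) //= big_mkord.
rewrite [X in _ + X]big_nat_cond [X in _ + X]big1 ?addr0 // => i /andP[/andP[pi _] _].
exact: u0.
Qed.

Lemma finite_le_nneseries (u : nat -> K) p : (forall i, 0 <= u i) ->
  ((\sum_(i < p) u i)%:E <= \sum_(0 <= i <oo) (u i)%:E)%E.
Proof.
move=> u0; rewrite -sumEFin -(big_mkord xpredT (fun i => (u i)%:E)).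
by apply: nneseries_lim_ge => i _ _; rewrite lee_fin.
Qed.

Lemma lim_series_scaled (d k : nat) (c : seq nat) (ga : nat -> K) :
  (0 < d)%N -> (0 < k)%N -> (forall i, (nth 0%N c i)%:R = d%:R * ga i) ->
  (d ^ k)%:R * limn (series (fun i => ga i ^+ k)) = \sum_(m <- c) m%:R ^+ k.
Proof.
move=> d0 k0 ec; rewrite (@lim_series_finite _ (size c)) => [|i ci].
  rewrite mulr_sumr (big_nth 0%N) big_mkord; apply: eq_bigr => i _.
  by rewrite ec exprMn natrX.
have /eqP : d%:R * ga i = 0 by rewrite -ec nth_default.
by rewrite mulf_eq0 pnatr_eq0 gtn_eqF // => /eqP ->; rewrite expr0n gtn_eqF.
Qed.
End Thoma.

Lemma hs_rmorph (S T : comNzRingType) (phi : {rmorphism S -> T}) a b k :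
  phi (hs a b k) = hs (map phi a) (map phi b) k.
Proof.
elim: a k => [|x a IHa] k; last first.
  rewrite /= -!/(hs _ _) /mulgeo rmorph_sum; apply: eq_bigr => i _.
  by rewrite rmorphM rmorphXn IHa.
elim: b k => [|y b IHb] k; first by rewrite /= /delta0 rmorph_nat.
by rewrite map_cons !hs_consr /mul1p rmorphD IHb; case: k => [|k]; rewrite ?rmorph0 // rmorphM IHb.
Qed.

Section Rescaled.
Variables (K : realType) (d : nat) (R : involutive_Rmatrix K d) (a b : seq nat).
Hypothesis hab : rescaled_thoma_parameters R a b.
Notation F := (K[i]%C).
Let aF : seq F := [seq m%:R | m <- a].
Let bF : seq F := [seq m%:R | m <- b].

Let tfF : torsion_free F.
Proof. by move=> k x /eqP; rewrite mulf_eq0 pnatr_eq0 => /eqP. Qed.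

Lemma rescaled_sum : (sumn a + sumn b <= d)%N.
Proof.
have [_ _ [alpha [beta [T ea eb]]]] := hab.
have d0 : (0 : K) < d%:R by rewrite ltr0n (Rmx_dim R).
have := thoma_sum T; move/(le_trans (constructive_ereal.leeD (finite_le_nneseries (size a) (thoma_alpha_ge0 T))
   (finite_le_nneseries (size b) (thoma_beta_ge0 T)))).
have sm (c : seq nat) (ga : nat -> K) : (forall i, (nth 0%N c i)%:R = d%:R * ga i) ->
    d%:R * \sum_(i < size c) ga i = (sumn c)%:R.
  move=> ec; rewrite sumnE (big_nth 0%N) big_mkord natr_sum mulr_sumr.
  by apply: eq_bigr => i _; rewrite ec.
rewrite -constructive_ereal.EFinD constructive_ereal.lee_fin -(ler_pM2l d0) mulrDr.
by rewrite (sm a) // (sm b) // mulr1 -natrD ler_nat.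
Qed.

Lemma rescaled_rho_t k : (2 <= k)%N ->
  rho_t R k = \sum_(x <- aF) x ^+ k - \sum_(y <- bF) (- y) ^+ k.
Proof.
move=> k2; have [_ _ [alpha [beta [T ea eb]]]] := hab.
have k0 : (0 < k)%N by exact: ltnW.
rewrite /rho_t (tr_cycle _ k0) (thoma_cycle T k2 (porbits_full_cycle k0)).
rewrite -(rmorph_nat (real_complex K)) -rmorphM mulrDr mulrCA.
rewrite !(lim_series_scaled (Rmx_dim R) k0 ea) !(lim_series_scaled (Rmx_dim R) k0 eb).
rewrite rmorphD rmorphM !rmorph_sum rmorphXn rmorphN1 /aF /bF !big_map; congr (_ + _).
  by apply: eq_bigr => m _; rewrite rmorphXn rmorph_nat.
rewrite mulr_sumr -sumrN; apply: eq_bigr => m _; rewrite rmorphXn rmorph_nat.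
by rewrite [(- _) ^+ k]exprNn exprS mulN1r mulNr.
Qed.

(** The amount by which the sum of the rescaled parameters may fall short of d. It contributes to
    t_1 only. *)
Let ga := (d - (sumn a + sumn b))%N.

Let sumF (c : seq nat) : \sum_(x <- [seq m%:R | m <- c] : seq F) x = (sumn c)%:R.
Proof. by rewrite big_map sumnE natr_sum. Qed.

Lemma rescaled_rho_t_gamma k : (0 < k)%N ->
  rho_t R k = \sum_(x <- aF) x ^+ k - \sum_(y <- bF) (- y) ^+ k + (ga * (k == 1))%:R.
Proof.
case: k => // -[|k] _; last by rewrite rescaled_rho_t // muln0 addr0.
rewrite /rho_t tr_cycle1 muln1 /ga natrB ?rescaled_sum //.
rewrite (eq_bigr id) => [|x _]; last by rewrite expr1.
rewrite [X in _ - X + _](eq_bigr (fun y => - y)) => [|x _]; last by rewrite expr1.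
rewrite sumrN opprK !sumF natrD; ring.
Qed.

(** The effect of a factor 1 + y z on the sequence n! h_n: natural numbers stay natural, and the
    value at n does not change modulo n. *)
Let mulE y (H : nat -> nat) n := (H n + n * y * H n.-1)%N.

Let exp_fold n : (n`!)%:R * foldr (@mul1p F) (fun n => (ga ^ n)%:R / (n`!)%:R) bF n =
  (foldr mulE (fun n => ga ^ n)%N b n)%:R.
Proof.
have f0 m : (m`!)%:R != 0 :> F by rewrite pnatr_eq0 -lt0n fact_gt0.
rewrite /bF; elim: b n => [|y c IHc] n /=; first by rewrite mulrCA divff // mulr1.
rewrite /mul1p /mulE mulrDr IHc natrD; congr (_ + _).
case: n => [|n]; first by rewrite mulr0 !mul0n.
by rewrite /= factS !natrM -IHc; ring.
Qed.

(* With D the coefficients of \prod_b (1 + b z) * exp (ga z), which are integers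
   because D = \prod_a (1 - a z) * Q, one has p! D_p = ga^p modulo p for every
   prime p; so a prime p > ga > 0 would divide ga^p. *)
Lemma gamma_eq0 : (sumn a + sumn b = d)%N.
Proof.
suff g0 : ga = 0%N by have := rescaled_sum; rewrite /ga in g0; lia.
apply/eqP/negPn/negP => g0.
have ex n : exists q : nat, rho_Q R n == q%:R.
  by have [q ->] := rho_Q_nat R n; exists q.
pose Q n : int := Posz (xchoose (ex n)).
have QE n : rho_Q R n = (Q n)%:~R by rewrite (eqP (xchooseP (ex n))) -pmulrn.
pose D := foldr (@mul1p int) Q [seq - Posz m | m <- a].
have newD : newton (fun k => (ga * (k == 1))%:R - \sum_(y <- bF) (- y) ^+ k) (fun n => (D n)%:~R : F).
  have : newton (fun k => rho_t R k - \sum_(x <- aF) x ^+ k) (fun n => (D n)%:~R : F).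
    rewrite /D /aF; elim: (a) => [|m c IHc].
      apply: eq_newton (rho_newton R) => [n _|n] /=; last by rewrite QE.
      by rewrite big_nil subr0.
    apply: eq_newton (newton_mul1p (- m%:R) IHc) => [n _|n] /=.
      by rewrite big_cons opprK; ring.
    by rewrite /mul1p rmorphD; case: n => [|n]; rewrite ?rmorph0 // rmorphM rmorphN.
  apply: eq_newton => // n n0; rewrite rescaled_rho_t_gamma //; ring.
have newE : newton (fun k => (ga * (k == 1))%:R - \sum_(y <- bF) (- y) ^+ k)
    (foldr (@mul1p F) (fun n => (ga ^ n)%:R / (n`!)%:R) bF).
  rewrite /bF; elim: (b) => [|y c IHc] /=.
    split=> [|n n0]; first by rewrite expn0 fact0 divr1.
    case: n n0 => // n _; rewrite big_ord_recr /= big1 ?add0r => [|i _].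
      rewrite subSnn eqxx muln1 big_nil subr0 factS expnS !natrM invfM.
      have n1 : n.+1%:R != 0 :> F by rewrite pnatr_eq0.
      by rewrite mulrACA (mulrC ga%:R) -mulrA mulVKf.
    have -> : (n.+1 - i == 1)%N = false by apply/negbTE; have := ltn_ord i; lia.
    by rewrite big_nil subr0 muln0 mul0r.
  apply: eq_newton (newton_mul1p y%:R IHc) => // n _.
  by rewrite big_cons; ring.
have DE := newton_uniq tfF newD newE.
have key n : (Posz n`! * D n)%R = Posz (foldr mulE (fun n => ga ^ n)%N b n).
  apply: (@intr_inj F); rewrite rmorphM /= DE -!pmulrn -exp_fold //.
have [p pp gp] : exists2 p, prime p & (ga < p)%N.
  by have [p gp pp] := prime_above ga; exists p.
have mE c : (foldr mulE (fun n => ga ^ n) c p = ga ^ p %[mod p])%N.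
  by elim: c => //= y c IHc; rewrite /mulE -mulnA mulnC addnC modnMDl.
have pD : (p %| ga ^ p)%N.
  rewrite /dvdn -(mE b) -/(dvdn _ _); have := key p; move/(congr1 absz).
  by rewrite abszM !absz_nat => <-; rewrite dvdn_mulr // dvdn_fact // prime_gt0 //=.
rewrite Euclid_dvdX // in pD; case/andP: pD => pD _.
by have := dvdn_leq _ pD; rewrite lt0n g0 leqNgt gp => /(_ isT).
Qed.

Lemma rho_Q_hs n : rho_Q R n = hs aF bF n.
Proof.
have N1 : newton (fun k => \sum_(x <- aF) x ^+ k - \sum_(y <- bF) (- y) ^+ k) (rho_Q R).
  apply: eq_newton (rho_newton R) => // k k0; rewrite rescaled_rho_t_gamma //.
  by rewrite /ga gamma_eq0 subnn mul0n addr0.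
exact: newton_uniq tfF N1 (newton_hs aF bF) n.
Qed.

Lemma mult_JT_hs n (la : seq nat) : is_part_of n la ->
  Posz (multiplicity (specht F la n) (rho_R R n)) =
  JT (hs (map Posz a) (map Posz b)) (@part_fun la).
Proof.
move=> hla; apply: (@intr_inj F); rewrite -pmulrn (mult_JT R hla) [RHS]det_rmorph.
congr (\det _); apply/matrixP => i j; rewrite !mxE /subz.
case: ifP => _; last by rewrite rmorph0.
by rewrite rho_Q_hs hs_rmorph -!map_comp.
Qed.
End Rescaled.

(** * Rectangles, shifted partitions and the product formula *)

Lemma JT_pad (R : comNzRingType) (h : nat -> R) la l : h 0%N = 1 -> (size la <= l)%N ->
  JT h (fun i : 'I_l => nth 0%N la i) = JT h (@part_fun la).
Proof.
move=> h0 /subnKC <-; elim: (l - size la)%N => [|k IHk]; first by rewrite addn0.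
by rewrite addnS JT_recr //= nth_default // leq_addr.
Qed.

Lemma nth_filter_pos s i : sorted geq s ->
  nth 0%N [seq r <- s | 0 < r]%N i = nth 0%N s i.
Proof.
elim: s i => [|x s IHs] i //= srt; case: ifP => x0.
  by case: i => //= i; rewrite IHs // (path_sorted srt).
move/negbT: x0; rewrite -eqn0Ngt => /eqP x0; rewrite {x}x0 in srt *.
have s0 : all (pred1 0%N) s.
  have tr : transitive geq by move=> u v w vu uw; apply: leq_trans uw vu.
  by have := order_path_min tr srt; apply: sub_all => y; rewrite /= leqn0.
rewrite (eq_in_filter (a2 := pred0)) ?filter_pred0 => [|y /(allP s0)/eqP -> //].
rewrite nth_nil; case: i => //= i.
by have [il|il] := ltnP i (size s); [rewrite (eqP (allP s0 _ (mem_nth 0%N il)))|rewrite nth_default].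
Qed.

Section ShiftPart.
Variables (la : seq nat) (l c : nat).
Hypothesis ni : forall i j, (i <= j)%N -> (nth 0 la j <= nth 0 la i)%N.

Lemma nth_shift_part i :
  nth 0%N (shift_part la l c) i = if (i < l)%N then (nth 0%N la i - c)%N else 0%N.
Proof.
rewrite nth_filter_pos; last first.
  rewrite sorted_map; apply: sub_sorted (iota_sorted 0 l) => i1 i2 /= le12.
  by rewrite leq_sub2r // ni.
case: ltnP => il; last by rewrite nth_default // size_map size_iota.
by rewrite (nth_map 0%N) ?size_iota // nth_iota.
Qed.

Lemma size_shift_part : (size (shift_part la l c) <= l)%N.
Proof. by rewrite size_filter (leq_trans (count_size _ _)) // size_map size_iota. Qed.

Lemma sf_eval_shift_part (A : comNzRingType) (a : seq A) : torsion_free A ->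
  sf_eval (schur A (shift_part la l c)) a =
  JT (hs a [::]) (fun i : 'I_l => nth 0%N la i - c)%N.
Proof.
move=> tf; rewrite sf_eval_schur // -(JT_pad (hs0 _ _) size_shift_part).
by apply: eq_JT => // i; rewrite nth_shift_part ltn_ord.
Qed.
End ShiftPart.

Lemma nth_conj_part la j : (forall i k, (i <= k)%N -> (nth 0 la k <= nth 0 la i)%N) ->
  nth 0%N (conj_part la) j = count (fun r => j < r)%N la.
Proof.
move=> ni; have [jh|jh] := ltnP j (head 0%N la).
  by rewrite (nth_map 0%N) ?size_iota // nth_iota.
rewrite nth_default ?size_map ?size_iota //; apply/esym/eqP; rewrite -leqn0 leqNgt -has_count.
by apply/hasPn => x /(nthP 0%N)[i _ <-]; rewrite -leqNgt (leq_trans (ni 0%N i _)) ?nth0.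
Qed.

Lemma contains_rectE la p q : (forall i k, (i <= k)%N -> (nth 0 la k <= nth 0 la i)%N) ->
  contains_rect la p.+1 q.+1 <-> (q < nth 0 la p)%N.
Proof.
move=> ni; split=> [H|H i j]; first by have := H p q; rewrite /in_diagram nth_nseq leqnn; apply.
rewrite /in_diagram nth_nseq; case: (ltnP i p.+1) => // ip jq.
exact: (leq_trans (leq_trans jq H) (ni i p ip)).
Qed.

Lemma hook_part la p q : (forall i k, (i <= k)%N -> (nth 0 la k <= nth 0 la i)%N) ->
  hook p q (@part_fun la) = (nth 0 la p <= q)%N.
Proof.
move=> ni; apply/hookP/idP => [H|H i pi]; last by apply: leq_trans (ni _ _ pi) H.
by have [pl|pl] := ltnP p (size la); [apply: (H (Ordinal pl))|rewrite nth_default].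
Qed.

Lemma is_part_nonincr n la : is_part_of n la ->
  forall i k, (i <= k)%N -> (nth 0 la k <= nth 0 la i)%N.
Proof. by move=> la_n i k; apply: part_noninc la_n _ _. Qed.

Section Factorization.
Variables (a b la : seq nat).
Hypothesis ni : forall i j, (i <= j)%N -> (nth 0 la j <= nth 0 la i)%N.
Hypothesis big_rect : contains_rect la (size a) (size b).
Hypothesis no_rect : (nth 0 la (size a) <= size b)%N.
Let p := size a.
Let q := size b.

Let wide i : (i < p)%N -> (q <= nth 0 la i)%N.
Proof.
move=> ip; have [->//|q0] := posnP q.
have := @big_rect i q.-1; rewrite /in_diagram nth_nseq ip prednK //.
by apply.
Qed.

(** Column j < q meets all of the first p rows, so subtracting p leaves the boxes of that column
    below them. *)
Let count_cj (j : 'I_q) :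
  (count (fun r => j < r)%N la - p)%N = cj (fun i : 'I_(size la) => nth 0%N la (p + i)) j.
Proof.
have -> : count (fun r => j < r)%N la = (\sum_(i < p + size la) (j < nth 0 la i))%N.
  transitivity (\sum_(0 <= i < p + size la) (j < nth 0 la i))%N; last by rewrite big_mkord.
  rewrite -sum1_count big_mkcond (big_nth 0%N) [RHS](big_cat_nat _ (n := size la)) //= ?leq_addl //.
  rewrite [X in (_ + X)%N]big_nat_cond [X in (_ + X)%N]big1 ?addn0.
    by apply: eq_bigr => i _; case: ifP.
  by move=> i /andP[/andP[il _] _]; rewrite nth_default.
rewrite big_split_ord /= (eq_bigr (fun=> 1%N)) => [|i _]; last first.
  by rewrite (leq_trans (ltn_ord j) (wide (ltn_ord i))).
rewrite sum1_card card_ord addKn /cj -sum1_card [RHS]big_mkcond.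
by apply: eq_bigr => i _; rewrite inE; case: ifP.
Qed.

(** The rectangle splits the determinant after row p. The upper block has all parts at least q and
    yields the product and s_mu(a); the lower block involves b only, has parts at most q, and is
    s_nu(b) by duality. *)
Lemma JT_factor :
  JT (hs (map Posz a) (map Posz b)) (@part_fun la) =
  sf_eval (schur int (shift_part la p q)) (map Posz a) *
  sf_eval (schur int (shift_part (conj_part la) q p)) (map Posz b) *
  \prod_(i < p) \prod_(j < q) Posz (nth 0 a i + nth 0 b j)%N.
Proof.
(* Padding by p zero parts puts the index in the form p + k, also when q = 0 and la has fewer than p
   parts. *)
rewrite -(JT_pad (hs0 _ _) (leq_addl p (size la))).
rewrite (@JT_split _ (map Posz a) (map Posz b) p (size la)) ?size_map //= => [|i]; last exact: wide.
rewrite (@sf_eval_shift_part la p q ni) //; last exact: torsion_free_int.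
have nic i k : (i <= k)%N -> (nth 0 (conj_part la) k <= nth 0 (conj_part la) i)%N.
  by move=> ik; rewrite !nth_conj_part //; apply: sub_count => r /= kr; apply: leq_ltn_trans kr.
rewrite (@sf_eval_shift_part (conj_part la) q p nic) //; last exact: torsion_free_int.
rewrite [X in _ = _ * X * _](@eq_JT _ _ (hs (map Posz b) [::]) _ _ (@cj q _ (fun i : 'I_(size la) => nth 0%N la (p + i)))) //; last first.
  by move=> j; rewrite nth_conj_part // count_cj.
rewrite -JT_dual; first last.
- by move=> i; apply: leq_trans (ni _) no_rect; rewrite leq_addr.
- by apply/nonincrP => i j ij; apply: ni; rewrite leq_add2l.
have sq (A B : seq int) l (mu : 'I_l -> nat) : size A = l ->
    JT (hs A B) (fun i => mu i + size B)%N =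
    (\prod_(i < l) \prod_(y <- B) (nth 0 A i + y)) * JT (hs A [::]) mu.
  by move=> sA; case: l / sA mu => mu; rewrite JT_square.
rewrite mulrAC; congr (_ * _); rewrite mulrC.
have -> : \prod_(i < p) \prod_(j < q) Posz (nth 0%N a i + nth 0%N b j) =
    \prod_(i < p) \prod_(y <- map Posz b) (nth 0 (map Posz a) i + y).
  apply: eq_bigr => i _; rewrite big_map (big_nth 0%N) big_mkord.
  by apply: eq_bigr => j _; rewrite (nth_map 0%N).
rewrite -sq ?size_map //; apply: eq_JT => // i.
by rewrite subnK // wide.
Qed.
End Factorization.

Theorem proposition5p7 (K : realType) (d : nat) (R : involutive_Rmatrix K d)
    (a b : seq nat) (hab : rescaled_thoma_parameters R a b)
    (n : nat) (hn : (0 < n)%N) (la : seq nat) (hla : is_part_of n la) :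
  let mult := multiplicity (specht K[i]%C la n) (rho_R R n) in
  let mu := shift_part la (size a) (size b) in
  let nu := shift_part (conj_part la) (size b) (size a) in
  [/\ mult%:Z = sf_eval2 (id_tens_omega (Delta (schur int la))) (map Posz a) (map Posz b),
      mult = 0%N <-> contains_rect la (size a).+1 (size b).+1 &
      contains_rect la (size a) (size b) ->
      ~ contains_rect la (size a).+1 (size b).+1 ->
      mult%:Z = sf_eval (schur int mu) (map Posz a)
                * sf_eval (schur int nu) (map Posz b)
                * \prod_(i < size a) \prod_(j < size b)
                    (nth 0%N a i + nth 0%N b j)%:Z].
Proof.
have ni := is_part_nonincr hla.
have multE := mult_JT_hs hab hla.
have pos c : is_part c -> all (fun x => 0 < x) (map Posz c).
  case/andP=> _ c0; rewrite all_map; apply/allP => x xc /=.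
  by rewrite ltz_nat lt0n; apply: contraNneq c0 => <-.
have nila : nonincr (@part_fun la) by apply/nonincrP => i j; apply: ni.
have [_] := JT_hs_pos (pos a (thoma_a_part hab)) (pos b (thoma_b_part hab)) nila.
rewrite -multE ltz_nat !size_map (hook_part _ _ ni) => mult0 mult mu nu.
split=> [||big_rect].
- by rewrite multE sf_eval2_schur.
- rewrite (contains_rectE _ _ ni) ltnNge -mult0 lt0n negbK.
  exact: (rwP eqP).
rewrite (contains_rectE _ _ ni) => /negP; rewrite -leqNgt => no_rect.
by rewrite [LHS]multE (JT_factor ni big_rect no_rect).
Qed.
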